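(* Let $n\ge2$, $R,R_1>0$, let $\Omega_1\subset B_{R_1}\subset\mathbb{R}^n$ be a convex body containing the origin, with support function $h_1$, and set $$M=\frac{1}{n\kappa_n}\int_{\mathbb{S}^{n-1}}\bigl(h_1-R\bigr)\,d\sigma=\frac{w(\Omega_1)-w(B_R)}{2},\qquad c_{R,n}=\frac{n\kappa_n}{(2\pi)^{n/2}}\,R^{n-1}u_n'(R)^2e^{-R^2/2}.$$ Then there exist $t_1,C>0$ depending only on $n,R,R_1$ such that $$T_\gamma\bigl((1-t)B_R+t\Omega_1\bigr)\ge T_\gamma(B_R)+c_{R,n}Mt-Ct^2\qquad\text{for }0<t\le t_1 .$$ In particular, if $w(\Omega_1)>2R$, then $T_\gamma((1-t)B_R+t\Omega_1)>T_\gamma(B_R)$ for all sufficiently small $t>0$.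
   Context: $\gamma$ is the standard Gaussian measure on $\mathbb{R}^n$, $d\gamma=(2\pi)^{-n/2}e^{-|x|^2/2}\,dx$. For a bounded open set $\Omega\subset\mathbb{R}^n$, the torsion function $u_\Omega$ is the solution of $\Delta u-x\cdot\nabla u=-1$ in $\Omega$, $u=0$ on $\partial\Omega$, and $T_\gamma(\Omega)=\int_\Omega u_\Omega\,d\gamma$. A convex body $K$ is a compact convex set with nonempty interior, and $T_\gamma(K):=T_\gamma(\operatorname{int}K)$. $B_R$ is the (closed) ball of radius $R$ centered at the origin. $\kappa_n$ is the volume of the unit ball of $\mathbb{R}^n$ and $\sigma$ is the surface measure on $\mathbb{S}^{n-1}$ (total mass $n\kappa_n$). The support function of $K$ is $h_K(\xi)=\max_{z\in K}z\cdot\xi$, $\xi\in\mathbb{S}^{n-1}$, and $h_1=h_{\Omega_1}$. The mean width is $w(K)=\frac{2}{n\kappa_n}\int_{\mathbb{S}^{n-1}}h_K\,d\sigma$, so $w(B_R)=2R$. Sums and multiples of sets are in the Minkowski sense. The function $u_n$ is the solution of $u_n''+\frac{n-1}{r}u_n'-ru_n'=-1$, $u_n(0)=u_n'(0)=0$, so that $u_n'(r)=-r^{1-n}e^{r^2/2}\int_0^r s^{n-1}e^{-s^2/2}\,ds$ for $r>0$. *)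

(* Defs.v *)
From HB Require Import structures.
From mathcomp Require Import all_boot all_order all_algebra.
From mathcomp Require Import all_classical all_reals all_analysis.
From mathcomp Require Import measurable_realfun.

Set Implicit Arguments.
Unset Strict Implicit.
Unset Printing Implicit Defensive.

Import Order.TTheory GRing.Theory Num.Theory.
Import numFieldNormedType.Exports.

Local Open Scope classical_set_scope.
Local Open Scope ring_scope.

(** R^n is 'rV[R]_n. The library's norm on matrices is the sup norm, which gives
    the usual topology but not the usual length; hence [enorm]. *)

Definition edot (R : realType) (n : nat) (x y : 'rV[R]_n) : R :=
  \sum_(i < n) x 0 i * y 0 i.

Definition enorm (R : realType) (n : nat) (x : 'rV[R]_n) : R :=
  Num.sqrt (edot x x).

Definition cball (R : realType) (n : nat) (r : R) : set 'rV[R]_n :=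
  [set x | enorm x <= r].

Arguments cball {R} n r.

Definition sphere (R : realType) (n : nat) : set 'rV[R]_n :=
  [set x | enorm x = 1].

Arguments sphere R n : clear implicits.

(** The measurable sets of R^n are those of the product sigma-algebra, that is
    the Borel sets. *)

Definition measure_row_display : measure_display -> measure_display.
Proof. exact. Qed.

Section measurable_row.
Context {d} {T : measurableType d}.
Variable n : nat.

Let coords : 'I_n -> 'rV[T]_n -> T := fun i x => x 0 i.

Let row_set0 : g_sigma_preimage coords set0.
Proof. exact: sigma_algebra0. Qed.

Let row_setC A : g_sigma_preimage coords A -> g_sigma_preimage coords (~` A).
Proof. exact: sigma_algebraC. Qed.

Let row_bigcup (F : _^nat) : (forall i, g_sigma_preimage coords (F i)) ->
  g_sigma_preimage coords (\bigcup_i (F i)).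
Proof. exact: sigma_algebra_bigcup. Qed.

HB.instance Definition _ := @isMeasurable.Build (measure_row_display d)
  'rV[T]_n (g_sigma_preimage coords) row_set0 row_setC row_bigcup.

Lemma measurable_coord (i : 'I_n) :
  measurable_fun [set: 'rV[T]_n] (fun x : 'rV[T]_n => x 0 i).
Proof.
move=> _ Y mY; rewrite setTI; apply: sub_sigma_algebra => /=.
rewrite -bigcup_seq/=; exists i => /=; first by rewrite mem_index_enum.
by exists Y => //; rewrite setTI.
Qed.

Lemma measurable_rowP d1 (T1 : measurableType d1) (f : T1 -> 'rV[T]_n) :
  (forall i, measurable_fun setT (fun x => f x 0 i)) -> measurable_fun setT f.
Proof.
move=> mf _ A mA; rewrite setTI.
have : g_sigma_preimage coords `<=` [set B | measurable (f @^-1` B)].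
  apply: smallest_sub => /=.
    split => /=.
    - by rewrite preimage_set0.
    - by move=> B mB; rewrite setTD preimage_setC; exact: measurableC.
    - by move=> F mF; rewrite preimage_bigcup; exact: bigcup_measurable.
  rewrite -bigcup_seq => B [i _ [C mC <-]] /=; rewrite setTI.
  by rewrite -comp_preimage -[X in measurable X]setTI; exact: mf.
by apply.
Qed.

End measurable_row.

Arguments measurable_coord {d T n} i.

Definition row_cons (R : realType) (n : nat)
    (p : measurableTypeR R * 'rV[R]_n) : 'rV[R]_n.+1 :=
  \row_(i < n.+1) (if unlift ord0 i is Some j then p.2 0 j else p.1).

Lemma measurable_row_cons (R : realType) (n : nat) :
  measurable_fun setT (@row_cons R n).
Proof.
apply: measurable_rowP => i.
rewrite (_ : (fun x => _) = fun p : measurableTypeR R * 'rV[R]_n =>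
    if unlift ord0 i is Some j then p.2 0 j else p.1); last first.
  by apply/funext => p; rewrite mxE.
case: (unlift ord0 i) => [j|]; last exact: measurable_fst.
exact: (measurableT_comp (measurable_coord j) measurable_snd).
Qed.

Section lebesgue_succ.
Context (R : realType) (n : nat).
Variable m : {sigma_finite_measure set 'rV[R]_n -> \bar R}.

Definition lebesgue_succ : set 'rV[R]_n.+1 -> \bar R :=
  pushforward (@lebesgue_measure R \x m)%E (@row_cons R n).

Let pf : {measure set 'rV[R]_n.+1 -> \bar R} :=
  measure_function_pushforward__canonical__measure_function_Measure
    (@lebesgue_measure R \x m)%E (@measurable_row_cons R n).

Let succ0 : lebesgue_succ set0 = 0%E.
Proof. exact: (measure0 pf). Qed.

Let succ_ge0 A : (0 <= lebesgue_succ A)%E.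
Proof. exact: (measure_ge0 pf). Qed.

Let succ_sigma_additive : semi_sigma_additive lebesgue_succ.
Proof. exact: (@measure_semi_sigma_additive _ _ _ pf). Qed.

HB.instance Definition _ := isMeasure.Build _ _ _
  lebesgue_succ succ0 succ_ge0 succ_sigma_additive.

Let row_uncons (x : 'rV[R]_n.+1) : measurableTypeR R * 'rV[R]_n :=
  (x 0 ord0, \row_j x 0 (lift ord0 j)).

Let row_consK : cancel (@row_cons R n) row_uncons.
Proof.
move=> [a y]; rewrite /row_uncons /row_cons mxE unlift_none /=; congr pair.
by apply/rowP => j; rewrite !mxE liftK.
Qed.

Let measurable_row_uncons : measurable_fun setT row_uncons.
Proof.
apply/measurable_fun_pairP; split; first exact: (measurable_coord ord0).
apply: measurable_rowP => j.
rewrite (_ : (fun x => _) = fun x : 'rV[R]_n.+1 => x 0 (lift ord0 j)).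
  exact: measurable_coord.
by apply/funext => x; rewrite /= mxE.
Qed.

Let succ_sigma_finite : sigma_finite setT lebesgue_succ.
Proof.
have /sigma_finiteP[F [TF ndF Foo]] := sigma_finiteT (@lebesgue_measure R).
have /sigma_finiteP[G [TG ndG Goo]] := sigma_finiteT m.
exists (fun k => row_uncons @^-1` (F k `*` G k)).
  apply/seteqP; split=> // x _.
  have [i _ Fi] : (\bigcup_i F i) (row_uncons x).1 by rewrite -TF.
  have [j _ Gj] : (\bigcup_i G i) (row_uncons x).2 by rewrite -TG.
  exists (maxn i j) => //; split.
    by move: Fi; apply/subsetPset/ndF; rewrite leq_maxl.
  by move: Gj; apply/subsetPset/ndG; rewrite leq_maxr.
move=> k; have [mFk Fk] := Foo k; have [mGk Gk] := Goo k; split.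
  rewrite -[X in measurable X]setTI; apply: measurable_row_uncons => //.
  exact: measurableX.
rewrite /lebesgue_succ /pushforward -comp_preimage.
rewrite (_ : row_uncons \o _ = id); last first.
  by apply/funext => p; exact: row_consK.
by rewrite preimage_id product_measure1E// lte_mul_pinfty// ge0_fin_numE.
Qed.

HB.instance Definition _ := Measure_isSigmaFinite.Build _ _ _
  lebesgue_succ succ_sigma_finite.

End lebesgue_succ.

Fixpoint lebesgue_row (R : realType) (n : nat) :
    {sigma_finite_measure set 'rV[R]_n -> \bar R} :=
  match n with
  | 0 => \d_(0 : 'rV[R]_0)
  | m.+1 => lebesgue_succ (lebesgue_row R m)
  end.

Section gaussian_measure.
Context (R : realType) (n : nat).

Definition gauss_density (x : 'rV[R]_n) : R :=
  (2 * pi) `^ (- (n%:R / 2)) * expR (- (enorm x ^+ 2 / 2)).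

Definition gauss_row (A : set 'rV[R]_n) : \bar R :=
  (\int[lebesgue_row R n]_(x in A) (gauss_density x)%:E)%E.

Lemma measurable_enorm : measurable_fun setT (@enorm R n).
Proof.
apply: (measurableT_comp (f := @Num.sqrt R)).
  by apply: continuous_measurable_fun; exact: sqrt_continuous.
apply: measurable_sum => i.
by apply: measurable_funM; exact: measurable_coord.
Qed.

Lemma gauss_density_ge0 x : 0 <= gauss_density x.
Proof. by rewrite mulr_ge0// ?powR_ge0// expR_ge0. Qed.

Lemma measurable_gauss_density : measurable_fun setT gauss_density.
Proof.
apply: measurable_funM => //; apply: measurableT_comp => //.
apply: measurableT_comp => //; apply: measurable_funM => //.
by apply: measurable_funX; exact: measurable_enorm.
Qed.

Let gauss0 : gauss_row set0 = 0%E.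
Proof. by rewrite /gauss_row integral_set0. Qed.

Let gauss_ge0 A : (0 <= gauss_row A)%E.
Proof. by apply: integral_ge0 => x _; rewrite lee_fin gauss_density_ge0. Qed.

Let gauss_sigma_additive : semi_sigma_additive gauss_row.
Proof.
move=> F mF tF mUF; rewrite /gauss_row ge0_integral_bigcup//.
- apply: is_cvg_ereal_nneg_natsum_cond => k _ _.
  by apply: integral_ge0 => x _; rewrite lee_fin gauss_density_ge0.
- by apply/measurable_EFinP/measurable_funTS; exact: measurable_gauss_density.
- by move=> x _; rewrite lee_fin gauss_density_ge0.
Qed.

HB.instance Definition _ := isMeasure.Build _ _ _
  gauss_row gauss0 gauss_ge0 gauss_sigma_additive.

End gaussian_measure.

Arguments gauss_row R n : clear implicits.

(** The surface measure of a subset A of the sphere is n times the volume of the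
    cone {x | |x| <= 1, x / |x| in A}. For n >= 1 it is carried by [sphere]: the
    origin, whose [direction] is 0, is negligible. *)

Section sphere_measure.
Context (R : realType) (n : nat).

Definition direction (x : 'rV[R]_n) : 'rV[R]_n := (enorm x)^-1 *: x.

Definition sphere_measure (A : set 'rV[R]_n) : \bar R :=
  (n%:R%:E * lebesgue_row R n (cball n 1 `&` direction @^-1` A))%E.

Lemma measurable_direction : measurable_fun setT direction.
Proof.
apply: measurable_rowP => i.
rewrite (_ : (fun x => _) = fun x : 'rV[R]_n => enorm x `^ (-1) * x 0 i).
  apply: measurable_funM; last exact: measurable_coord.
  apply: (measurableT_comp (f := fun y : R => y `^ (-1))).
    exact: measurable_powR.
  exact: measurable_enorm.
by apply/funext => x; rewrite mxE powR_inv1// sqrtr_ge0.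
Qed.

Lemma measurable_cball (r : R) : measurable (@cball R n r).
Proof.
rewrite (_ : cball n r = @enorm R n @^-1` `]-oo, r]).
  by rewrite -[X in measurable X]setTI; exact: measurable_enorm.
by apply/seteqP; split=> x /=; rewrite in_itv.
Qed.

Let mcone A : measurable A -> measurable (cball n 1 `&` direction @^-1` A).
Proof.
move=> mA; apply: measurableI; first exact: measurable_cball.
by rewrite -[X in measurable X]setTI; exact: measurable_direction.
Qed.

Let sphere0 : sphere_measure set0 = 0%E.
Proof. by rewrite /sphere_measure preimage_set0 setI0 measure0 mule0. Qed.

Let sphere_ge0 A : (0 <= sphere_measure A)%E.
Proof. by rewrite mule_ge0. Qed.

Let sphere_sigma_additive : semi_sigma_additive sphere_measure.
Proof.
move=> F mF tF mUF; rewrite /sphere_measure preimage_bigcup setI_bigcupr.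
have h : (fun k => \sum_(0 <= i < k) lebesgue_row R n
      (cball n 1 `&` direction @^-1` F i))%E @ \oo -->
    lebesgue_row R n (\bigcup_i (cball n 1 `&` direction @^-1` F i)).
  apply: measure_semi_sigma_additive.
  - by move=> k; exact: mcone.
  - apply/trivIsetP => i j _ _ ij.
    move/trivIsetP : tF => /(_ _ _ Logic.I Logic.I ij) Fij.
    have FF : direction @^-1` F i `&` direction @^-1` F j = set0.
      by rewrite -preimage_setI Fij preimage_set0.
    by rewrite setIACA FF setI0.
  - by apply: bigcup_measurable => k _; exact: mcone.
rewrite [X in X @ _ --> _](_ : _ = fun k => (n%:R%:E * \sum_(0 <= i < k)
    lebesgue_row R n (cball n 1 `&` direction @^-1` F i))%E).
  by apply: cvgeZl => //.
by apply/funext => k; rewrite ge0_sume_distrr.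
Qed.

HB.instance Definition _ := isMeasure.Build _ _ _
  sphere_measure sphere0 sphere_ge0 sphere_sigma_additive.

End sphere_measure.

Arguments sphere_measure R n : clear implicits.

Section convex_bodies.
Context (R : realType) (n : nat).
Implicit Types (A B K : set 'rV[R]_n) (xi : 'rV[R]_n).

Definition convex_body K :=
  [/\ compact K, convex_set K & K° !=set0].

Definition minkowski_add A B : set 'rV[R]_n :=
  [set x + y | x in A & y in B].

Definition minkowski_scale (a : R) A : set 'rV[R]_n :=
  [set a *: x | x in A].

Definition support_function K xi : R := sup [set edot z xi | z in K].

End convex_bodies.

Definition unit_ball_volume (R : realType) (n : nat) : R :=
  fine (lebesgue_row R n (cball n 1)).

Arguments unit_ball_volume R n : clear implicits.

Definition mean_width (R : realType) (n : nat) (K : set 'rV[R]_n) : R :=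
  2 / (n%:R * unit_ball_volume R n) *
  \int[sphere_measure R n]_(xi in sphere R n) support_function K xi.

Section torsion.
Context (R : realType) (n : nat).
Implicit Types (Omega : set 'rV[R]_n) (phi psi u : 'rV[R]_n -> R).

Definition partial (i : 'I_n) phi (x : 'rV[R]_n) : R :=
  'D_(delta_mx 0 i : 'rV[R]_n) phi x.

Definition test_function Omega phi :=
  [/\ forall x (i : 'I_n), derivable phi x (delta_mx 0 i : 'rV[R]_n),
      forall i, continuous (partial i phi) &
      exists K : set 'rV[R]_n, [/\ compact K, K `<=` Omega &
        forall x, ~ K x -> phi x = 0]].

(** u belongs to the Gaussian Sobolev space H^1_0(Omega, gamma), the closure of
    the test functions for the norm (||u||_2^2 + ||grad u||_2^2)^(1/2) of
    L^2(gamma), and its weak gradient is G. *)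
Definition H10_gradient Omega u (G : 'I_n -> 'rV[R]_n -> R) :=
  [/\ measurable_fun setT u,
      forall i, measurable_fun setT (G i) &
      exists phi_ : nat -> 'rV[R]_n -> R,
      [/\ forall k, test_function Omega (phi_ k),
          (\int[gauss_row R n]_x ((phi_ k x - u x) ^+ 2)%:E)%E
            @[k --> \oo] --> 0%E &
          forall i,
            (\int[gauss_row R n]_x ((partial i (phi_ k) x - G i x) ^+ 2)%:E)%E
            @[k --> \oo] --> 0%E]].

(** u is the solution of Delta u - x . grad u = -1 in Omega, u = 0 on the
    boundary of Omega, which for an arbitrary bounded open set is meant in the
    weak sense: u is in H^1_0(Omega, gamma), and the equation, whose left-hand
    side is exp(|x|^2/2) div (exp(-|x|^2/2) grad u), is tested against gamma. *)
Definition is_torsion_function Omega u :=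
  exists G, H10_gradient Omega u G /\
    forall psi, test_function Omega psi ->
      \int[gauss_row R n]_(x in Omega) (\sum_(i < n) G i x * partial i psi x) =
      \int[gauss_row R n]_(x in Omega) psi x.

(** Unique up to gamma-negligible sets, so that the integral below does not
    depend on the choice made by [get]. *)
Definition torsion_function Omega : 'rV[R]_n -> R :=
  get (is_torsion_function Omega).

Definition gauss_torsion Omega : R :=
  \int[gauss_row R n]_(x in Omega) torsion_function Omega x.

Definition gauss_torsion_body (K : set 'rV[R]_n) : R := gauss_torsion K°.

End torsion.

(** Only the restriction of u to [0, +oo[ is constrained; the derivative at 0 is
    one-sided. *)

Definition is_radial_profile (R : realType) (n : nat) (u : R -> R) :=
  [/\ u 0 = 0, h^-1 * (u h - u 0) @[h --> 0^'+] --> 0 &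
      forall r, 0 < r -> [/\ derivable u r 1, derivable (derive1 u) r 1 &
        derive1 (derive1 u) r + n.-1%:R / r * derive1 u r - r * derive1 u r
        = -1]].

Definition radial_profile (R : realType) (n : nat) : R -> R :=
  get (@is_radial_profile R n).

Arguments radial_profile R n : clear implicits.

Definition torsion_slope (R : realType) (n : nat) (r : R) : R :=
  n%:R * unit_ball_volume R n / (2 * pi) `^ (n%:R / 2) *
  r ^+ n.-1 * derive1 (radial_profile R n) r ^+ 2 * expR (- (r ^+ 2 / 2)).

Definition mean_support_excess (R : realType) (n : nat) (r : R)
    (K : set 'rV[R]_n) : R :=
  (n%:R * unit_ball_volume R n)^-1 *
  \int[sphere_measure R n]_(xi in sphere R n) (support_function K xi - r).

(* Main.v *)
(** The torsion is the supremum of 2 int psi - int |grad psi|^2 (against gamma)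
    over test functions psi. With q = |x|^2/2 and P' = k a power series,
    U = - P(q) satisfies Delta U - x . grad U = -1 on R^n, so testing with psi
    only involves grad U = - k(q) x. Completing the square bounds T(B_R) by
    int_(B_R) |grad U|^2.

    For K_t = (1 - t) B_R + t K put w(x) = P(R^2/2) - P(q) +
    t k(R^2/2) (hh(x) - R^2) - O(t^2), where hh(x) = max_(z in K) (x.z - t |z|^2/2)
    is a C^1 regularisation of the support function whose gradient is the
    maximiser z(x). Convexity of P shows that w > 0 implies x in K_t. A cutoff of
    w at height t^2 is a test function for K_t, and its energy is at least
    int_({w >= 2t^2}) |grad U|^2 - O(t^2). Finally {w >= 2t^2} contains the star
    body |x| <= R + t (h_K(x/|x|) - R) - O(t^2), whose volume exceeds that of
    B_R by R^(n-1) t int_(S^(n-1)) (h_K - R) - O(t^2), and which differs from B_R only in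
    a shell of width O(t), where |grad U|^2 is constant up to O(t). *)

Require Import Defs.
From mathcomp Require Import all_boot all_order all_algebra.
From mathcomp Require Import all_classical all_reals all_analysis.
From mathcomp Require Import measurable_realfun ring lra.

Set Implicit Arguments.
Unset Strict Implicit.
Unset Printing Implicit Defensive.

Import Order.TTheory GRing.Theory Num.Theory.
Import numFieldNormedType.Exports.

Local Open Scope classical_set_scope.
Local Open Scope ring_scope.

Local Notation partial := Defs.partial.

(** * Euclidean geometry and Borel sets of R^n *)

(** The torsion is used only through its variational form, so neither boundary regularity of K_t nor
    a shape derivative enters. The price is that test functions must be C^1, whereas h_K is only
    Lipschitz. The penalisation in hh repairs this: with strength equal to t it costs at most t (t
    R_1^2/2) in w, while its gradient stays bounded by R_1 however small t is. Hence grad w = grad U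
    + O(t), and the cutoff is harmless: where its slope d lies strictly between 0 and 1, completing
    the square leaves the nonnegative remainder d (1 - d) |grad w|^2. The constants see K only
    through the inclusion K in B_(R_1), which makes t_1 and C uniform. Polar coordinates are
    replaced by the homogeneity of Lebesgue measure on cones, which matches the definition of the
    surface measure by cones. Finally, [torsion_function] and [radial_profile] are choices made by
    [get]: the first calls for an existence proof, the second for a uniqueness proof as well, across
    the singular point r = 0 of its equation. *)

Lemma continuous_sum (R : realType) (T : topologicalType) (I : Type) (r : seq I)
    (P : pred I) (F : I -> T -> R) : (forall i, P i -> continuous (F i)) ->
  continuous (fun t => \sum_(i <- r | P i) F i t).
Proof. by move=> cF; apply: continuous_big => //; exact: add_continuous. Qed.

Section euclidean.
Context (R : realType) (n : nat).
Implicit Types (x y z : 'rV[R]_n) (a : R).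

Lemma edotC x y : edot x y = edot y x.
Proof. by apply: eq_bigr => i _; rewrite mulrC. Qed.

Lemma edotDl x y z : edot (x + y) z = edot x z + edot y z.
Proof. by rewrite -big_split; apply: eq_bigr => i _; rewrite mxE mulrDl. Qed.

Lemma edotZl a x y : edot (a *: x) y = a * edot x y.
Proof. by rewrite /edot mulr_sumr; apply: eq_bigr => i _; rewrite mxE mulrA. Qed.

Lemma edotDr x y z : edot x (y + z) = edot x y + edot x z.
Proof. by rewrite edotC edotDl !(edotC x). Qed.

Lemma edotZr a x y : edot x (a *: y) = a * edot x y.
Proof. by rewrite edotC edotZl edotC. Qed.

Lemma edotNl x y : edot (- x) y = - edot x y.
Proof. by rewrite -scaleN1r edotZl mulN1r. Qed.

Lemma edotNr x y : edot x (- y) = - edot x y.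
Proof. by rewrite edotC edotNl edotC. Qed.

Lemma edot0l x : edot 0 x = 0.
Proof. by rewrite -(scale0r x) edotZl mul0r. Qed.

Lemma edot_ge0 x : 0 <= edot x x.
Proof. by apply: sumr_ge0 => i _; rewrite -expr2 sqr_ge0. Qed.

Lemma enorm_ge0 x : 0 <= enorm x.
Proof. exact: sqrtr_ge0. Qed.

Lemma sqr_enorm x : enorm x ^+ 2 = edot x x.
Proof. by rewrite sqr_sqrtr// edot_ge0. Qed.

Lemma enormZ a x : enorm (a *: x) = `|a| * enorm x.
Proof.
by rewrite /enorm edotZl edotZr mulrA -expr2 sqrtrM ?sqr_ge0// sqrtr_sqr.
Qed.

Lemma enorm0 : enorm (0 : 'rV[R]_n) = 0.
Proof. by rewrite /enorm edot0l sqrtr0. Qed.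

Lemma enormN x : enorm (- x) = enorm x.
Proof. by rewrite -scaleN1r enormZ normrN1 mul1r. Qed.

Lemma sqr_coord_le x i : x 0 i ^+ 2 <= edot x x.
Proof.
rewrite /edot (bigD1 i)//= -expr2 lerDl.
by apply: sumr_ge0 => j _; rewrite -expr2 sqr_ge0.
Qed.

Lemma coord_le_enorm x i : `|x 0 i| <= enorm x.
Proof. by rewrite -sqrtr_sqr ler_wsqrtr// sqr_coord_le. Qed.

Lemma enorm_eq0 x : enorm x = 0 -> x = 0.
Proof.
move=> x0; apply/rowP => i; rewrite mxE; apply/eqP; rewrite -normr_le0 -x0.
exact: coord_le_enorm.
Qed.

Lemma edot_le x y : edot x y <= enorm x * enorm y.
Proof.
have [y0|y0] := eqVneq (enorm y) 0.
  by rewrite (enorm_eq0 y0) edotC edot0l enorm0 mulr0.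
have yp : 0 < enorm y by rewrite lt0r y0 enorm_ge0.
have [x0|x0] := eqVneq (enorm x) 0.
  by rewrite (enorm_eq0 x0) edot0l enorm0 mul0r.
have xp : 0 < enorm x by rewrite lt0r x0 enorm_ge0.
(* With a, b the two norms and c the scalar product, this square is 2ab(ab - c). *)
have := edot_ge0 (enorm y *: x - enorm x *: y).
rewrite !(edotDl, edotDr, edotNl, edotNr, edotZl, edotZr) -!sqr_enorm (edotC y).
set a := enorm x; set b := enorm y; set c := edot x y => h.
have : 0 <= (a * b) * (a * b - c) by nra.
by rewrite pmulr_rge0 ?mulr_gt0// subr_ge0.
Qed.

Lemma enormD x y : enorm (x + y) <= enorm x + enorm y.
Proof.
rewrite -(@ler_sqr _ (enorm (x + y))) ?nnegrE ?addr_ge0 ?enorm_ge0//.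
rewrite sqr_enorm edotDl !edotDr sqrrD -!sqr_enorm (edotC y).
by have := edot_le x y; lra.
Qed.

Lemma enorm_le_sum x : enorm x <= \sum_(i < n) `|x 0 i|.
Proof.
have s0 : 0 <= \sum_(i < n) `|x 0 i| by apply: sumr_ge0.
rewrite -(@ler_sqr _ (enorm x)) ?nnegrE ?enorm_ge0// sqr_enorm.
rewrite [leRHS]expr2 mulr_suml /edot.
apply: ler_sum => i _; rewrite -expr2 -real_normK ?num_real// expr2.
by apply: ler_wpM2l => //; rewrite (bigD1 i)//= lerDl; apply: sumr_ge0.
Qed.

Lemma coord_le_norm x i : `|x 0 i| <= `|x|.
Proof. by rewrite [leRHS]/Num.Def.normr/= mx_normrE (le_trans _ (le_bigmax _ _ (0, i))). Qed.

Lemma norm_le_enorm x : `|x| <= enorm x.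
Proof.
rewrite [leLHS]/Num.Def.normr/= mx_normrE; apply/bigmax_leP; split; first exact: enorm_ge0.
by move=> [i j] _ /=; rewrite ord1 coord_le_enorm.
Qed.

Lemma enorm_le_norm x : enorm x <= n%:R * `|x|.
Proof.
apply: (le_trans (enorm_le_sum x)).
rewrite -[n in n%:R](card_ord n) -sum1_card natr_sum mulr_suml.
by apply: ler_sum => i _; rewrite mul1r coord_le_norm.
Qed.

Lemma continuous_coord i : continuous (fun x : 'rV[R]_n => x 0 i).
Proof. by move=> x; exact: coord_continuous. Qed.

Lemma continuous_edot (T : topologicalType) (f g : T -> 'rV[R]_n) :
  continuous f -> continuous g -> continuous (fun s => edot (f s) (g s)).
Proof.
move=> cf cg; apply: continuous_sum => i _ s; apply: cvgM.
  apply: (@continuous_comp _ _ _ f (fun x : 'rV[R]_n => x 0 i)); first exact: cf.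
  exact: coord_continuous.
apply: (@continuous_comp _ _ _ g (fun x : 'rV[R]_n => x 0 i)); first exact: cg.
exact: coord_continuous.
Qed.

Lemma continuous_enorm : continuous (@enorm R n).
Proof.
move=> x; apply: (@continuous_comp _ _ _ (fun y => edot y y) (@Num.sqrt R)).
  by apply: (@continuous_edot _ idfun idfun) => y; exact: cvg_id.
exact: sqrt_continuous.
Qed.

Lemma closed_cball r : closed (@cball R n r).
Proof.
rewrite (_ : cball n r = @enorm R n @^-1` [set y | y <= r]) //.
by apply: preimage_closed; [move=> x _; exact: continuous_enorm|exact: closed_le].
Qed.

Lemma subset_cball_bounded r (A : set 'rV[R]_n) :
  A `<=` cball n r -> bounded_set A.
Proof.
move=> Ar; exists r; split; first exact: num_real.
move=> M rM x Ax; apply: (le_trans (norm_le_enorm x)).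
by apply: (le_trans (Ar _ Ax)); exact: ltW.
Qed.

Lemma closed_cball_compact r (A : set 'rV[R]_n) :
  closed A -> A `<=` cball n r -> compact A.
Proof. by move=> cA /subset_cball_bounded Ab; exact: bounded_closed_compact. Qed.

Definition rat_box (c : 'rV[rat]_n) (k : nat) : set 'rV[R]_n :=
  [set x | forall i, `|x 0 i - ratr (c 0 i)| < k.+1%:R^-1].

Lemma measurable_rat_box c k : measurable (rat_box c k).
Proof.
rewrite (_ : rat_box c k = \bigcap_(i in [set: 'I_n])
    ((fun x : 'rV[R]_n => x 0 i) @^-1` ball (ratr (c 0 i) : R) (k.+1%:R^-1 : R))).
  apply: fin_bigcap_measurable => // i _.
  rewrite -[X in measurable X]setTI; apply: (measurable_coord i) => //.
  exact: measurable_ball.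
by apply/seteqP; split => x /= h i => [_|]; have := h i;
  rewrite /= -ball_normE /ball_ /= distrC; [|apply].
Qed.

(** The sigma-algebra is generated by the coordinates, so a countable base is needed: an open set is
    the union of the boxes with rational centre and half-width 1/(k + 1) that it contains. *)
Lemma open_measurable_row (A : set 'rV[R]_n) : open A -> measurable A.
Proof.
move=> oA.
pose F (p : 'rV[rat]_n * nat) : set 'rV[R]_n :=
  if pselect (rat_box p.1 p.2 `<=` A) then rat_box p.1 p.2 else set0.
rewrite (_ : A = \bigcup_p F p); last first.
  apply/seteqP; split=> [x Ax|x [p _]]; last first.
    by rewrite /F; case: pselect => //= h; exact: h.
  have /nbhs_ballP[e /= e0 eA] := open_nbhs_nbhs (conj oA Ax).
  (* Two points of a box differ, in each coordinate, by less than twice its half-width. *)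
  have [k ke] : exists k : nat, 2 * k.+1%:R^-1 < e.
    exists (Num.truncn (2 / e)).
    by rewrite ltr_pdivrMr// mulrC -ltr_pdivrMr// truncnS_gt.
  have k0 : 0 < k.+1%:R^-1 :> R by rewrite invr_gt0.
  have hc i : exists q : rat, `|x 0 i - ratr q| < k.+1%:R^-1.
    have /rat_in_itvoo[q] : x 0 i < x 0 i + k.+1%:R^-1 by rewrite ltrDl.
    rewrite in_itv /= => /andP[q1 q2]; exists q.
    by move: (x 0 i) (ratr q) (k.+1%:R^-1) k0 q1 q2 => a b d *; rewrite ltr_norml; lra.
  pose c : 'rV[rat]_n := \row_i xchoose (hc i).
  exists (c, k) => //; rewrite /F; case: pselect => [_ /= i|].
    by rewrite mxE; exact: (xchooseP (hc i)).
  apply: contra_notP => _ y hy; apply: eA; split=> // i j; rewrite !ord1.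
  have := hy j; rewrite mxE => h1; have h2 := xchooseP (hc j).
  rewrite -ball_normE /ball_ /=; apply: le_lt_trans ke.
  rewrite (_ : x 0 j - y 0 j = (x 0 j - ratr (xchoose (hc j))) -
     (y 0 j - ratr (xchoose (hc j)))); last by ring.
  apply: (le_trans (ler_normB _ _)).
  by rewrite [leRHS]mulrDl mul1r lerD// ltW.
apply: countable_bigcupT_measurable => // p; rewrite /F; case: pselect => h //=.
exact: measurable_rat_box.
Qed.

Lemma closed_measurable_row (A : set 'rV[R]_n) : closed A -> measurable A.
Proof. by move=> /closed_openC/open_measurable_row/measurableC; rewrite setCK. Qed.

Lemma continuous_measurable_row (f : 'rV[R]_n -> R) :
  continuous f -> measurable_fun setT f.
Proof.
move=> /continuousP cf; apply: (measurability _ (RGenOpens.measurableE R)).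
move=> _ [_ [a [b ->] <-]]; rewrite setTI.
by apply: open_measurable_row; apply: cf; apply: interval_open.
Qed.

End euclidean.

Lemma enorm_lipschitz_continuous (R : realType) (n : nat) (f : 'rV[R]_n -> R) (C : R) :
  (forall x y, `|f x - f y| <= C * enorm (x - y)) -> continuous f.
Proof.
move=> fC x; have FF : Filter (nbhs x) by exact: nbhs_filter.
apply/cvgrPdist_le => eps eps0.
(* [C] carries no sign, hence the absolute value; the summand 1 keeps the divisor positive, and n
   compares the Euclidean norm with the sup norm. *)
have c0 : 0 < `|C| * n%:R + 1 by rewrite ltr_wpDl// mulr_ge0.
have d0 : 0 < eps / (`|C| * n%:R + 1) by rewrite divr_gt0.
apply: filterS (nbhsx_ballx x _ d0) => y xy.
rewrite -ball_normE /ball_/= in xy.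
apply: (le_trans (fC x y)).
apply: (@le_trans _ _ (`|C| * (n%:R * `|x - y|))).
  apply: (@le_trans _ _ (`|C| * enorm (x - y))).
    by rewrite ler_wpM2r ?enorm_ge0// ler_norm.
  by rewrite ler_wpM2l// enorm_le_norm.
rewrite mulrA; apply: (@le_trans _ _ ((`|C| * n%:R + 1) * `|x - y|)).
  by rewrite ler_wpM2r// lerDl.
by rewrite mulrC -ler_pdivlMr// ltW.
Qed.

(** * Integration against a density *)

Section integral_density.
Context d (T : measurableType d) (R : realType).
Variables (mu nu : {measure set T -> \bar R}) (rho : T -> R).
Hypotheses (rho0 : forall x, 0 <= rho x) (mrho : measurable_fun setT rho).
Hypothesis nuE : forall A, measurable A -> nu A = (\int[mu]_(x in A) (rho x)%:E)%E.

Import HBNNSimple.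

(** [nuE] speaks of sets only: linearity extends it to simple functions and monotone convergence to
    the rest. It serves the Gaussian measure and the cone measure behind the surface measure. *)
Lemma ge0_integral_density (f : T -> R) : (forall x, 0 <= f x) ->
  measurable_fun setT f ->
  (\int[nu]_x (f x)%:E = \int[mu]_x (f x * rho x)%:E)%E.
Proof.
move=> f0 mf; have mEf : measurable_fun setT (EFin \o f) by exact/measurable_EFinP.
pose h := nnsfun_approx measurableT mEf.
have hcvg x : (EFin \o h n) x @[n --> \oo] --> (f x)%:E.
  by apply: cvg_nnsfun_approx => // y _; rewrite lee_fin.
have hle x : {homo (fun n => (h n x)%:E) : m n / (m <= n)%N >-> (m <= n)%E}.
  by move=> m n mn; rewrite lee_fin; exact/lefP/nd_nnsfun_approx.
have -> : (\int[nu]_x (f x)%:E = limn (fun n => \int[nu]_x (h n x)%:E))%E.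
  rewrite -monotone_convergence//.
  - by apply: eq_integral => x _; apply/esym/cvg_lim => //; exact: hcvg.
  - by move=> n; exact/measurable_EFinP.
  - by move=> n x _; rewrite lee_fin.
have -> : (\int[mu]_x (f x * rho x)%:E = limn (fun n => \int[mu]_x (h n x * rho x)%:E))%E.
  rewrite -monotone_convergence//.
  - apply: eq_integral => x _; apply/esym/cvg_lim => //.
    have : (rho x)%:E \is a fin_num by [].
    by move=> /cvgeZr /(_ (hcvg x)).
  - by move=> n; apply/measurable_EFinP; exact: measurable_funM.
  - by move=> n x _; rewrite lee_fin mulr_ge0.
  - move=> x _ m n mn; rewrite lee_fin ler_wpM2r//.
    by have := hle x m n mn; rewrite lee_fin.
congr (limn _); apply/funext => n.
transitivity (\int[nu]_x
   (\sum_(y \in range (h n)) (y * \1_(h n @^-1` [set y]) x)%:E))%E.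
  by apply: eq_integral => t _; rewrite fsumEFin// -fimfunE.
transitivity (\int[mu]_x
   (\sum_(y \in range (h n)) (y * \1_(h n @^-1` [set y]) x * rho x)%:E))%E; last first.
  apply: eq_integral => t _; rewrite fsumEFin//; congr EFin.
  by rewrite -mulr_fsuml// -fimfunE.
rewrite !ge0_integral_fsum//; last 4 first.
- move=> r; apply/measurable_EFinP; apply: measurable_funM => //.
  exact: measurable_funM.
- by move=> r x _; rewrite !EFinM mule_ge0 ?nnfun_muleindic_ge0 ?lee_fin.
- by move=> r; exact/measurable_EFinP/measurable_funM.
- by move=> r x _; rewrite EFinM nnfun_muleindic_ge0.
apply: eq_fsbigr => r /set_mem[z _ <-].
have mr : measurable (h n @^-1` [set h n z]) by [].
under eq_integral do rewrite EFinM.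
under [RHS]eq_integral do rewrite -mulrA EFinM.
rewrite !ge0_integralZl ?lee_fin//.
- rewrite integral_indic// setIT nuE//; congr (_ * _)%E.
  rewrite [LHS]integral_mkcond; apply: eq_integral => x _.
  by rewrite patchE indicE; case: ifPn; rewrite ?mul1r ?mul0r.
- by apply/measurable_EFinP; exact: measurable_funM.
- by move=> x _; rewrite lee_fin mulr_ge0.
- exact/measurable_EFinP.
Qed.

Lemma integrable_density (f : T -> R) : measurable_fun setT f ->
  nu.-integrable setT (EFin \o f) <->
  mu.-integrable setT (EFin \o (fun x => f x * rho x)).
Proof.
move=> mf; have E : (\int[nu]_x `|(f x)%:E| = \int[mu]_x `|(f x * rho x)%:E|)%E.
  rewrite (ge0_integral_density (f := fun x => `|f x|))//; last exact: measurableT_comp.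
  by apply: eq_integral => x _ /=; rewrite normrM (ger0_norm (rho0 x)).
split => /integrableP[_ h]; apply/integrableP; split.
- by apply/measurable_EFinP; exact: measurable_funM.
- by rewrite -E.
- exact/measurable_EFinP.
- by rewrite E.
Qed.

Lemma Rintegral_density (f : T -> R) : nu.-integrable setT (EFin \o f) ->
  \int[nu]_x f x = \int[mu]_x (f x * rho x).
Proof.
move=> inf; have mf : measurable_fun setT f.
  by apply/measurable_EFinP; exact: (measurable_int _ inf).
rewrite /Rintegral; congr fine; rewrite integralE [RHS]integralE.
have mp : measurable_fun setT f^\+ by exact: measurable_funrpos.
have mn : measurable_fun setT f^\- by exact: measurable_funrneg.
rewrite !(funerpos, funerneg) /=.
rewrite (ge0_integral_density (f := f^\+))//.
rewrite (ge0_integral_density (f := f^\-))//.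
congr (_ - _)%E; apply: eq_integral => x _; congr EFin.
- by rewrite /funrpos/= maxr_pMl// mul0r.
- by rewrite /funrneg/= -mulNr maxr_pMl// mul0r.
Qed.

End integral_density.

(** * Lebesgue measure on R^n *)

Section lebesgue_row.
Context (R : realType).

Definition box (n : nat) (c : R) : set 'rV[R]_n := [set x | forall i, `|x 0 i| <= c].

Arguments box : clear implicits.

Lemma measurable_box n c : measurable (box n c).
Proof.
rewrite (_ : box n c = \bigcap_(i in [set: 'I_n])
    ((fun x : 'rV[R]_n => x 0 i) @^-1` `[- c, c])).
  apply: fin_bigcap_measurable => // i _.
  by rewrite -[X in measurable X]setTI; apply: (measurable_coord i).
by apply/seteqP; split => x /= h i => [_|]; have := h i;
  rewrite /= in_itv/= ler_norml => //; apply.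
Qed.

Lemma row_cons0 n (s : R) (y : 'rV[R]_n) : row_cons (s, y) 0 ord0 = s.
Proof. by rewrite mxE unlift_none. Qed.

Lemma row_consS n (s : R) (y : 'rV[R]_n) j : row_cons (s, y) 0 (lift ord0 j) = y 0 j.
Proof. by rewrite mxE liftK. Qed.

Lemma lebesgue_row_succ n (A : set 'rV[R]_n.+1) :
  lebesgue_row R n.+1 A =
  (@lebesgue_measure R \x lebesgue_row R n)%E (@row_cons R n @^-1` A).
Proof. by []. Qed.

Lemma preimage_row_cons_box n c : @row_cons R n @^-1` box n.+1 c = `[- c, c] `*` box n c.
Proof.
apply/seteqP; split => -[s y] /=; rewrite in_itv/= -ler_norml.
  move=> h; split; first by have := h ord0; rewrite row_cons0.
  by move=> j; have := h (lift ord0 j); rewrite row_consS.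
move=> [h1 h2] i; case: (unliftP ord0 i) => [j ->|->]; first by rewrite row_consS.
by rewrite row_cons0.
Qed.

Lemma lebesgue_row_box n c : 0 <= c -> lebesgue_row R n (box n c) = ((2 * c) ^+ n)%:E.
Proof.
move=> c0; elim: n => [|n IH].
  by rewrite /= diracE mem_set// => -[].
rewrite lebesgue_row_succ preimage_row_cons_box.
rewrite (@product_measure1E _ _ _ _ _ lebesgue_measure)//; last exact: measurable_box.
rewrite IH/= lebesgue_measure_itv/= lte_fin exprS EFinM.
case: ltP => h; first by rewrite opprK -EFinD mulr2n mulrDl mul1r.
by rewrite (_ : c = 0) ?mulr0//; lra.
Qed.

(** The first order of integration suits derivatives along the last coordinates, the second those
    along the first coordinate. *)
Lemma integral_lebesgue_row_succ n (f : 'rV[R]_n.+1 -> \bar R) :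
  (lebesgue_row R n.+1).-integrable setT f ->
  (\int[lebesgue_row R n.+1]_x f x =
   \int[lebesgue_measure]_s \int[lebesgue_row R n]_y f (row_cons (s, y)))%E /\
  (\int[lebesgue_row R n.+1]_x f x =
   \int[lebesgue_row R n]_y \int[lebesgue_measure]_s f (row_cons (s, y)))%E.
Proof.
move=> intf; have mf := measurable_int _ intf.
have intg : ((@lebesgue_measure R \x lebesgue_row R n)%E).-integrable setT
    (f \o @row_cons R n).
  apply/integrableP; split.
    by apply: (measurableT_comp mf); exact: measurable_row_cons.
  move/integrableP : intf => [_].
  rewrite (@ge0_integral_pushforward _ _ _ _ _ _ (@measurable_row_cons R n)
   (@lebesgue_measure R \x lebesgue_row R n)%E)//.
  exact: measurableT_comp.
rewrite (@integral_pushforward _ _ _ _ _ _ (@measurable_row_cons R n)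
   (@lebesgue_measure R \x lebesgue_row R n)%E)// preimage_setT.
by split; [rewrite -(integral12_prod_meas1 intg)|rewrite -(integral21_prod_meas1 intg)].
Qed.

Lemma lebesgue_measure_scale (c : R) (A : set R) : 0 < c -> measurable A ->
  (c%:E * lebesgue_measure ((fun s : R => (c * s)%R) @^-1` A) = lebesgue_measure A)%E.
Proof.
move=> c0 mA.
have mc : measurable_fun setT ((fun s => c * s) : R -> measurableTypeR R).
  exact: mulrl_measurable.
pose pf := measure_function_pushforward__canonical__measure_function_Measure
    (@lebesgue_measure R) mc.
pose m := mscale (NngNum (ltW c0)) pf.
suff -> : lebesgue_measure A = m A by [].
apply: lebesgue_measure_unique => //= _ [[a b]] _ <-.
rewrite /m /mscale /= /pushforward/=.
rewrite (_ : _ @^-1` _ = `]a / c, b / c]%classic); last first.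
  by apply/seteqP; split => s /=; rewrite !in_itv/= ltr_pdivrMr// ler_pdivlMr// mulrC.
rewrite !lebesgue_measure_itv/= !lte_fin ltr_pM2r ?invr_gt0//.
case: ifP => _; rewrite ?mule0// -!EFinD -EFinM; congr EFin.
by rewrite -mulrBl mulrCA divff ?mulr1// gt_eqF.
Qed.

Lemma measurable_scale n (c : R) : measurable_fun setT (fun x : 'rV[R]_n => c *: x).
Proof.
apply: measurable_rowP => i; under eq_fun do rewrite mxE.
by apply: measurable_funM => //; exact: measurable_coord.
Qed.

(** Uniqueness of product measures reduces this to rectangles, where one factor c comes from the
    line and the others from the induction hypothesis. *)
Lemma lebesgue_row_scale n (c : R) (A : set 'rV[R]_n) : 0 < c -> measurable A ->
  ((c ^+ n)%:E * lebesgue_row R n ((fun x => c *: x) @^-1` A) = lebesgue_row R n A)%E.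
Proof.
move=> c0; elim: n A => [|n IH] A mA.
  rewrite expr0 mul1e; congr (lebesgue_row R 0 _).
  by apply/seteqP; split => x /=; rewrite (thinmx0 x) (thinmx0 (c *: _)).
pose sc (p : measurableTypeR R * 'rV[R]_n) : measurableTypeR R * 'rV[R]_n :=
  (c * p.1, c *: p.2).
have msc : measurable_fun setT sc.
  apply/measurable_fun_pairP; split => /=.
    by apply: measurable_funM => //; exact: measurable_fst.
  pose S (x : 'rV[R]_n) : 'rV[R]_n := c *: x.
  have mS : measurable_fun setT S by exact: measurable_scale.
  exact: (measurableT_comp mS measurable_snd).
have cn0 : 0 <= c ^+ n.+1 by rewrite exprn_ge0// ltW.
pose pf := measure_function_pushforward__canonical__measure_function_Measure
    (@lebesgue_measure R \x lebesgue_row R n)%E msc.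
pose m := mscale (NngNum cn0) pf.
have mE X : m X = ((c ^+ n.+1)%:E *
    (@lebesgue_measure R \x lebesgue_row R n)%E (sc @^-1` X))%E by [].
rewrite !lebesgue_row_succ.
have -> : (@lebesgue_measure R \x lebesgue_row R n)%E (@row_cons R n @^-1` A) =
    m (@row_cons R n @^-1` A).
  apply: product_measure_unique; last first.
    by rewrite -[X in measurable X]setTI; exact: measurable_row_cons.
  move=> B C mB mC; apply: (etrans (mE _)).
  rewrite (_ : sc @^-1` _ = ((fun s => c * s) @^-1` B) `*` ((fun x => c *: x) @^-1` C))//.
  rewrite product_measure1E//; last 2 first.
  - by rewrite -[X in measurable X]setTI; exact: mulrl_measurable.
  - by rewrite -[X in measurable X]setTI; exact: measurable_scale.
  by rewrite exprS EFinM muleACA lebesgue_measure_scale// IH.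
have E p : @row_cons R n (sc p) = c *: row_cons p.
  by apply/rowP => i; rewrite !mxE; case: unlift => //= j; rewrite mxE.
rewrite [RHS](mE _); congr (_ * product_measure1 _ _ _)%E.
by apply/seteqP; split => p /=; rewrite E.
Qed.

End lebesgue_row.

Arguments box {R} n c.

(** * Continuously differentiable functions *)

Section line_derivative.
Context (R : realType) (V : normedModType R).
Implicit Types (f : V -> R) (x v : V).

(** Turns directional derivatives into derivatives of one real variable, to which the chain rule and
    the mean value theorem apply. *)
Lemma is_derive_line f x v (s df : R) :
  is_derive s 1 (fun h : R => f (h *: v + x)) df <-> is_derive (s *: v + x) v f df.
Proof.
have E : (fun h : R => h^-1 *: (((fun h => f (h *: v + x)) \o shift s) (h *: 1) -
    f (s *: v + x))) =
    (fun h : R => h^-1 *: ((f \o shift (s *: v + x)) (h *: v) - f (s *: v + x))).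
  apply/funext => h /=; congr (_ *: (f _ - _)).
  by rewrite scalerDl addrA [h *: 1]mulr1.
by split => -[h1 h2]; split; move: h1 h2; rewrite /derivable /derive ?E -?E.
Qed.

Lemma is_derive_line0 f x v (df : R) :
  is_derive (0 : R) 1 (fun h : R => f (h *: v + x)) df <-> is_derive x v f df.
Proof. by rewrite is_derive_line scale0r add0r. Qed.

Lemma is_derive_comp f (h : R -> R) x v (df dh : R) :
  is_derive x v f df -> is_derive (f x) 1 h dh ->
  is_derive x v (h \o f) (dh * df).
Proof.
move=> /is_derive_line0 f' h'; apply/is_derive_line0.
apply: (@is_derive1_comp _ h (fun s : R => f (s *: v + x))) => //.
by rewrite scale0r add0r.
Qed.

(** Serves two functions that are not compositions of differentiable ones: the squared positive part
    and the penalised support function. *)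
Lemma is_derive_quadratic f x v (d C : R) :
  (forall h : R, `|f (h *: v + x) - f x - h * d| <= C * h ^+ 2) -> is_derive x v f d.
Proof.
move=> H.
have lim : (fun h : R => h^-1 *: (f (h *: v + x) - f x)) @ 0^' --> d.
  apply/cvgrPdist_le => c c0.
  have C0 : 0 < `|C| + 1 by rewrite ltr_wpDl.
  have d0 : 0 < c / (`|C| + 1) by rewrite divr_gt0.
  near=> h.
  have h0 : h != 0 by near: h; exact: nbhs_dnbhs_neq.
  have hc : `|h| < c / (`|C| + 1) by near: h; exact: dnbhs0_lt.
  have nh0 : 0 < `|h| by rewrite normr_gt0.
  rewrite distrC (_ : _ - _ = h^-1 * (f (h *: v + x) - f x - h * d)); last first.
    by rewrite [in RHS]mulrBr mulKf.
  rewrite normrM normfV ler_pdivrMl//; apply: (le_trans (H h)).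
  rewrite -(real_normK (num_real h)) expr2 mulrCA ler_pM2l//.
  rewrite ltr_pdivlMr// in hc; apply: le_trans (ltW hc).
  rewrite mulrC ler_wpM2l ?(ltW nh0)//.
  by apply: (le_trans (ler_norm C)); rewrite lerDl.
by apply: DeriveDef; [apply/cvg_ex; exists d|exact: cvg_lim lim].
Unshelve. all: by end_near. Qed.

End line_derivative.

Lemma derive_bounded_lipschitz (R : realType) (g dg : R -> R) (M a b : R) :
  (forall s : R, is_derive s 1 g (dg s)) -> (forall s, `|dg s| <= M) ->
  `|g b - g a| <= M * `|b - a|.
Proof.
move=> g' dM; wlog ab : a b / a <= b => [H|].
  by case/orP : (le_total a b) => /H//; rewrite distrC (distrC b).
have cg : {within `[a, b], continuous g}.
  apply: derivable_within_continuous => s _; exact: ex_derive.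
have [c _ ->] := MVT_segment ab (fun s _ => g' s) cg.
by rewrite normrM ler_wpM2r.
Qed.

Section C1.
Context (R : realType) (n : nat).
Implicit Types (f : 'rV[R]_n -> R) (x : 'rV[R]_n).

Local Notation e i := (delta_mx 0 i : 'rV[R]_n).

(** The gradient is part of the data, so that gradients of composite functions are read off from the
    combinators below. Continuity of f is a separate clause because [is_derive] only looks along
    lines. *)
Definition is_C1 f (g : 'I_n -> 'rV[R]_n -> R) :=
  [/\ continuous f, forall i, continuous (g i) &
    forall x i, is_derive x (e i) f (g i x)].

Lemma partialE f g : is_C1 f g -> (fun i => partial i f) = g.
Proof. by case=> _ _ f'; apply/funext => i; apply/funext => x; exact: derive_val. Qed.

Lemma is_C1_cst (c : R) : is_C1 (cst c) (fun _ _ => 0).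
Proof.
by split=> [|i|x i]; [exact: cst_continuous|exact: cst_continuous|exact: is_derive_cst].
Qed.

Lemma is_C1_coord j : is_C1 (fun x => x 0 j) (fun i _ => (i == j)%:R).
Proof.
split=> [|i|x i]; [exact: continuous_coord|exact: cst_continuous|].
apply/is_derive_line0.
rewrite (_ : (fun h => _) = fun h : R => h * (i == j)%:R + x 0 j); last first.
  by apply/funext => h; rewrite !mxE eqxx /= eq_sym.
by apply: is_derive_eq; rewrite scaler0 add0r addr0 [LHS]mulr1.
Qed.

Lemma is_C1_add f1 f2 g1 g2 : is_C1 f1 g1 -> is_C1 f2 g2 ->
  is_C1 (fun x => f1 x + f2 x) (fun i x => g1 i x + g2 i x).
Proof.
move=> [c1 cg1 d1] [c2 cg2 d2]; split=> [x|i x|x i].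
- exact: (cvgD (c1 x) (c2 x)).
- exact: (cvgD (cg1 i x) (cg2 i x)).
- exact: is_deriveD.
Qed.

Lemma is_C1_mul f1 f2 g1 g2 : is_C1 f1 g1 -> is_C1 f2 g2 ->
  is_C1 (fun x => f1 x * f2 x) (fun i x => g1 i x * f2 x + f1 x * g2 i x).
Proof.
move=> [c1 cg1 d1] [c2 cg2 d2]; split=> [x|i x|x i].
- exact: (cvgM (c1 x) (c2 x)).
- exact: (cvgD (cvgM (cg1 i x) (c2 x)) (cvgM (c1 x) (cg2 i x))).
- apply: is_derive_eq.
  by rewrite addrC [f2 x *: _]mulrC.
Qed.

Lemma is_C1_comp f g (h dh : R -> R) : is_C1 f g ->
  (forall s : R, is_derive s 1 h (dh s)) -> continuous dh ->
  is_C1 (fun x => h (f x)) (fun i x => dh (f x) * g i x).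
Proof.
move=> [cf cg f'] h' cdh; split=> [x|i x|x i].
- apply: (@continuous_comp _ _ _ f h); first exact: cf.
  apply: differentiable_continuous; apply/derivable1_diffP.
  exact: ex_derive.
- exact: (cvgM (continuous_comp (cf x) (cdh (f x))) (cg i x)).
- exact: (is_derive_comp (h := h)).
Qed.

Lemma edot_delta i x : edot (e i) x = x 0 i.
Proof.
rewrite /edot (bigD1 i)//= !mxE !eqxx mul1r big1 ?addr0// => j ji.
by rewrite !mxE eqxx (negbTE ji) mul0r.
Qed.

Lemma is_C1_sqr_norm : is_C1 (fun x => edot x x / 2) (fun i x => x 0 i).
Proof.
have cq : continuous (fun x : 'rV[R]_n => edot x x / 2).
  have cc : continuous (fun x : 'rV[R]_n => edot x x).
    by apply: (@continuous_edot _ _ _ idfun idfun) => y; exact: cvg_id.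
  by move=> x; exact: (cvgM (cc x) (cvg_cst _)).
split=> // [i|x i]; first exact: continuous_coord.
apply/is_derive_line0.
rewrite (_ : (fun h => _) = fun h : R => (h * h + 2 * (h * x 0 i) + edot x x) / 2).
  apply: is_derive_eq; last first.
    by rewrite !(scaler0, addr0, add0r) /GRing.scale/=; lra.
apply/funext => h; rewrite edotDl !edotDr (edotC x) !edotZl !edotZr !edot_delta.
by rewrite mxE !eqxx /=; ring.
Qed.

End C1.

(** * Bounded functions of bounded support, divergence theorem *)

Section bounded_support.
Context (R : realType) (n : nat).
Implicit Types (f g : 'rV[R]_n -> R) (x : 'rV[R]_n).

(** Boxes rather than balls: the slices of a box along a coordinate are boxes, as the induction in
    [integral_is_C1] requires. *)
Definition supported (r : R) f := forall x, ~ box n r x -> f x = 0.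

(** An algebra of functions integrable for every measure that is finite on boxes; integrability for
    both the Lebesgue and the Gaussian measure is thus reduced to closure properties. *)
Definition bsupp f :=
  [/\ measurable_fun setT f, exists M, forall x, `|f x| <= M &
    exists r, 0 <= r /\ supported r f].

Lemma supportedW r s f : r <= s -> supported r f -> supported s f.
Proof.
by move=> rs fr x xs; apply: fr => xr; apply: xs => i; exact: le_trans rs.
Qed.

Lemma cball_box (r : R) : cball n r `<=` box n r.
Proof. by move=> x xr i; apply: le_trans xr; exact: coord_le_enorm. Qed.

Lemma box_cball (r : R) : box n r `<=` cball n (n%:R * r).
Proof.
move=> x xr; apply: (le_trans (enorm_le_sum x)).
rewrite -[n in n%:R](card_ord n) -sum1_card natr_sum mulr_suml.
by apply: ler_sum => i _; rewrite mul1r.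
Qed.

Lemma closed_box r : closed (box n r : set 'rV[R]_n).
Proof.
rewrite (_ : box n r = \bigcap_(i in [set: 'I_n])
    ((fun x : 'rV[R]_n => x 0 i) @^-1` [set y | `|y| <= r])).
  apply: closed_bigI => i _; apply: preimage_closed.
    by move=> x _; exact: continuous_coord.
  rewrite (_ : mkset _ = `[- r, r]%classic); first exact: interval_closed.
  by apply/seteqP; split => y /=; rewrite in_itv/= ler_norml.
by apply/seteqP; split => x /= h i => [_|]; have := h i => //; apply.
Qed.

Lemma compact_box r : compact (box n r : set 'rV[R]_n).
Proof. exact: (closed_cball_compact (@closed_box r) (@box_cball r)). Qed.

Lemma continuous_bounded_box f r : continuous f ->
  exists M, forall x, box n r x -> `|f x| <= M.
Proof.
move=> cf; have [b0|/set0P b0] := eqVneq (box n r) (set0 : set 'rV[R]_n).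
  by exists 0 => x; rewrite b0.
have cnf : continuous (fun x => `|f x|).
  by move=> x; apply: (continuous_comp (cf x)); exact: norm_continuous.
have [|c _ hc] := @compact_EVT_max _ _ (fun x => `|f x|) _ b0 (@compact_box r).
  exact: continuous_subspaceT.
by exists `|f c| => x xr; apply: hc; rewrite inE.
Qed.

Lemma bsupp_continuous f r : continuous f -> 0 <= r -> supported r f -> bsupp f.
Proof.
move=> cf r0 fr; split; [exact: continuous_measurable_row| |by exists r].
have [M hM] := continuous_bounded_box r cf.
exists `|M| => x; have [xr|xr] := pselect (box n r x).
  by apply: (le_trans (hM x xr)); exact: ler_norm.
by rewrite (fr x xr) normr0.
Qed.

Lemma bsuppD f g : bsupp f -> bsupp g -> bsupp (fun x => f x + g x).
Proof.
move=> [mf [M fM] [r [r0 fr]]] [mg [N gN] [s [s0 gs]]]; split.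
- exact: measurable_funD.
- by exists (M + N) => x; apply: (le_trans (ler_normD _ _)); exact: lerD.
- exists (Num.max r s); split; first by rewrite le_max r0.
  move=> x xrs; rewrite (supportedW _ fr xrs) ?(supportedW _ gs xrs) ?addr0//.
    by rewrite le_max lexx orbT.
  by rewrite le_max lexx.
Qed.

Lemma bsuppM f g : bsupp f -> measurable_fun setT g ->
  (forall r, exists M, forall x, box n r x -> `|g x| <= M) ->
  bsupp (fun x => f x * g x).
Proof.
move=> [mf [M fM] [r [r0 fr]]] mg gb; split.
- exact: measurable_funM.
- have [N gN] := gb r; exists (`|M| * `|N|) => x.
  have [xr|xr] := pselect (box n r x); last by rewrite fr// mul0r normr0 mulr_ge0.
  rewrite normrM ler_pM//.
    by apply: (le_trans (fM x)); exact: ler_norm.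
  by apply: (le_trans (gN x xr)); exact: ler_norm.
- by exists r; split=> // x xr; rewrite fr// mul0r.
Qed.

Lemma bsuppMc f g : bsupp f -> continuous g -> bsupp (fun x => f x * g x).
Proof.
move=> bf cg; apply: bsuppM => //; first exact: continuous_measurable_row.
by move=> r; exact: continuous_bounded_box.
Qed.

Lemma bsuppMb f g : bsupp f -> bsupp g -> bsupp (fun x => f x * g x).
Proof. by move=> bf [mg [M gM] _]; apply: bsuppM => // r; exists M. Qed.

Lemma bsuppZ (c : R) f : bsupp f -> bsupp (fun x => c * f x).
Proof.
move=> bf; rewrite (_ : (fun x => _) = (fun x => f x * c)).
  by apply: bsuppMc => //; exact: cst_continuous.
by apply/funext => x; rewrite mulrC.
Qed.

Lemma bsuppB f g : bsupp f -> bsupp g -> bsupp (fun x => f x - g x).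
Proof.
move=> bf bg; rewrite (_ : (fun x => _) = (fun x => f x + (-1) * g x)).
  by apply: bsuppD => //; exact: bsuppZ.
by apply/funext => x; rewrite mulN1r.
Qed.

Lemma bsupp_cst0 : bsupp (fun=> 0).
Proof.
by split; [exact: measurable_cst|exists 0 => x; rewrite normr0|exists 0; split].
Qed.

Lemma bsupp_sum (I : Type) (s : seq I) (F : I -> 'rV[R]_n -> R) :
  (forall i, bsupp (F i)) -> bsupp (fun x => \sum_(i <- s) F i x).
Proof.
move=> bF; elim: s => [|i s IH].
  rewrite (_ : (fun x => _) = fun=> 0); first exact: bsupp_cst0.
  by apply/funext => x; rewrite big_nil.
rewrite (_ : (fun x => _) = fun x => F i x + \sum_(j <- s) F j x).
  exact: bsuppD.
by apply/funext => x; rewrite big_cons.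
Qed.

Lemma bsupp_indic r (A : set 'rV[R]_n) : 0 <= r -> measurable A ->
  A `<=` box n r -> bsupp (\1_A : 'rV[R]_n -> R).
Proof.
move=> r0 mA Ar; split; first exact: measurable_indic.
  by exists 1 => x; rewrite indicE ger0_norm// lern1 leq_b1.
by exists r; split=> // x xr; rewrite indicE memNset// => /Ar.
Qed.

Lemma bsupp_integrable (mu : {measure set 'rV[R]_n -> \bar R}) f :
  (forall r, mu (box n r) < +oo)%E -> bsupp f -> mu.-integrable setT (EFin \o f).
Proof.
move=> mub [mf [M fM] [r [r0 fr]]].
have : mu.-integrable (box n r) (EFin \o f).
  apply: measurable_bounded_integrable => //; first exact: measurable_box.
    exact: measurable_funTS.
  exists M; split; first exact: num_real.
  by move=> N MN x _; apply: (le_trans (fM x)); exact: ltW.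
rewrite (integrable_mkcond _ (@measurable_box R n r)).
apply: (eq_integrable measurableT) => x _; rewrite patchE; case: ifPn => //.
by move=> /negP xr; rewrite /= fr// => ?; apply: xr; rewrite inE.
Qed.

End bounded_support.

Lemma lebesgue_row_box_lty (R : realType) n (r : R) : (lebesgue_row R n (box n r) < +oo)%E.
Proof.
apply: (@le_lt_trans _ _ (lebesgue_row R n (box n `|r|))).
  apply: le_measure; rewrite ?inE; [exact: measurable_box|exact: measurable_box|].
  by move=> x xr i; apply: (le_trans (xr i)); exact: ler_norm.
by rewrite lebesgue_row_box// ltry.
Qed.

Section divergence.
Context (R : realType).

Lemma continuous_rowP n (T : topologicalType) (f : T -> 'rV[R]_n) :
  (forall i, continuous (fun t => f t 0 i)) -> continuous f.
Proof.
move=> cf t; apply/cvg_ballP => e e0.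
have : \forall s \near t, forall i, ball (f t 0 i) e (f s 0 i).
  by apply: filter_forall => i; have /cvg_ballP := cf i t; apply.
by apply: filterS => s hs; split=> // i j; rewrite ord1.
Qed.

Lemma continuous_row_consr n (s : R) : continuous (fun y : 'rV[R]_n => row_cons (s, y)).
Proof.
apply: continuous_rowP => i; case: (unliftP ord0 i) => [j ->|->].
  under eq_fun do rewrite row_consS.
  exact: continuous_coord.
by under eq_fun do rewrite row_cons0; exact: cst_continuous.
Qed.

Lemma continuous_row_consl n (y : 'rV[R]_n) : continuous (fun s : R => row_cons (s, y)).
Proof.
apply: continuous_rowP => i; case: (unliftP ord0 i) => [j ->|->].
  by under eq_fun do rewrite row_consS; exact: cst_continuous.
by under eq_fun do rewrite row_cons0; move=> s; exact: cvg_id.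
Qed.

Lemma box_row_cons n (r s : R) (y : 'rV[R]_n) :
  box n.+1 r (row_cons (s, y)) <-> `|s| <= r /\ box n r y.
Proof.
have := preimage_row_cons_box n r.
move=> /(congr1 (fun A => A (s, y))) /= ->.
by rewrite in_itv/= -ler_norml.
Qed.

Lemma is_C1_supported n (f : 'rV[R]_n -> R) g r : is_C1 f g -> supported r f ->
  forall i, supported r (g i).
Proof.
move=> [_ _ f'] fr i x xr; have [_ <-] := f' x i.
rewrite (@near_eq_derive _ _ _ f (cst 0)); first exact: derive_cst.
have : open (~` box n r : set 'rV[R]_n) by apply: closed_openC; exact: closed_box.
by rewrite openE => /(_ x xr); apply: filterS => y yr; exact: fr.
Qed.

Lemma integral_derive_compact (f df : R -> R) (r : R) : 0 < r ->
  (forall s : R, is_derive s 1 f (df s)) -> continuous df ->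
  (forall s, r < `|s| -> f s = 0) -> (forall s, r < `|s| -> df s = 0) ->
  (\int[lebesgue_measure]_s (df s)%:E = 0)%E.
Proof.
move=> r0 f' cdf fr dfr.
have cf : continuous f.
  move=> s; apply: differentiable_continuous; apply/derivable1_diffP.
  exact: ex_derive.
(* Vanishing is known only for |s| > r, hence the margin 1 beyond r. *)
transitivity (\int[lebesgue_measure]_(s in `[(- (r + 1))%R, (r + 1)%R]) (df s)%:E)%E.
  rewrite [RHS]integral_mkcond; apply: eq_integral => s _; rewrite patchE.
  case: ifPn => //; rewrite notin_setE/= in_itv/= -ler_norml => /negP.
  by rewrite -ltNge => hs; rewrite dfr//; lra.
rewrite (@continuous_FTC2 _ df f)//.
- rewrite !fr ?subee// ?normrN ger0_norm; lra.
- lra.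
- exact: continuous_subspaceT.
- split => [s _| |].
  + exact: ex_derive.
  + by apply: cvg_at_right_filter; exact: cf.
  + by apply: cvg_at_left_filter; exact: cf.
- by move=> s _; rewrite derive1E derive_val.
Qed.

(** Induction on the dimension. A derivative along the first coordinate is integrated first in that
    variable and vanishes by the fundamental theorem; for any other direction, freezing the first
    coordinate leaves the same statement one dimension lower. *)
Lemma integral_is_C1 n (f : 'rV[R]_n -> R) g r i : is_C1 f g -> 0 < r ->
  supported r f -> (\int[lebesgue_row R n]_x (g i x)%:E = 0)%E.
Proof.
elim: n f g i => [|n IH] f g i fg r0 fr; first by case: i.
have gr := is_C1_supported fg fr i.
have [cf cg f'] := fg.
have intg : (lebesgue_row R n.+1).-integrable setT (EFin \o g i).
  apply: bsupp_integrable; first by move=> s; exact: lebesgue_row_box_lty.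
  by apply: (bsupp_continuous (cg i) (ltW r0)).
have [E1 E2] := integral_lebesgue_row_succ intg.
case: (unliftP ord0 i) => [j ij|i0].
- rewrite E1 integral0_eq// => s _; rewrite ij /=.
  apply: (IH (fun y => f (row_cons (s, y))) (fun k y => g (lift ord0 k) (row_cons (s, y))) j)
    => //=.
  + split=> [y|k y|y k].
    * exact: (continuous_comp (@continuous_row_consr n s y) (cf _)).
    * exact: (continuous_comp (@continuous_row_consr n s y) (cg _ _)).
    * apply/is_derive_line0.
      have /is_derive_line0 := f' (row_cons (s, y)) (lift ord0 k).
      congr (is_derive _ _ _ _); apply/funext => h; congr f.
      apply/rowP => l; case: (unliftP ord0 l) => [m ->|->].
        by rewrite mxE !row_consS !mxE !eqxx/= (inj_eq lift_inj).
      by rewrite mxE !row_cons0 !mxE /= mulr0 add0r.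
  + by move=> y yr; apply: fr => /box_row_cons[].
- rewrite E2 integral0_eq// => y _.
  apply: (@integral_derive_compact (fun s => f (row_cons (s, y))) _ r) => //=.
  + move=> s; have := f' (row_cons (0, y)) i.
    have -> : (fun s => f (row_cons (s, y))) =
        (fun s : R => f (s *: delta_mx 0 i + row_cons (0, y))).
      apply/funext => h; congr f.
      apply/rowP => l; case: (unliftP ord0 l) => [m ->|->].
        by rewrite [in RHS]mxE !row_consS !mxE i0/= mulr0 add0r.
      by rewrite [in RHS]mxE !row_cons0 !mxE i0/= mulr1 addr0.
    move=> _; apply/is_derive_line.
    rewrite (_ : s *: _ + _ = row_cons (s, y)); first exact: f'.
    apply/rowP => l; case: (unliftP ord0 l) => [m ->|->].
      by rewrite mxE !row_consS !mxE i0/= mulr0 add0r.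
    by rewrite mxE !row_cons0 !mxE i0/= mulr1 addr0.
  + by move=> s; exact: (continuous_comp (@continuous_row_consl n y s) (cg _ _)).
  + by move=> s rs; apply: fr => /box_row_cons[]; rewrite leNgt rs.
  + by move=> s rs; apply: gr => /box_row_cons[]; rewrite leNgt rs.
Qed.

End divergence.

(** * L^2 and the Gaussian measure *)

Section L2_complete.
Context d (T : measurableType d) (R : realType) (mu : {measure set T -> \bar R}).

Lemma limn_einf_le (u : (\bar R)^nat) (c : \bar R) :
  (forall l, (u l <= c)%E) -> (limn_einf u <= c)%E.
Proof.
move=> uc; rewrite limn_einf_lim; apply: lime_le; first exact: is_cvg_einfs.
apply: nearW => l; apply: le_trans (uc l); apply: ereal_inf_lbound.
by exists l => /=.
Qed.

(** Riesz-Fischer with a rate. The rate 4^-k leaves room for weights 2^j: the sum of 2^j (f_j -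
    f_(j+1))^2 has integral at most 2B, so it is finite almost everywhere, which forces pointwise
    convergence; Fatou's lemma then carries the bound to the limit. *)
Lemma L2_complete (f : nat -> T -> R) (B : R) :
  0 <= B ->
  (forall k, measurable_fun setT (f k)) ->
  (forall k l, (k <= l)%N ->
    (\int[mu]_x ((f k x - f l x) ^+ 2)%:E <= (B / 4 ^+ k)%:E)%E) ->
  exists g : T -> R, measurable_fun setT g /\
    forall k, (\int[mu]_x ((f k x - g x) ^+ 2)%:E <= (B / 4 ^+ k)%:E)%E.
Proof.
move=> B0 mf fB.
pose t j x : \bar R := (2 ^+ j * (f j x - f j.+1 x) ^+ 2)%:E.
have t0 j x : (0 <= t j x)%E by rewrite lee_fin mulr_ge0 ?sqr_ge0 ?exprn_ge0.
have mt j : measurable_fun setT (t j).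
  apply/measurable_EFinP; apply: measurable_funM => //.
  by apply: measurable_funX; exact: measurable_funB.
pose S x := (\sum_(j <oo) t j x)%E.
have mS : measurable_fun setT S.
  by apply: (ge0_emeasurable_sum (h := t) (P := xpredT)) => // k x _ _; exact: t0.
have S0 x : (0 <= S x)%E by apply: nneseries_ge0.
have intS : (\int[mu]_x S x < +oo)%E.
  rewrite integral_nneseries//.
  apply: (@le_lt_trans _ _ (2 * B)%:E); last by rewrite ltry.
  apply: lime_le; first by apply: is_cvg_nneseries => j _ _; exact: integral_ge0.
  apply: nearW => N; apply: (@le_trans _ _ (\sum_(0 <= j < N) (B / 2 ^+ j)%:E)%E).
    apply: lee_sum => j _; rewrite /t.
    under eq_integral do rewrite EFinM.
    rewrite ge0_integralZl//; last 2 first.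
    - apply/measurable_EFinP; apply: measurable_funX; exact: measurable_funB.
    - by move=> x _; rewrite lee_fin sqr_ge0.
    apply: le_trans (_ : ((2 ^+ j)%:E * (B / 4 ^+ j)%:E <= _)%E).
      by apply: lee_wpmul2l; [rewrite lee_fin exprn_ge0|exact: fB].
    rewrite -EFinM lee_fin (_ : 4 = 2 * 2) ?exprMn; last by rewrite -natrM.
    by rewrite invfM mulrCA mulrA mulrA mulfK ?lexx// gt_eqF// exprn_gt0.
  rewrite sumEFin lee_fin -mulr_sumr mulrC ler_wpM2r//.
  have -> : \sum_(0 <= j < N) (2 ^+ j)^-1 = 2 * (1 - (2 ^+ N)^-1) :> R.
    elim: N => [|N IH]; first by rewrite big_geq// expr0 invr1 subrr mulr0.
    rewrite big_nat_recr//= IH exprS invfM; lra.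
  have : 0 <= (2 ^+ N)^-1 :> R by rewrite invr_ge0 exprn_ge0.
  lra.
pose A := [set x | (S x < +oo)%E].
have mA : measurable A.
  rewrite -[A]setTI; exact: emeasurable_fun_infty_o.
have nA : mu.-negligible (~` A).
  have iS : mu.-integrable setT S.
    apply/integrableP; split=> //; under eq_integral do rewrite gee0_abs//.
    by [].
  have [N [mN N0 sN]] := integrable_ae measurableT iS.
  exists N; split=> // x Ax; apply: sN => /= /(_ Logic.I).
  by rewrite ge0_fin_numE.
have cvgA x : A x -> cvgn (f ^~ x).
  move=> Ax.
  have cs : cvgn (series (telescope (f ^~ x))).
    apply: normed_cvg; apply: nondecreasing_is_cvgn.
      by apply: nondecreasing_series => *; exact: normr_ge0.
    exists (1 + fine (S x)) => _ [N _ <-].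
    rewrite /normed_series_of /series/=.
    have : \sum_(0 <= j < N) (2 ^+ j * (f j x - f j.+1 x) ^+ 2) <= fine (S x).
      rewrite -lee_fin fineK ?ge0_fin_numE// -sumEFin.
      exact: (nneseries_lim_ge (u_ := t ^~ x) (P := xpredT)).
    have : \sum_(0 <= j < N) (2 ^+ j)^-1 <= 2 :> R.
      have -> : \sum_(0 <= j < N) (2 ^+ j)^-1 = 2 * (1 - (2 ^+ N)^-1) :> R.
        elim: N => [|N IH]; first by rewrite big_geq// expr0 invr1 subrr mulr0.
        rewrite big_nat_recr//= IH exprS invfM; lra.
      have : 0 <= (2 ^+ N)^-1 :> R by rewrite invr_ge0 exprn_ge0.
      lra.
    set a := \sum_(_ <= _ < _) _^-1; set b := \sum_(_ <= _ < _) (_ * _).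
    (* Arithmetic-geometric inequality termwise: 2 |e| <= 2^-j + 2^j e^2. *)
    have : \sum_(0 <= j < N) `|telescope (f ^~ x) j| <= (a + b) / 2.
      rewrite /a /b -big_split mulr_suml /=; apply: ler_sum => j _.
      rewrite /telescope distrC.
      have p0 : 0 < 2 ^+ j :> R by rewrite exprn_gt0.
      set q := 2 ^+ j in p0 *; set e := f j x - f j.+1 x.
      rewrite ler_pdivlMr// -(real_normK (num_real e)).
      have : 0 <= q^-1 * (q * `|e| - 1) ^+ 2.
        by rewrite mulr_ge0 ?sqr_ge0// invr_ge0 ltW.
      rewrite (_ : q^-1 * _ = q^-1 + q * `|e| ^+ 2 - `|e| * 2); first by rewrite subr_ge0.
      by field; rewrite gt_eqF.
    have : 0 <= fine (S x) by exact: fine_ge0.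
    lra.
  move: cs; rewrite telescopeK => cs.
  rewrite (_ : f ^~ x = (fun n => f n x - f 0%N x + f 0%N x)).
    by apply: is_cvgD => //; exact: is_cvg_cst.
  by apply/funext => n; rewrite subrK.
(* Set to 0 off the convergence set, the sequence converges at every point and its limit is
   measurable. *)
pose h k x := f k x * \1_A x.
have mh k : measurable_fun setT (h k).
  by apply: measurable_funM => //; exact: measurable_indic.
pose g x := limn (h ^~ x).
have hg x : h ^~ x @ \oo --> g x.
  have [Ax|Ax] := pselect (A x).
    apply/cvg_ex; exists (limn (f ^~ x)) => /=.
    rewrite (_ : h ^~ x = f ^~ x); first exact: (cvgA _ Ax).
    by apply/funext => k; rewrite /h indicE mem_set// mulr1.
  apply/cvg_ex; exists 0 => /=; rewrite (_ : h ^~ x = cst 0); first exact: cvg_cst.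
  by apply/funext => k; rewrite /h indicE memNset// mulr0.
have mg : measurable_fun setT g by exact: (measurable_fun_cvg mh (fun x _ => hg x)).
exists g; split=> // k.
pose u l x : \bar R := ((f k x - h (k + l)%N x) ^+ 2)%:E.
have mu_ l : measurable_fun setT (u l).
  by apply/measurable_EFinP; apply: measurable_funX; exact: measurable_funB.
have u0 l x : setT x -> (0 <= u l x)%E by rewrite lee_fin sqr_ge0.
have ug x : limn_einf (u ^~ x) = ((f k x - g x) ^+ 2)%:E.
  have hl : h (k + l)%N x @[l --> \oo] --> g x.
    have := hg x; rewrite -(cvg_shiftn k).
    by rewrite (_ : (fun l => h (l + k)%N x) = fun l => h (k + l)%N x)//;
      apply/funext => l; rewrite addnC.
  have hl1 : f k x - h (k + l)%N x @[l --> \oo] --> f k x - g x.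
    by apply: cvgB => //; exact: cvg_cst.
  apply: (cvg_limn_einf_sup _).1; apply/fine_cvgP; split; first exact: nearW.
  exact: (cvgM hl1 hl1).
apply: (@le_trans _ _ (\int[mu]_x (limn_einf (u ^~ x)))%E).
  by rewrite le_eqVlt; apply/orP; left; apply/eqP/eq_integral => x _; rewrite ug.
apply: (le_trans (fatou mu measurableT mu_ u0)); apply: limn_einf_le => l.
apply: le_trans (fB k (k + l)%N (leq_addr _ _)).
rewrite le_eqVlt; apply/orP; left; apply/eqP; apply: ge0_ae_eq_integral => //.
- by apply/measurable_EFinP; apply: measurable_funX; exact: measurable_funB.
- by move=> x _; rewrite lee_fin sqr_ge0.
- by move=> x _; rewrite lee_fin sqr_ge0.
- have [N [mN N0 sN]] := nA; exists N; split=> // x /= hx; apply: sN => /= Ax.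
  apply: hx => _.
  by rewrite /u /h indicE mem_set// mulr1.
Qed.

End L2_complete.

Section L2.
Context d (T : measurableType d) (R : realType) (mu : {measure set T -> \bar R}).
Implicit Types f g h : T -> R.

Definition L2 f := measurable_fun setT f /\
  mu.-integrable setT (EFin \o (fun x => f x ^+ 2)).

Definition ip f g := \int[mu]_x (f x * g x).

Lemma L2M f g : L2 f -> L2 g -> mu.-integrable setT (EFin \o (fun x => f x * g x)).
Proof.
move=> [mf f2] [mg g2].
have := integrableD measurableT f2 g2; apply: le_integrable => //.
  by apply/measurable_EFinP; exact: measurable_funM.
move=> x _ /=; rewrite lee_fin normrM [leRHS]ger0_norm; last by rewrite addr_ge0 ?sqr_ge0.
rewrite -(real_normK (num_real (f x))) -(real_normK (num_real (g x))).
by have := sqr_ge0 (`|f x| - `|g x|); have := normr_ge0 (f x); have := normr_ge0 (g x); nra.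
Qed.

Lemma L2Z (a : R) f : L2 f -> L2 (fun x => a * f x).
Proof.
move=> [mf f2]; split; first exact: measurable_funM.
have := integrableZl measurableT (a ^+ 2) f2.
by apply: eq_integrable => // x _ /=; rewrite -EFinM exprMn.
Qed.

Lemma L2D f g : L2 f -> L2 g -> L2 (fun x => f x + g x).
Proof.
move=> Lf Lg; have [mf f2] := Lf; have [mg g2] := Lg.
split; first exact: measurable_funD.
have := integrableD measurableT (integrableD measurableT f2 g2)
  (integrableZl measurableT 2 (L2M Lf Lg)).
by apply: eq_integrable => // x _ /=; rewrite -EFinM -!EFinD; congr EFin; ring.
Qed.

Lemma L2B f g : L2 f -> L2 g -> L2 (fun x => f x - g x).
Proof.
move=> Lf Lg; rewrite (_ : (fun x => _) = fun x => f x + (-1) * g x).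
  exact/L2D/L2Z.
by apply/funext => x; rewrite mulN1r.
Qed.

Lemma L2_lty f : measurable_fun setT f ->
  (\int[mu]_x (f x ^+ 2)%:E < +oo)%E -> L2 f.
Proof.
move=> mf foo; split=> //; apply/integrableP; split.
  by apply/measurable_EFinP; exact: measurable_funX.
under eq_integral do rewrite /= ger0_norm ?sqr_ge0//.
exact: foo.
Qed.

Lemma ipE f : L2 f -> (\int[mu]_x (f x ^+ 2)%:E = (ip f f)%:E)%E.
Proof.
by move=> Lf; rewrite /ip /Rintegral fineK// integrable_fin_num//; exact: L2M.
Qed.

Lemma ipC f g : ip f g = ip g f.
Proof. by apply: eq_Rintegral => x _; rewrite mulrC. Qed.

Lemma ipDl f g h : L2 f -> L2 g -> L2 h ->
  ip (fun x => f x + g x) h = ip f h + ip g h.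
Proof.
move=> Lf Lg Lh; rewrite -RintegralD//; [|exact: L2M|exact: L2M].
by apply: eq_Rintegral => x _; rewrite mulrDl.
Qed.

Lemma ipZl a f h : L2 f -> L2 h -> ip (fun x => a * f x) h = a * ip f h.
Proof.
move=> Lf Lh; rewrite -RintegralZl//; last exact: L2M.
by apply: eq_Rintegral => x _; rewrite mulrA.
Qed.

Lemma ipDr f g h : L2 f -> L2 g -> L2 h ->
  ip h (fun x => f x + g x) = ip h f + ip h g.
Proof. by move=> Lf Lg Lh; rewrite ipC ipDl// !(ipC h). Qed.

Lemma ipZr a f h : L2 f -> L2 h -> ip h (fun x => a * f x) = a * ip h f.
Proof. by move=> Lf Lh; rewrite ipC ipZl// (ipC h). Qed.

Lemma ipBl f g h : L2 f -> L2 g -> L2 h ->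
  ip (fun x => f x - g x) h = ip f h - ip g h.
Proof.
move=> Lf Lg Lh; rewrite -RintegralB//; [|exact: L2M|exact: L2M].
by apply: eq_Rintegral => x _; rewrite mulrBl.
Qed.

Lemma ipBr f g h : L2 f -> L2 g -> L2 h ->
  ip h (fun x => f x - g x) = ip h f - ip h g.
Proof. by move=> Lf Lg Lh; rewrite ipC ipBl// !(ipC h). Qed.

Lemma ip_ge0 f : 0 <= ip f f.
Proof. by apply: Rintegral_ge0 => x _; rewrite -expr2 sqr_ge0. Qed.

Lemma ip_CS f g : L2 f -> L2 g -> ip f g ^+ 2 <= ip f f * ip g g.
Proof.
move=> Lf Lg.
have P s t : 0 <= s ^+ 2 * ip f f + 2 * s * t * ip f g + t ^+ 2 * ip g g.
  have := ip_ge0 (fun x => s * f x + t * g x).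
  have Lsf := L2Z s Lf; have Ltg := L2Z t Lg; have Ls := L2D Lsf Ltg.
  rewrite ipDl// !ipDr// !ipZl// !ipZr// (ipC g f).
  by rewrite (_ : _ + _ + _ = s ^+ 2 * ip f f + 2 * s * t * ip f g + t ^+ 2 * ip g g)//; ring.
set a := ip f f in P *; set b := ip f g in P *; set c := ip g g in P *.
have a0 : 0 <= a by exact: ip_ge0.
have c0 : 0 <= c by exact: ip_ge0.
have [a00|ap] := eqVneq a 0.
  have [b0|bn] := eqVneq b 0; first by rewrite b0 expr0n/= mulr_ge0.
  (* When a = 0 and b <> 0 the form is affine in its first argument; this choice gives it the
     negative value - c - 2. *)
  have := P (- (c + 1) / b) 1; rewrite a00 mulr0 add0r expr1n mul1r mulr1.
  rewrite (_ : 2 * (- (c + 1) / b) * b + c = - c - 2); first by lra.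
  by field.
have ap' : 0 < a by rewrite lt0r ap.
have := P (- b) a.
rewrite (_ : _ + _ + _ = a * (a * c - b ^+ 2)); last by ring.
by rewrite pmulr_rge0// subr_ge0.
Qed.

End L2.

Section gauss.
Context (R : realType) (n : nat).
Implicit Types (f phi : 'rV[R]_n -> R) (x : 'rV[R]_n).

Local Notation gam := (gauss_row R n).
Local Notation rho := (@gauss_density R n).

Lemma gauss_densityE x : rho x = (2 * pi) `^ (- (n%:R / 2)) * expR (- (edot x x / 2)).
Proof. by rewrite /gauss_density sqr_enorm. Qed.

Lemma gauss_density_le x : rho x <= (2 * pi) `^ (- (n%:R / 2)).
Proof.
rewrite gauss_densityE ler_piMr ?powR_ge0// expR_le1 oppr_le0.
by rewrite divr_ge0// edot_ge0.
Qed.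

Lemma is_C1_gauss_density : is_C1 rho (fun i x => - x 0 i * rho x).
Proof.
have := is_C1_mul (is_C1_cst n ((2 * pi) `^ (- (n%:R / 2)) : R))
  (is_C1_comp (@is_C1_sqr_norm R n) (h := fun s => expR (- s)) (dh := fun s => - expR (- s)) _ _).
move=> H; have {H} := H.
have h1 : forall s : R, is_derive s 1 (fun s : R => expR (- s)) (- expR (- s)).
  by move=> s; apply: is_derive_eq; rewrite mulrN1.
have h2 : continuous (fun s : R => - expR (- s)).
  move=> s; apply: cvgN; apply: (@continuous_comp _ _ _ -%R expR).
    exact: opp_continuous.
  exact: continuous_expR.
move=> /(_ h1 h2) [c cg c']; split.
- by move=> x; rewrite (_ : rho = fun y => cst ((2 * pi) `^ (- (n%:R / 2))) y *
    expR (- (edot y y / 2))); [exact: c|apply/funext => y; exact: gauss_densityE].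
- move=> i; rewrite (_ : (fun x => _) = fun x => 0 * expR (- (edot x x / 2)) +
    cst ((2 * pi) `^ (- (n%:R / 2))) x * (- expR (- (edot x x / 2)) * x 0 i)).
    exact: cg.
  by apply/funext => y; rewrite gauss_densityE /cst; ring.
- move=> x i; rewrite (_ : rho = fun y => cst ((2 * pi) `^ (- (n%:R / 2))) y *
    expR (- (edot y y / 2))); last by apply/funext => y; exact: gauss_densityE.
  by apply: is_derive_eq; rewrite /cst; ring.
Qed.

Lemma gauss_row_le A : measurable A ->
  (gam A <= ((2 * pi) `^ (- (n%:R / 2)))%:E * lebesgue_row R n A)%E.
Proof.
move=> mA; rewrite -integral_cst//; apply: ge0_le_integral => //.
- by move=> x _; rewrite lee_fin gauss_density_ge0.
- by apply/measurable_EFinP/measurable_funTS; exact: measurable_gauss_density.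
- by move=> x _; rewrite lee_fin gauss_density_le.
Qed.

Lemma gauss_row_box_lty r : (gam (box n r) < +oo)%E.
Proof.
apply: (le_lt_trans (gauss_row_le (@measurable_box R n r))).
by rewrite lte_mul_pinfty ?lee_fin ?powR_ge0// lebesgue_row_box_lty.
Qed.

Lemma bsupp_gauss_integrable f : bsupp f -> gam.-integrable setT (EFin \o f).
Proof. by apply: bsupp_integrable => r; exact: gauss_row_box_lty. Qed.

Lemma bsupp_lebesgue_integrable f : bsupp f ->
  (lebesgue_row R n).-integrable setT (EFin \o f).
Proof. by apply: bsupp_integrable => r; exact: lebesgue_row_box_lty. Qed.

Lemma bsupp_L2 f : bsupp f -> L2 gam f.
Proof. by move=> bf; split; [case: bf|apply: bsupp_gauss_integrable; exact: bsuppMb]. Qed.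

Lemma gauss_RintegralE f : bsupp f ->
  \int[gam]_x f x = \int[lebesgue_row R n]_x (f x * rho x).
Proof.
move=> bf; apply: Rintegral_density => //.
- exact: gauss_density_ge0.
- exact: measurable_gauss_density.
- exact: bsupp_gauss_integrable.
Qed.

Lemma is_C1_bsupp f g r : is_C1 f g -> 0 <= r -> supported r f ->
  bsupp f /\ forall i, bsupp (g i).
Proof.
move=> fg r0 fr; have [cf cg _] := fg; split; first exact: (bsupp_continuous cf r0).
by move=> i; apply: (bsupp_continuous (cg i) r0); exact: (is_C1_supported fg fr).
Qed.

Lemma Rintegral_is_C1 f g r i : is_C1 f g -> 0 < r -> supported r f ->
  \int[lebesgue_row R n]_x g i x = 0.
Proof. by move=> fg r0 fr; rewrite /Rintegral (integral_is_C1 i fg r0 fr). Qed.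

End gauss.

(** * Test functions and the variational form of the torsion *)

Section test_functions.
Context (R : realType) (n : nat).
Implicit Types (f phi psi : 'rV[R]_n -> R) (x y : 'rV[R]_n) (Omega : set 'rV[R]_n).

Local Notation e i := (delta_mx 0 i : 'rV[R]_n).

(* From x to y one coordinate at a time. *)
Lemma bounded_partial_lipschitz f (g : 'I_n -> 'rV[R]_n -> R) (M : R) x y :
  (forall x i, is_derive x (e i) f (g i x)) -> (forall i x, `|g i x| <= M) ->
  `|f y - f x| <= M * \sum_(i < n) `|y 0 i - x 0 i|.
Proof.
move=> f' gM.
pose z (k : nat) : 'rV[R]_n := \row_j (if (j < k)%N then y 0 j else x 0 j).
have z0 : z 0%N = x by apply/rowP => j; rewrite mxE.
have zn : z n = y by apply/rowP => j; rewrite mxE ltn_ord.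
rewrite -{1}z0 -{1}zn -(telescope_sumr (fun k => f (z k)))// big_mkord mulr_sumr.
apply: (le_trans (ler_norm_sum _ _ _)); apply: ler_sum => i _.
have zS : z i.+1 = (y 0 i - x 0 i) *: e i + z i.
  apply/rowP => j; rewrite !mxE eqxx/= ltnS.
  have [->|ji] := eqVneq j i; first by rewrite leqnn ltnn mulr1 subrK.
  have /negbTE jin : (j != i :> nat) by [].
  by rewrite mulr0 add0r leq_eqVlt jin.
have := @derive_bounded_lipschitz R (fun s => f (s *: e i + z i))
  (fun s => g i (s *: e i + z i)) M 0 (y 0 i - x 0 i).
rewrite scale0r add0r subr0 zS; apply => // s.
exact/is_derive_line.
Qed.

Lemma bounded_partial_continuous f (g : 'I_n -> 'rV[R]_n -> R) (M : R) :
  0 <= M -> (forall x i, is_derive x (e i) f (g i x)) ->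
  (forall i x, `|g i x| <= M) -> continuous f.
Proof.
move=> M0 f' gM; apply: (@enorm_lipschitz_continuous _ _ _ (M * n%:R)) => x y.
apply: (le_trans (bounded_partial_lipschitz y x f' gM)).
rewrite -mulrA ler_wpM2l// -[n in n%:R](card_ord n) -sum1_card natr_sum mulr_suml.
apply: ler_sum => i _; rewrite mul1r; have := coord_le_enorm (x - y) i.
by rewrite !mxE.
Qed.

Lemma partial_supported Omega phi (r : R) i :
  test_function Omega phi -> supported r phi -> supported r (partial i phi).
Proof.
move=> [dphi _ _] phir x xr.
rewrite /partial (@near_eq_derive _ _ _ phi (cst 0)); first exact: derive_cst.
have : open (~` box n r : set 'rV[R]_n) by apply: closed_openC; exact: closed_box.
by rewrite openE => /(_ x xr); apply: filterS => y yr; exact: phir.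
Qed.

Lemma partial_outside Omega phi i x :
  test_function Omega phi -> ~ Omega x -> partial i phi x = 0.
Proof.
move=> [dphi _ [K [cK KO phi0]]] xO.
have xK : ~ K x by move=> /KO.
rewrite /partial (@near_eq_derive _ _ _ phi (cst 0)); first exact: derive_cst.
have : open (~` K) by apply: closed_openC; apply: compact_closed => //; exact: Rhausdorff.
by rewrite openE => /(_ x xK); apply: filterS => y yK; exact: phi0.
Qed.

(** A test function is only required to have continuous partial derivatives. Its own continuity
    follows because these are supported in a box, hence bounded, which makes it Lipschitz. *)
Lemma test_function_C1 Omega phi (r : R) : test_function Omega phi ->
  supported r phi -> is_C1 phi (fun i => partial i phi).
Proof.
move=> tphi phir; have [dphi cphi _] := tphi.
have d x i : is_derive x (e i) phi (partial i phi x) by exact/derivableP.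
have bM (i : 'I_n) : exists M : R, forall x, `|partial i phi x| <= `|M|.
  have [M hM] := continuous_bounded_box r (cphi i).
  exists M => x; have [xr|xr] := pselect (box n r x).
    by apply: (le_trans (hM x xr)); exact: ler_norm.
  by rewrite (partial_supported i tphi phir xr) normr0.
have [M hM] := choice bM; split=> //.
apply: (@bounded_partial_continuous _ (fun i => partial i phi) (\sum_i `|M i|)) => //.
  by apply: sumr_ge0.
move=> i x; apply: (le_trans (hM i x)); rewrite (bigD1 i)//= lerDl.
by apply: sumr_ge0.
Qed.

Lemma C1_test_function Omega f g (K : set 'rV[R]_n) : is_C1 f g -> compact K ->
  K `<=` Omega -> (forall x, ~ K x -> f x = 0) -> test_function Omega f.
Proof.
move=> fg cK KO f0; have [cf cg f'] := fg; split; last by exists K.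
  by move=> x i; exact: ex_derive.
by move=> i; have := partialE fg => /(congr1 (fun h => h i)) ->; exact: cg.
Qed.

Lemma test_function_supported Omega phi (r : R) : Omega `<=` box n r ->
  test_function Omega phi -> supported r phi.
Proof. by move=> Or [_ _ [K [_ KO phi0]]] x xr; apply: phi0 => /KO/Or. Qed.

Lemma test_function_lin Omega (r : R) phi psi (a b : R) : Omega `<=` box n r ->
  test_function Omega phi -> test_function Omega psi ->
  test_function Omega (fun x => a * phi x + b * psi x) /\
  forall i, partial i (fun x => a * phi x + b * psi x) =
    (fun x => a * partial i phi x + b * partial i psi x).
Proof.
move=> Or tphi tpsi.
have Z c f : test_function Omega f ->
    is_C1 (fun x => c * f x) (fun i x => c * partial i f x).
  move=> tf; have := is_C1_mul (is_C1_cst n c)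
    (test_function_C1 tf (test_function_supported Or tf)).
  by congr (is_C1 _ _); apply/funext => i; apply/funext => x; rewrite mul0r add0r.
have C := is_C1_add (Z a _ tphi) (Z b _ tpsi).
split; last by move=> i; have := partialE C => /(congr1 (fun h => h i)).
have [_ _ [K [cK KO phi0]]] := tphi; have [_ _ [L [cL LO psi0]]] := tpsi.
apply: (C1_test_function C (compactU cK cL)).
  by move=> x []; [exact: KO|exact: LO].
by move=> x /not_orP[xK xL]; rewrite phi0// psi0// !mulr0 addr0.
Qed.

Lemma test_function0 Omega : test_function Omega (fun=> 0).
Proof.
apply: (@C1_test_function _ _ (fun _ _ => 0) set0) => //.
  exact: (is_C1_cst n (0 : R)).
exact: compact0.
Qed.

Lemma test_function_bsupp Omega (r : R) phi : 0 <= r -> Omega `<=` box n r ->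
  test_function Omega phi -> bsupp phi /\ forall i, bsupp (partial i phi).
Proof.
move=> r0 Or tphi; have s := test_function_supported Or tphi.
exact: (is_C1_bsupp (test_function_C1 tphi s) r0 s).
Qed.

End test_functions.

Lemma Rintegral_sum d (T : measurableType d) (R : realType)
    (mu : {measure set T -> \bar R}) (I : Type) (s : seq I) (F : I -> T -> R) :
  (forall i, mu.-integrable setT (EFin \o F i)) ->
  \int[mu]_x (\sum_(i <- s) F i x) = \sum_(i <- s) \int[mu]_x F i x.
Proof.
move=> iF.
have iS (r : seq I) : mu.-integrable setT (EFin \o (fun x => \sum_(i <- r) F i x)).
  have := integrable_sum measurableT r (P := xpredT) (fun i _ => iF i).
  by apply: eq_integrable => // x _ /=; rewrite sumEFin.
elim: s => [|i s IH].
  by rewrite big_nil; under eq_Rintegral do rewrite big_nil;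
    rewrite Rintegral_cst// mul0r.
by rewrite big_cons -IH -RintegralD//; apply: eq_Rintegral => x _; rewrite big_cons.
Qed.

(** * Poincare inequality and weak equation of the radial solution *)

Section gauss_identities.
Context (R : realType).

Local Notation rho := (@gauss_density R _).

Lemma is_derive_sqr_half (s : R) : is_derive s 1 (fun t : R => t ^+ 2 / 2) s.
Proof.
have -> : (fun t : R => t ^+ 2 / 2) = (fun t => t * t / 2).
  by apply/funext => t; rewrite expr2.
by apply: is_derive_eq; rewrite !(scaler0, addr0, add0r) /GRing.scale/=; lra.
Qed.

(* Integrate the divergence of f^2 a(x_0) rho e_0, where a' dominates a^2. *)
Lemma gauss_poincare n (r : R) : 0 < r -> exists2 C, 0 < C &
  forall (f : 'rV[R]_n.+1 -> R) g, is_C1 f g -> supported r f ->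
    ip (gauss_row R n.+1) f f <= C * ip (gauss_row R n.+1) (g ord0) (g ord0).
Proof.
move=> r0; pose E (s : R) := expR (s ^+ 2 / 2).
(* Chosen so that dl s^2 E(s) <= 1/2 for |s| <= r. With a = dl s E this gives a^2 <= dl E / 2
   there. *)
pose dl := (2 * (1 + r ^+ 2 * E r))^-1.
have r2 : 0 <= r ^+ 2 * E r by rewrite mulr_ge0 ?sqr_ge0 ?expR_ge0.
have dl0 : 0 < dl by rewrite invr_gt0; lra.
have dE : dl * (2 * (1 + r ^+ 2 * E r)) = 1 by rewrite mulVf//; lra.
exists (2 / dl) => [|f g fg fr]; first by rewrite divr_gt0.
pose a s := dl * s * E s.
have E' (s : R) : is_derive s 1 E (s * E s).
  rewrite mulrC; apply: (@is_derive1_comp _ expR (fun t : R => t ^+ 2 / 2) s).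
  exact: is_derive_sqr_half.
have a' (s : R) : is_derive s 1 a (dl * (1 + s ^+ 2) * E s).
  by apply: is_derive_eq; rewrite /GRing.scale/=; ring.
have cE : continuous E.
  move=> s; apply: differentiable_continuous; apply/derivable1_diffP.
  exact: ex_derive.
have cda : continuous (fun s : R => dl * (1 + s ^+ 2) * E s).
  move=> s; apply: cvgM; last exact: cE.
  apply: cvgM; first exact: cvg_cst.
  apply: cvgD; first exact: cvg_cst.
  by apply: (@exprn_continuous _ 2).
pose x0 (x : 'rV[R]_n.+1) := x 0 ord0.
have aC := is_C1_comp (is_C1_coord R (ord0 : 'I_n.+1)) a' cda.
have FC := is_C1_mul (is_C1_mul fg fg) (is_C1_mul aC (@is_C1_gauss_density R n.+1)).
set F := (fun x => _) in FC; set G := (fun i x => _) in FC.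
have Fr : supported r F by move=> x xr; rewrite /F fr// !mul0r.
have [bf bg] := is_C1_bsupp fg (ltW r0) fr.
have [bF bG] := is_C1_bsupp FC (ltW r0) Fr.
have intG := Rintegral_is_C1 ord0 FC r0 Fr.
rewrite /ip !gauss_RintegralE; [|exact: bsuppMb|exact: bsuppMb].
have cr : continuous (@gauss_density R n.+1) by have [] := @is_C1_gauss_density R n.+1.
have bff : bsupp (fun x => f x * f x * rho x) by apply: bsuppMc cr; exact: bsuppMb.
have bgg : bsupp (fun x => g ord0 x * g ord0 x * rho x).
  by apply: bsuppMc cr; exact: bsuppMb.
rewrite -ler_pdivrMl ?divr_gt0// invf_div -RintegralZl//; last first.
  exact: bsupp_lebesgue_integrable.
rewrite -[leRHS]addr0 -intG -RintegralD//; try exact: bsupp_lebesgue_integrable.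
apply: le_Rintegral => //.
- by apply: bsupp_lebesgue_integrable; exact: bsuppZ.
- by apply: bsupp_lebesgue_integrable; apply: bsuppD => //; exact: bG.
move=> x _; rewrite /G eqxx /=.
have rho0 : 0 <= rho x by exact: gauss_density_ge0.
(* Since a' - s a = dl E, adding the divergence term to g^2 completes the square g + a f. *)
rewrite [leRHS](_ : _ = ((g ord0 x + a (x0 x) * f x) ^+ 2 +
    f x ^+ 2 * (dl * E (x0 x) - a (x0 x) ^+ 2)) * rho x); last first.
  by rewrite /a /x0; ring.
rewrite mulrA ler_wpM2r//.
have [xr|xr] := pselect (box n.+1 r x); last first.
  by rewrite fr// !(mul0r, mulr0, expr0n)/= !addr0 sqr_ge0.
have E0 : 0 < E (x0 x) by exact: expR_gt0.
have E1 : 1 <= E (x0 x).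
  by rewrite /E -[leLHS]expR0 ler_expR divr_ge0 ?sqr_ge0.
have x0r : x0 x ^+ 2 <= r ^+ 2.
  by rewrite -[leLHS]real_normK ?num_real// ler_sqr ?nnegrE ?(ltW r0)//; exact: xr.
have EE : E (x0 x) <= E r.
  by rewrite /E ler_expR ler_pM2r ?invr_gt0.
have h : dl * (x0 x ^+ 2 * E (x0 x)) <= 1 / 2.
  apply: (@le_trans _ _ (dl * (r ^+ 2 * E r))); last by lra.
  by rewrite ler_pM2l// ler_pM ?sqr_ge0// ltW.
have k : dl / 2 <= dl * E (x0 x) - a (x0 x) ^+ 2.
  rewrite (_ : _ - _ = dl * E (x0 x) * (1 - dl * (x0 x ^+ 2 * E (x0 x)))).
    rewrite -mulrA ler_pM2l//.
    by apply: (@le_trans _ _ (E (x0 x) * (1 / 2))); [lra|rewrite ler_pM2l//; lra].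
  by rewrite /a; ring.
apply: (@le_trans _ _ (f x ^+ 2 * (dl / 2))); first by rewrite expr2 mulrC.
apply: (@le_trans _ _ (f x ^+ 2 * (dl * E (x0 x) - a (x0 x) ^+ 2))).
  by rewrite ler_wpM2l ?sqr_ge0.
by rewrite lerDr sqr_ge0.
Qed.

(* - k(|x|^2/2) x is the gradient of a radial function U, and
   Delta U - x . grad U = -1 amounts to n k + 2 q k' - 2 q k = 1. *)
Lemma gauss_weak_radial n (k dk : R -> R) (f : 'rV[R]_n -> R) g (r : R) :
  (forall q : R, is_derive q 1 k (dk q)) -> continuous dk ->
  (forall q, n%:R * k q + 2 * q * dk q - 2 * q * k q = 1) ->
  is_C1 f g -> 0 < r -> supported r f ->
  \int[gauss_row R n]_x (\sum_(i < n) - (k (edot x x / 2) * x 0 i) * g i x) =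
  \int[gauss_row R n]_x f x.
Proof.
move=> k' cdk ode fg r0 fr.
have kC := is_C1_comp (@is_C1_sqr_norm R n) k' cdk.
have [ck _ _] := kC.
have HC i := is_C1_mul fg (is_C1_mul (is_C1_mul kC (is_C1_coord R i)) (@is_C1_gauss_density R n)).
have [bf bg] := is_C1_bsupp fg (ltW r0) fr.
have bs : bsupp (fun x : 'rV[R]_n => \sum_(i < n) - (k (edot x x / 2) * x 0 i) * g i x).
  apply: bsupp_sum => i.
  have [ckx _ _] := is_C1_mul kC (is_C1_coord R i).
  have := bsuppZ (-1) (bsuppMc (bg i) ckx).
  by congr bsupp; apply/funext => x; ring.
rewrite !gauss_RintegralE//.
have cr : continuous (@gauss_density R n) by have [] := @is_C1_gauss_density R n.
(* The i-th derivative of f k x_i rho, in the very form the combinators produce, hence the factor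
   [(i == i)]. *)
pose H (i : 'I_n) (x : 'rV[R]_n) := g i x * (k (edot x x / 2) * x 0 i * rho x) +
   f x * (((dk (edot x x / 2) * x 0 i) * x 0 i + k (edot x x / 2) * (i == i)%:R) * rho x +
   k (edot x x / 2) * x 0 i * (- x 0 i * rho x)).
have Fr i : supported r (fun x : 'rV[R]_n => f x * (k (edot x x / 2) * x 0 i * rho x)).
  by move=> x xr; rewrite fr// mul0r.
have intH i : \int[lebesgue_row R n]_x H i x = 0.
  exact: (Rintegral_is_C1 i (HC i) r0 (Fr i)).
have bH i : bsupp (H i).
  by have [_ bG] := is_C1_bsupp (HC i) (ltW r0) (Fr i); exact: bG i.
apply/eqP; rewrite -subr_eq0 -RintegralB//; last 2 first.
- by apply: bsupp_lebesgue_integrable; exact: bsuppMc.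
- by apply: bsupp_lebesgue_integrable; exact: bsuppMc.
apply/eqP; transitivity (-1 * \sum_(i < n) \int[lebesgue_row R n]_x H i x); last first.
  by rewrite big1 ?mulr0// => i _; exact: intH.
rewrite -Rintegral_sum; last by move=> i; exact: bsupp_lebesgue_integrable.
rewrite -RintegralZl//; last by apply: bsupp_lebesgue_integrable; exact: bsupp_sum.
apply: eq_Rintegral => x _.
have -> : \sum_(i < n) H i x = rho x * \sum_(i < n) (k (edot x x / 2) * x 0 i) * g i x +
    f x * rho x.
  have O : \sum_(i < n) (k (edot x x / 2) + x 0 i * x 0 i * dk (edot x x / 2) -
      x 0 i * x 0 i * k (edot x x / 2)) = 1.
    rewrite -[RHS](ode (edot x x / 2)).
    rewrite sumrB big_split/= -!mulr_suml sumr_const card_ord -[k _ *+ n]mulr_natl.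
    by rewrite -/(edot x x); congr (_ + _ - _); field.
  transitivity (rho x * \sum_(i < n) (k (edot x x / 2) * x 0 i) * g i x +
    f x * rho x * \sum_(i < n) (k (edot x x / 2) + x 0 i * x 0 i * dk (edot x x / 2) -
      x 0 i * x 0 i * k (edot x x / 2))); last by rewrite O mulr1.
  rewrite !mulr_sumr -big_split; apply: eq_bigr => i _.
  by rewrite /H eqxx /=; ring.
under eq_bigr do rewrite mulNr.
by rewrite sumrN; ring.
Qed.

End gauss_identities.

Section L2_convergence.
Context d (T : measurableType d) (R : realType) (mu : {measure set T -> \bar R}).
Implicit Types f g h : T -> R.

Lemma cvg_sum_seq (I : Type) (s : seq I) (F : I -> nat -> R) (l : I -> R) :
  (forall i, F i k @[k --> \oo] --> l i) ->
  \sum_(i <- s) F i k @[k --> \oo] --> \sum_(i <- s) l i.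
Proof.
move=> Fl; apply: (@cvg_big _ _ +%R 0 xpredT) => //; exact: add_continuous.
Qed.

Lemma ip_lin_sqr (a b : R) f g : L2 mu f -> L2 mu g ->
  ip mu (fun x => a * f x + b * g x) (fun x => a * f x + b * g x) =
  a ^+ 2 * ip mu f f + 2 * a * b * ip mu f g + b ^+ 2 * ip mu g g.
Proof.
move=> Lf Lg; have L1 := L2Z a Lf; have L2' := L2Z b Lg; have L3 := L2D L1 L2'.
rewrite ipDl// !ipDr// !ipZl// !ipZr// (ipC mu g f).
by move: (ip mu f f) (ip mu f g) (ip mu g g) => p q r; ring.
Qed.

Lemma ip_sub_sqr f g : L2 mu f -> L2 mu g ->
  ip mu (fun x => f x - g x) (fun x => f x - g x) =
  ip mu f f - 2 * ip mu f g + ip mu g g.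
Proof.
move=> Lf Lg; have L3 := L2B Lf Lg; rewrite ipBl// !ipBr// (ipC mu g f).
by move: (ip mu f f) (ip mu f g) (ip mu g g) => p q r; ring.
Qed.

Lemma cvg_ip (f : nat -> T -> R) g h : (forall k, L2 mu (f k)) -> L2 mu g -> L2 mu h ->
  ip mu (fun x => f k x - g x) (fun x => f k x - g x) @[k --> \oo] --> 0 ->
  ip mu (f k) h @[k --> \oo] --> ip mu g h.
Proof.
move=> Lf Lg Lh fg; have Ld k := L2B (Lf k) Lg.
have H : ip mu (fun x => f k x - g x) h @[k --> \oo] --> 0.
  apply/cvgrPdist_lt => eps eps0; pose c := ip mu h h + 1.
  have c0 : 0 < c by rewrite ltr_wpDl// ip_ge0.
  have e2 : 0 < eps ^+ 2 / c by rewrite divr_gt0// exprn_gt0.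
  move/cvgrPdist_lt : fg => /(_ _ e2); apply: filterS => k.
  rewrite !sub0r !normrN (ger0_norm (ip_ge0 _ _)) => hk.
  rewrite -(@ltr_sqr _ `|_|) ?nnegrE ?(ltW eps0)// real_normK ?num_real//.
  apply: (le_lt_trans (ip_CS (Ld k) Lh)).
  apply: (@le_lt_trans _ _ (ip mu (fun x => f k x - g x) (fun x => f k x - g x) * c)).
    by rewrite ler_wpM2l ?ip_ge0// lerDl.
  by rewrite -ltr_pdivlMr.
rewrite -[X in _ --> X]add0r.
have : ip mu (fun x => f k x - g x) h + ip mu g h @[k --> \oo] --> 0 + ip mu g h.
  by apply: cvgD => //; exact: cvg_cst.
apply: cvg_trans; apply: near_eq_cvg; apply: nearW => k.
by rewrite ipBl// subrK.
Qed.

Lemma cvg_ip_sqr (f : nat -> T -> R) g : (forall k, L2 mu (f k)) -> L2 mu g ->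
  ip mu (fun x => f k x - g x) (fun x => f k x - g x) @[k --> \oo] --> 0 ->
  ip mu (f k) (f k) @[k --> \oo] --> ip mu g g.
Proof.
move=> Lf Lg fg; have Ld k := L2B (Lf k) Lg.
have H := cvg_ip Lf Lg Lg fg.
have : ip mu (fun x => f k x - g x) (fun x => f k x - g x) + 2 * ip mu (f k) g - ip mu g g
    @[k --> \oo] --> 0 + 2 * ip mu g g - ip mu g g.
  apply: cvgB; last exact: cvg_cst.
  by apply: cvgD => //; apply: cvgM => //; exact: cvg_cst.
rewrite (_ : 0 + _ - _ = ip mu g g); last by ring.
apply: cvg_trans; apply: near_eq_cvg; apply: nearW => k.
by rewrite ip_sub_sqr//; ring.
Qed.

(** [H10_gradient] only asks that the limits be measurable; their square integrability follows
    because the distance to some term of the sequence is finite. *)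
Lemma cvg_L2 (f : nat -> T -> R) g : (forall k, L2 mu (f k)) -> measurable_fun setT g ->
  (\int[mu]_x ((f k x - g x) ^+ 2)%:E @[k --> \oo] --> 0)%E ->
  L2 mu g /\ ip mu (fun x => f k x - g x) (fun x => f k x - g x) @[k --> \oo] --> 0.
Proof.
move=> Lf mg /fine_cvgP[foo fg].
have Lg : L2 mu g.
  have [N _ hN] := foo; have fin := hN N (leqnn N).
  have Ld : L2 mu (fun x => f N x - g x).
    apply: L2_lty; first by apply: measurable_funB => //; exact: (Lf N).1.
    by rewrite -ge0_fin_numE//; apply: integral_ge0 => x _; rewrite lee_fin sqr_ge0.
  have := L2B (Lf N) Ld; congr (L2 _ _); apply/funext => x; ring.
by split.
Qed.

End L2_convergence.

(** * Existence of the torsion function and its variational characterisation *)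

Section torsion.
Context (R : realType) (n : nat) (Omega : set 'rV[R]_n.+1) (r : R).
Hypotheses (r0 : 0 < r) (mO : measurable Omega) (Or : Omega `<=` box n.+1 r).
Implicit Types (u phi psi : 'rV[R]_n.+1 -> R).

Local Notation gam := (gauss_row R n.+1).
Local Notation one := (\1_Omega : 'rV[R]_n.+1 -> R).
Local Notation tf := (test_function Omega).

Definition dirichlet phi := \sum_(i < n.+1) ip gam (partial i phi) (partial i phi).

Definition torsion_energy phi := 2 * \int[gam]_x phi x - dirichlet phi.

Let L2one : L2 gam one.
Proof. exact/bsupp_L2/(bsupp_indic (ltW r0)). Qed.

Let L2tf phi : tf phi -> L2 gam phi /\ forall i, L2 gam (partial i phi).
Proof.
move=> /(test_function_bsupp (ltW r0) Or)[b pb].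
by split=> [|i]; exact: bsupp_L2.
Qed.

Let integral_tf phi : tf phi -> \int[gam]_x phi x = ip gam phi one.
Proof.
move=> [_ _ [K [_ KO phi0]]]; apply: eq_Rintegral => x _; rewrite indicE.
have [xO|xO] := pselect (Omega x); first by rewrite mem_set// mulr1.
by rewrite phi0 ?mul0r// => /KO.
Qed.

Let integral_O u : \int[gam]_(x in Omega) u x = ip gam u one.
Proof.
rewrite Rintegral_mkcond; apply: eq_Rintegral => x _; rewrite patchE indicE.
by case: ifP => xO; rewrite ?mulr1 ?mulr0// xO ?mulr1 ?mulr0.
Qed.

Let energyE phi : tf phi ->
  torsion_energy phi = 2 * ip gam phi one - dirichlet phi.
Proof. by move=> tphi; rewrite /torsion_energy integral_tf. Qed.

Let weak_lhs (G : 'I_n.+1 -> 'rV[R]_n.+1 -> R) psi : (forall i, L2 gam (G i)) ->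
  tf psi ->
  \int[gam]_(x in Omega) (\sum_(i < n.+1) G i x * partial i psi x) =
  \sum_(i < n.+1) ip gam (G i) (partial i psi).
Proof.
move=> LG tpsi; have [_ Lp] := L2tf tpsi.
rewrite Rintegral_mkcond -Rintegral_sum; last by move=> i; exact: L2M.
apply: eq_Rintegral => x _; rewrite patchE; case: ifPn => // xO.
rewrite big1// => i _; rewrite (partial_outside i tpsi) ?mulr0//.
by move: xO => /negP; rewrite in_setE.
Qed.

Let weak_rhs psi : tf psi -> \int[gam]_(x in Omega) psi x = ip gam psi one.
Proof. by move=> _; exact: integral_O. Qed.

(** Tested against the approximations of u, the weak equation gives in the limit int u = int |G|^2 =
    E. Tested against psi, it turns the energy of psi into E - int |G - grad psi|^2. So E is an
    upper bound, and the least one because the energies of the approximations tend to E. *)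
Lemma torsion_variational u : is_torsion_function Omega u ->
  (forall psi, tf psi -> torsion_energy psi <= \int[gam]_(x in Omega) u x) /\
  (forall S, (forall psi, tf psi -> torsion_energy psi <= S) ->
    \int[gam]_(x in Omega) u x <= S).
Proof.
move=> [G [[mu_ mG [phi [tphi phiu phiG]]] weak]].
have Lphi k := (L2tf (tphi k)).1; have Ldphi i k := (L2tf (tphi k)).2 i.
have [Lu cu] := cvg_L2 Lphi mu_ phiu.
have LG i : L2 gam (G i) by have [] := cvg_L2 (Ldphi i) (mG i) (phiG i).
have cG i : ip gam (fun x => partial i (phi k) x - G i x)
    (fun x => partial i (phi k) x - G i x) @[k --> \oo] --> 0.
  by have [] := cvg_L2 (Ldphi i) (mG i) (phiG i).
pose E := \sum_(i < n.+1) ip gam (G i) (G i).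
have weak' psi : tf psi -> \sum_(i < n.+1) ip gam (G i) (partial i psi) = ip gam psi one.
  by move=> tpsi; rewrite -weak_lhs// weak// weak_rhs.
have c1 : ip gam (phi k) one @[k --> \oo] --> E.
  have : \sum_(i < n.+1) ip gam (partial i (phi k)) (G i) @[k --> \oo] --> E.
    apply: (cvg_sum_seq (F := fun i k => ip gam (partial i (phi k)) (G i))) => i.
    by apply: cvg_ip; [exact: Ldphi|exact: LG|exact: LG|exact: cG].
  apply: cvg_trans; apply: near_eq_cvg; apply: nearW => k.
  by rewrite -(weak' _ (tphi k)); apply: eq_bigr => i _; rewrite ipC.
have c2 : ip gam (phi k) one @[k --> \oo] --> ip gam u one by exact: cvg_ip.
have uE : \int[gam]_(x in Omega) u x = E.
  by rewrite integral_O; apply: (cvg_unique _ c2 c1); exact: Rhausdorff.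
rewrite uE; split=> [psi tpsi|S HS].
  have [_ Lp] := L2tf tpsi.
  rewrite energyE// -(weak' psi tpsi) /dirichlet /E mulr_sumr -sumrB.
  apply: ler_sum => i _; rewrite -subr_ge0.
  have := ip_ge0 gam (fun x => G i x - partial i psi x).
  rewrite (ip_sub_sqr (LG i) (Lp i)).
  by lra.
have cE : torsion_energy (phi k) @[k --> \oo] --> 2 * E - E.
  have : 2 * ip gam (phi k) one - dirichlet (phi k) @[k --> \oo] --> 2 * E - E.
    apply: cvgB; first by apply: cvgM => //; exact: cvg_cst.
    apply: (cvg_sum_seq (F := fun i k => ip gam (partial i (phi k)) (partial i (phi k)))) => i.
    by apply: cvg_ip_sqr; [exact: Ldphi|exact: LG|exact: cG].
  by apply: cvg_trans; apply: near_eq_cvg; apply: nearW => k; rewrite energyE.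
rewrite (_ : E = 2 * E - E); last by ring.
apply: (cvgr_to_le cE); apply: nearW => k; exact: HS.
Qed.

Lemma energy_bounded : exists B, forall phi, tf phi -> torsion_energy phi <= B.
Proof.
have [C C0 hC] := @gauss_poincare R n r r0.
exists (C * ip gam one one) => phi tphi; have [Lp Ldp] := L2tf tphi.
have s := test_function_supported Or tphi.
have := hC phi _ (test_function_C1 tphi s) s => P.
have D0 : ip gam (partial ord0 phi) (partial ord0 phi) <= dirichlet phi.
  rewrite /dirichlet (bigD1 ord0)//= lerDl; apply: sumr_ge0 => i _; exact: ip_ge0.
rewrite energyE//.
(* This yields 2C int phi <= |phi|^2 + C^2 |one|^2; the Poincare inequality bounds |phi|^2 by C
   times the Dirichlet term. *)
have := ip_ge0 gam (fun x => 1 * phi x + - C * one x).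
rewrite (ip_lin_sqr 1 (- C) Lp L2one).
move: P D0; move: (ip _ phi phi) (ip _ phi one) (ip _ one one) (ip _ (partial _ _) _) (dirichlet phi)
  => a b c d' e h1 h2 h3.
have h4 : a <= C * e by apply: (le_trans h1); rewrite ler_pM2l.
rewrite -(ler_pM2l C0); nra.
Qed.

(* A maximising sequence of the energy is Cauchy in H^1 by the parallelogram
   identity and the Poincare inequality; comparing its terms phi_k with
   phi_k + s psi gives the weak equation in the limit. *)
Lemma torsion_function_exists : exists u, is_torsion_function Omega u.
Proof.
have [B HB] := energy_bounded.
have [C C0 hC] := @gauss_poincare R n r r0.
pose E := [set torsion_energy phi | phi in [set phi | tf phi]].
have supE : has_sup E.
  split; first by exists (torsion_energy (fun=> 0)); exists (fun=> 0) => //; exact: test_function0.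
  by exists B => _ [phi tphi <-]; exact: HB.
pose S := sup E.
have leS phi : tf phi -> torsion_energy phi <= S.
  by move=> tphi; apply: ub_le_sup; [case: supE|exists phi].
(* The rate 4^-k is the one that [L2_complete] asks for. *)
have eps0 k : 0 < (4 ^+ k)^-1 :> R by rewrite invr_gt0 exprn_gt0.
have ex k : exists phi, tf phi /\ S - (4 ^+ k)^-1 < torsion_energy phi.
  by have [_ [phi tphi <-] h] := sup_adherent (eps0 k) supE; exists phi.
have [phi hphi] := choice ex.
have tphi k := (hphi k).1; have Sphi k := (hphi k).2.
have Lphi k := (L2tf (tphi k)).1; have Ldphi k i := (L2tf (tphi k)).2 i.
have energy_lin a b f g : tf f -> tf g ->
    torsion_energy (fun x => a * f x + b * g x) =
    2 * (a * ip gam f one + b * ip gam g one) - (a ^+ 2 * dirichlet f +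
      2 * a * b * (\sum_(i < n.+1) ip gam (partial i f) (partial i g)) +
      b ^+ 2 * dirichlet g).
  move=> tff tg; have [Lf Ldf] := L2tf tff; have [Lg Ldg] := L2tf tg.
  have [tl pl] := test_function_lin a b Or tff tg.
  rewrite energyE// ipDl//; [|exact: L2Z|exact: L2Z]; rewrite !ipZl//; congr (_ - _).
  rewrite /dirichlet !mulr_sumr -!big_split; apply: eq_bigr => i _ /=; rewrite pl.
  by rewrite (ip_lin_sqr a b (Ldf i) (Ldg i)).
(* The midpoint has energy at most S while both ends are within 4^-k and 4^-l of it; the
   parallelogram identity leaves 2 (4^-k + 4^-l). *)
have dirB k l : (k <= l)%N ->
    \sum_(i < n.+1) ip gam (fun x => partial i (phi k) x - partial i (phi l) x)
      (fun x => partial i (phi k) x - partial i (phi l) x) <= 4 / 4 ^+ k.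
  move=> kl.
  have e1 : torsion_energy (fun x => 1 / 2 * phi k x + 1 / 2 * phi l x) <= S.
    by apply: leS; have [] := test_function_lin (1 / 2) (1 / 2) Or (tphi k) (tphi l).
  have e2 := ltW (Sphi k); have e3 := ltW (Sphi l).
  have e4 : (4 ^+ l)^-1 <= (4 ^+ k)^-1 :> R.
    by rewrite lef_pV2 ?posrE ?exprn_gt0// ler_weXn2l// ler1n.
  rewrite energy_lin// in e1; rewrite energyE// in e2; rewrite energyE// in e3.
  have -> : \sum_(i < n.+1) ip gam (fun x => partial i (phi k) x - partial i (phi l) x)
      (fun x => partial i (phi k) x - partial i (phi l) x) =
      dirichlet (phi k) - 2 * (\sum_(i < n.+1) ip gam (partial i (phi k)) (partial i (phi l)))
      + dirichlet (phi l).
    rewrite /dirichlet mulr_sumr -sumrB -big_split; apply: eq_bigr => i _ /=.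
    by rewrite (ip_sub_sqr (Ldphi k i) (Ldphi l i)).
  move: e1 e2 e3 e4; move: (ip _ (phi k) one) (ip _ (phi l) one) (dirichlet (phi k))
    (dirichlet (phi l)) (\sum_(i < n.+1) _) (4 ^+ k)^-1 (4 ^+ l)^-1 => *.
  lra.
have sumle (F : 'I_n.+1 -> R) i c : (forall j, 0 <= F j) -> \sum_j F j <= c -> F i <= c.
  move=> F0; apply: le_trans; rewrite (bigD1 i)//= lerDl.
  by apply: sumr_ge0.
have dB i k l : (k <= l)%N -> ip gam (fun x => partial i (phi k) x - partial i (phi l) x)
      (fun x => partial i (phi k) x - partial i (phi l) x) <= 4 / 4 ^+ k.
  move=> /dirB; apply: (sumle (fun i => ip gam
    (fun x => partial i (phi k) x - partial i (phi l) x)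
    (fun x => partial i (phi k) x - partial i (phi l) x))) => j; exact: ip_ge0.
have phB k l : (k <= l)%N -> ip gam (fun x => phi k x - phi l x)
    (fun x => phi k x - phi l x) <= C * 4 / 4 ^+ k.
  move=> kl; have [tl pl] := test_function_lin 1 (-1) Or (tphi k) (tphi l).
  have E1 (f g : 'rV[R]_n.+1 -> R) : (fun x => 1 * f x + -1 * g x) = (fun x => f x - g x).
    by apply/funext => x; rewrite mul1r mulN1r.
  rewrite E1 in tl; have s := test_function_supported Or tl.
  apply: (le_trans (hC _ _ (test_function_C1 tl s) s)).
  have := pl ord0; rewrite !E1 => ->; rewrite -mulrA ler_pM2l//; exact: dB.
have [u [mu_ hu]] : exists u, measurable_fun setT u /\ forall k,
    (\int[gam]_x ((phi k x - u x) ^+ 2)%:E <= (C * 4 / 4 ^+ k)%:E)%E.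
  apply: L2_complete.
  - by rewrite mulr_ge0// ltW.
  - by move=> k; exact: (Lphi k).1.
  - by move=> k l kl; rewrite (ipE (L2B (Lphi k) (Lphi l))) lee_fin phB.
have exG i : exists G : 'rV[R]_n.+1 -> R, measurable_fun setT G /\ forall k,
    (\int[gam]_x ((partial i (phi k) x - G x) ^+ 2)%:E <= (4 / 4 ^+ k)%:E)%E.
  apply: (@L2_complete _ _ _ gam (fun k => partial i (phi k)) 4) => //.
  - by move=> k; exact: (Ldphi k i).1.
  - by move=> k l kl; rewrite (ipE (L2B (Ldphi k i) (Ldphi l i))) lee_fin dB.
have [G hG] := choice exG.
have c4 : (4 ^+ k)^-1 @[k --> \oo] --> (0 : R).
  rewrite (_ : (fun k => (4 ^+ k)^-1) = geometric 1 (4^-1 : R)).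
    by apply: cvg_geometric; rewrite ger0_norm// invf_lt1// ltr1n.
  by apply/funext => k; rewrite /geometric/= mul1r exprVn.
have small (F : nat -> \bar R) (c : R) : (forall k, (0 <= F k)%E) ->
    (forall k, (F k <= (c / 4 ^+ k)%:E)%E) -> F k @[k --> \oo] --> 0%E.
  move=> F0 Fc; apply: (@squeeze_cvge _ _ _ _ (cst 0%E) F (fun k => (c / 4 ^+ k)%:E)).
  - by apply: nearW => k; rewrite F0 Fc.
  - exact: cvg_cst.
  - apply/fine_cvgP; split; first exact: nearW.
    by rewrite -(mulr0 c); apply: cvgM => //; exact: cvg_cst.
have cvu : (\int[gam]_x ((phi k x - u x) ^+ 2)%:E @[k --> \oo] --> 0)%E.
  by apply: small => [k|]; [apply: integral_ge0 => x _; rewrite lee_fin sqr_ge0|exact: hu].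
have cvG i : (\int[gam]_x ((partial i (phi k) x - G i x) ^+ 2)%:E @[k --> \oo] --> 0)%E.
  apply: small => [k|]; last exact: (hG i).2.
  by apply: integral_ge0 => x _; rewrite lee_fin sqr_ge0.
exists u, G; split.
  by split=> //; [move=> i; exact: (hG i).1|exists phi; split].
have LG i : L2 gam (G i) by have [] := cvg_L2 (fun k => Ldphi k i) (hG i).1 (cvG i).
have cG i : ip gam (fun x => partial i (phi k) x - G i x)
    (fun x => partial i (phi k) x - G i x) @[k --> \oo] --> 0.
  by have [] := cvg_L2 (fun k => Ldphi k i) (hG i).1 (cvG i).
move=> psi tpsi; have [Lpsi Ldpsi] := L2tf tpsi.
rewrite weak_lhs// weak_rhs//.
set c := ip gam psi one; set d := \sum_(i < _) _.
pose D := dirichlet psi.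
have D0 : 0 <= D by apply: sumr_ge0 => i _; exact: ip_ge0.
(* First variation: the energy of phi_k + s psi is at most S, which exceeds that of phi_k by less
   than 4^-k; then k tends to infinity. *)
have H s : 2 * s * (c - d) <= s ^+ 2 * D.
  have cv : 2 * s * (c - \sum_(i < n.+1) ip gam (partial i (phi k)) (partial i psi))
      - (4 ^+ k)^-1 @[k --> \oo] --> 2 * s * (c - d) - 0.
    apply: cvgB => //; apply: cvgM; first exact: cvg_cst.
    apply: cvgB; first exact: cvg_cst.
    apply: (cvg_sum_seq (F := fun i k => ip gam (partial i (phi k)) (partial i psi))) => i.
    by apply: cvg_ip; [move=> k; exact: Ldphi|exact: LG|exact: Ldpsi|exact: cG].
  rewrite subr0 in cv; apply: (cvgr_to_le cv); apply: nearW => k.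
  have e1 : torsion_energy (fun x => 1 * phi k x + s * psi x) <= S.
    by apply: leS; have [] := test_function_lin 1 s Or (tphi k) tpsi.
  have e2 := ltW (Sphi k); rewrite energyE// in e2; rewrite energy_lin// in e1.
  rewrite -/c -/D in e1; move: e1 e2; move: (ip _ (phi k) one) (dirichlet (phi k))
    (\sum_(i < n.+1) _) (4 ^+ k)^-1 => *; lra.
(* Dividing by D + 1 rather than D, which may vanish, still forces c = d. *)
have := H ((c - d) / (D + 1)).
have D1 : 0 < D + 1 by lra.
move=> {}H; apply/eqP; rewrite eq_sym -subr_eq0 -sqrf_eq0 eq_le sqr_ge0 andbT.
have : 2 * (c - d) ^+ 2 * (D + 1) <= (c - d) ^+ 2 * D.
  have := ler_wpM2r (ltW (exprn_gt0 2 D1)) H.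
  move: (c - d) => z.
  have -> : 2 * (z / (D + 1)) * z * (D + 1) ^+ 2 = 2 * z ^+ 2 * (D + 1).
    by field; rewrite gt_eqF.
  suff -> : (z / (D + 1)) ^+ 2 * D * (D + 1) ^+ 2 = z ^+ 2 * D by [].
  by field; rewrite gt_eqF.
have := sqr_ge0 (c - d); nra.
Qed.

(** Existence makes the choice by [get] meaningful. From here on the torsion is used only through
    these two properties: the second bounds it above on the ball, the first below on K_t. *)
Lemma gauss_torsion_variational :
  (forall psi, tf psi -> torsion_energy psi <= gauss_torsion Omega) /\
  (forall S, (forall psi, tf psi -> torsion_energy psi <= S) -> gauss_torsion Omega <= S).
Proof.
have [u hu] := torsion_function_exists.
exact: (torsion_variational (getI (x := u) hu)).
Qed.

End torsion.

(** * The radial torsion function *)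

Section exp_type_series.
Context (R : realType).
Implicit Types (c : nat -> R) (q s : R).

(** Domination by the exponential series gives convergence everywhere and is preserved by termwise
    differentiation; nonnegativity makes the sums nondecreasing on the half-line. *)
Definition exp_bounded c := forall k, 0 <= c k <= (k`!%:R)^-1.

Definition psum c q : R := limn (pseries c q).

Lemma exp_bounded_diffs c : exp_bounded c -> exp_bounded (pseries_diffs c).
Proof.
move=> bc k; rewrite /pseries_diffs; have /andP[c0 c1] := bc k.+1.
rewrite mulr_ge0//= (le_trans (ler_wpM2l _ c1))//.
by rewrite factS natrM invfM mulVKf.
Qed.

Lemma is_cvg_exp_bounded c q : exp_bounded c -> cvgn (pseries c q).
Proof.
move=> bc; apply: normed_cvg.
apply: (series_le_cvg _ _ _ (is_cvg_series_exp_coeff `|q|)) => k.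
- exact: normr_ge0.
- by rewrite /exp_coeff/= divr_ge0// exprn_ge0.
- have /andP[c0 c1] := bc k.
  by rewrite /exp_coeff/= normrM normrX (ger0_norm c0) mulrC ler_wpM2l// exprn_ge0.
Qed.

Lemma is_derive_psum c q : exp_bounded c ->
  is_derive q 1 (psum c) (psum (pseries_diffs c) q).
Proof.
move=> bc; have b1 := exp_bounded_diffs bc; have b2 := exp_bounded_diffs b1.
apply: (@pseries_snd_diffs _ c (`|q| + 1)).
- exact: is_cvg_exp_bounded.
- exact: is_cvg_exp_bounded.
- exact: is_cvg_exp_bounded.
- by rewrite [ltRHS]ger0_norm ?addr_ge0// ltrDl.
Qed.

Lemma psum_ge0 c q : exp_bounded c -> 0 <= q -> c 0%N <= psum c q.
Proof.
move=> bc q0; apply: limr_ge; first exact: is_cvg_exp_bounded.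
exists 1%N => // -[//|N] _; rewrite /pseries/series/= big_nat_recl//= expr0 mulr1.
rewrite lerDl; apply: sumr_ge0 => k _; rewrite mulr_ge0 ?exprn_ge0//.
by have /andP[] := bc k.+1.
Qed.

Lemma psum_le c q s : exp_bounded c -> 0 <= q -> q <= s -> psum c q <= psum c s.
Proof.
move=> bc q0 qs; apply: ler_lim; [exact: is_cvg_exp_bounded|exact: is_cvg_exp_bounded|].
apply: nearW => N; rewrite /pseries/series/=; apply: ler_sum => k _.
have /andP[c0 _] := bc k; rewrite ler_wpM2l//.
by rewrite lerXn2r ?nnegrE// (le_trans q0).
Qed.

Lemma psum0 c : exp_bounded c -> psum c 0 = c 0%N.
Proof.
move=> bc; apply: (cvg_lim (@Rhausdorff R)).
rewrite -cvg_shiftS; apply: cvg_trans (cvg_cst (F := \oo) (c 0%N)).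
apply: near_eq_cvg; apply: nearW => N; rewrite /pseries/series/=.
rewrite big_nat_recl//= expr0 mulr1 big1 ?addr0// => k _.
by rewrite expr0n/= mulr0.
Qed.

End exp_type_series.

Section kernel_series.
Context (R : realType) (n : nat).
Hypothesis n0 : (0 < n)%N.

(* Coefficients of the power series solution of n k + 2 q k' - 2 q k = 1. *)
Fixpoint kernel_coef (k : nat) : R :=
  if k is j.+1 then 2 * kernel_coef j / (n + 2 * k)%:R else n%:R^-1.

Definition potential_coef (k : nat) : R :=
  if k is j.+1 then kernel_coef j / k%:R else 0.

Lemma kernel_coef_bounded : exp_bounded kernel_coef.
Proof.
elim=> [|k /andP[c0 c1]]; rewrite [kernel_coef _]/=.
  by rewrite invr_ge0 ler0n/= fact0 invr1 invf_le1 ?ler1n// ltr0n.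
have d0 : 0 < (n + 2 * k.+1)%:R :> R by rewrite ltr0n addn_gt0 n0.
have k0 : 0 < k.+1%:R :> R by rewrite ltr0n.
rewrite divr_ge0 ?mulr_ge0//= ler_pdivrMr//.
apply: (@le_trans _ _ (2 * (k`!%:R)^-1)); first by rewrite ler_pM2l.
rewrite factS natrM invfM [leRHS]mulrAC; apply: ler_wpM2r; first by rewrite invr_ge0.
by rewrite ler_pdivlMl// -natrM ler_nat mulnC leq_addl.
Qed.

Lemma potential_coef_bounded : exp_bounded potential_coef.
Proof.
case=> [|k]; rewrite [potential_coef _]/=; first by rewrite lexx/= invr_ge0.
have /andP[c0 c1] := kernel_coef_bounded k.
rewrite divr_ge0//= factS natrM invfM mulrC; exact: ler_wpM2l.
Qed.

Lemma diffs_potential_coef : pseries_diffs potential_coef = kernel_coef.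
Proof.
by apply/funext => k; rewrite /pseries_diffs/= mulrC divfK// pnatr_eq0.
Qed.

Definition radial_potential (q : R) := psum potential_coef q.
Definition radial_kernel (q : R) := psum kernel_coef q.
Definition radial_dkernel (q : R) := psum (pseries_diffs kernel_coef) q.

Let bd := exp_bounded_diffs kernel_coef_bounded.

Lemma is_derive_potential (q : R) : is_derive q 1 radial_potential (radial_kernel q).
Proof.
by rewrite /radial_kernel -diffs_potential_coef; apply: is_derive_psum; exact: potential_coef_bounded.
Qed.

Lemma is_derive_kernel (q : R) : is_derive q 1 radial_kernel (radial_dkernel q).
Proof. by apply: is_derive_psum; exact: kernel_coef_bounded. Qed.

Lemma continuous_dkernel : continuous radial_dkernel.
Proof.
move=> q; apply: differentiable_continuous; apply/derivable1_diffP.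
by have [] := is_derive_psum q bd.
Qed.

Lemma potential0 : radial_potential 0 = 0.
Proof. by rewrite /radial_potential psum0//; exact: potential_coef_bounded. Qed.

Lemma kernel_ge (q : R) : 0 <= q -> n%:R^-1 <= radial_kernel q.
Proof. by apply: psum_ge0; exact: kernel_coef_bounded. Qed.

Lemma kernel_gt0 (q : R) : 0 <= q -> 0 < radial_kernel q.
Proof. by move=> /kernel_ge; apply: lt_le_trans; rewrite invr_gt0 ltr0n. Qed.

Lemma kernel_le (q s : R) : 0 <= q -> q <= s -> radial_kernel q <= radial_kernel s.
Proof. by apply: psum_le; exact: kernel_coef_bounded. Qed.

Lemma dkernel_ge0 (q : R) : 0 <= q -> 0 <= radial_dkernel q.
Proof. by move=> q0; apply: le_trans (psum_ge0 bd q0); have /andP[] := bd 0. Qed.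

Lemma dkernel_le (q s : R) : 0 <= q -> q <= s -> radial_dkernel q <= radial_dkernel s.
Proof. exact: psum_le. Qed.

Lemma kernel_ode (q : R) : n%:R * radial_kernel q + 2 * q * radial_dkernel q - 2 * q * radial_kernel q = 1.
Proof.
pose A N : R := pseries kernel_coef q N; pose B N : R := pseries (pseries_diffs kernel_coef) q N.
have AS N : A N.+1 = A N + kernel_coef N * q ^+ N.
  by rewrite /A /pseries/series/= big_nat_recr.
have BS N : B N.+1 = B N + N.+1%:R * kernel_coef N.+1 * q ^+ N.
  by rewrite /B /pseries/series/= big_nat_recr.
(* With these truncation orders the equation holds exactly for the partial sums. *)
have E N : n%:R * A N.+1 + 2 * q * B N - 2 * q * A N = 1.
  elim: N => [|N IH].
    rewrite AS /A /B /pseries/series/= !big_geq// expr0 !mulr0 mulr1 add0r addr0 subr0.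
    by rewrite divff// pnatr_eq0 -lt0n.
  rewrite AS BS -[RHS]IH [X in _ - 2 * q * X = _]AS.
  have : (n + 2 * N.+1)%:R != 0 :> R by rewrite pnatr_eq0 -lt0n addn_gt0 n0.
  rewrite [kernel_coef N.+1]/= exprS natrD natrM.
  move: (A N.+1) (A N) (B N) (kernel_coef N) (q ^+ N) => a b c d e h.
  by field.
have cA : A N @[N --> \oo] --> radial_kernel q.
  by apply: is_cvg_exp_bounded; exact: kernel_coef_bounded.
have cB : B N @[N --> \oo] --> radial_dkernel q by exact: is_cvg_exp_bounded.
have : n%:R * A N.+1 + 2 * q * B N - 2 * q * A N @[N --> \oo] -->
    n%:R * radial_kernel q + 2 * q * radial_dkernel q - 2 * q * radial_kernel q.
  apply: cvgB; last by apply: cvgM => //; exact: cvg_cst.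
  apply: cvgD; last by apply: cvgM => //; exact: cvg_cst.
  by apply: cvgM; [exact: cvg_cst|rewrite cvg_shiftS].
under eq_cvg do rewrite E.
move=> h; apply: (cvg_unique _ h); [exact: Rhausdorff|exact: cvg_cst].
Qed.

End kernel_series.

(** * Uniqueness of the radial profile *)

Section radial_profile.
Context (R : realType) (n : nat).
Hypothesis n0 : (0 < n)%N.

Local Notation P := (@radial_potential R n).
Local Notation k := (@radial_kernel R n).
Local Notation dk := (@radial_dkernel R n).

Let nE : n%:R = n.-1%:R + 1 :> R.
Proof. by rewrite natr1 prednK. Qed.

Let u0 (r : R) : R := - P (r ^+ 2 / 2).

Let u0' (r : R) : is_derive r 1 u0 (- (r * k (r ^+ 2 / 2))).
Proof.
apply: is_deriveN; rewrite mulrC.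
apply: (@is_derive1_comp _ P (fun t : R => t ^+ 2 / 2) r).
  exact: is_derive_potential.
exact: is_derive_sqr_half.
Qed.

Let v0' (r : R) : is_derive r 1 (fun r => - (r * k (r ^+ 2 / 2)))
  (- (k (r ^+ 2 / 2) + r ^+ 2 * dk (r ^+ 2 / 2))).
Proof.
have h : is_derive r 1 (fun t : R => k (t ^+ 2 / 2)) (dk (r ^+ 2 / 2) * r).
  apply: (@is_derive1_comp _ k (fun t : R => t ^+ 2 / 2) r).
    exact: is_derive_kernel.
  exact: is_derive_sqr_half.
by apply: is_derive_eq; rewrite /GRing.scale/=; ring.
Qed.

Let is_radial_profile_potential : is_radial_profile n u0.
Proof.
have d1 : derive1 u0 = fun r => - (r * k (r ^+ 2 / 2)).
  by apply/funext => r; rewrite derive1E; have [_ ->] := u0' r.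
have d2 : derive1 (derive1 u0) = fun r => - (k (r ^+ 2 / 2) + r ^+ 2 * dk (r ^+ 2 / 2)).
  by apply/funext => r; rewrite d1 derive1E; have [_ ->] := v0' r.
split.
- by rewrite /u0 expr0n/= mul0r potential0 ?oppr0.
- have [+ E] := u0' 0; rewrite mul0r oppr0 in E.
  rewrite -[X in _ --> X]E /derivable => H.
  have {}H := cvg_dnbhs_at_right H; move: H.
  apply: cvg_trans; apply: near_eq_cvg; apply: nearW => h /=.
  by rewrite [h *: 1]mulr1 addr0.
- move=> r r0; split; [by have [] := u0' r|by rewrite d1; have [] := v0' r|].
  rewrite d2 d1 -[RHS](_ : - (n%:R * k (r ^+ 2 / 2) + 2 * (r ^+ 2 / 2) * dk (r ^+ 2 / 2) -
    2 * (r ^+ 2 / 2) * k (r ^+ 2 / 2)) = _); last by rewrite kernel_ode.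
  rewrite nE; field.
  by rewrite gt_eqF.
Qed.

(** The difference d between the derivative chosen by [get] and the explicit one solves the
    homogeneous equation, so d s^(n-1) exp(-s^2/2) is a constant. Were it nonzero, |d| would be
    bounded below on ]0, 1]; since the explicit derivative tends to 0, that of u would stay away
    from 0 near the origin, against u(h)/h -> 0. *)
Lemma derive1_radial_profile (r : R) : 0 < r ->
  derive1 (radial_profile R n) r = - (r * k (r ^+ 2 / 2)).
Proof.
move=> r0.
have := getI (x := u0) is_radial_profile_potential.
rewrite -/(radial_profile R n).
move: (radial_profile R n) => u [uz ulim uode].
pose v s := derive1 u s.
have v' (s : R) : 0 < s -> is_derive s 1 v (- 1 - n.-1%:R / s * v s + s * v s).
  move=> s0; have [_ dv] := uode s s0; rewrite -/(v s) => E.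
  by apply: DeriveDef => //; rewrite -derive1E; move: E; rewrite -/v; lra.
pose d s := v s + s * k (s ^+ 2 / 2).
have d' (s : R) : 0 < s -> is_derive s 1 d (- (n.-1%:R / s * d s) + s * d s).
  move=> s0; have h1 := v' s s0; have h2 := v0' s.
  rewrite (_ : d = v - (fun r => - (r * k (r ^+ 2 / 2)))); last first.
    by apply/funext => t; rewrite /d fctE opprK.
  apply: is_derive_eq; rewrite fctE opprK.
  have O := kernel_ode n0 (s ^+ 2 / 2); rewrite nE in O.
  apply/eqP; rewrite -subr_eq0; apply/eqP.
  rewrite -[RHS](subrr 1) -[X in _ = X - _]O !fctE !opprK.
  by field; rewrite gt_eqF.
pose g s := d s * (s ^+ n.-1 * expR (- (s ^+ 2 / 2))).
have g' (s : R) : 0 < s -> is_derive s 1 g 0.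
  move=> s0; have h1 := d' s s0.
  have h2 : is_derive s 1 (fun t : R => expR (- (t ^+ 2 / 2))) (expR (- (s ^+ 2 / 2)) * - s).
    apply: (@is_derive1_comp _ expR (fun t : R => - (t ^+ 2 / 2)) s).
    by apply: is_deriveN; exact: is_derive_sqr_half.
  have h3 : is_derive s 1 (fun t : R => t ^+ n.-1) (n.-1%:R * s ^+ n.-1 / s).
    have -> : (fun t : R => t ^+ n.-1) = (@idfun R) ^+ n.-1.
      by apply/funext => t; rewrite exprfctE.
    have X := @is_deriveX _ _ (@idfun R) n.-1 s 1 1 (is_derive_id _ _).
    apply: is_derive_eq; case: (n.-1) => [|m]; first by rewrite !mul0r scale0r.
    by rewrite exprSr mulrA mulfK ?gt_eqF// [LHS]mulr1.
  have -> : g = d * ((fun t : R => t ^+ n.-1) * (fun t : R => expR (- (t ^+ 2 / 2)))) by [].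
  apply: is_derive_eq; rewrite !fctE /GRing.scale/=.
  by field; rewrite gt_eqF.
have gE a b : 0 < a -> a <= b -> g a = g b.
  move=> a0 ab.
  have H (s : R) : s \in `]a, b[%R -> is_derive s 1 g ((fun=> 0) s).
    by rewrite in_itv/= => /andP[sa _]; apply: g'; exact: lt_trans sa.
  have [|c _] := MVT_segment ab H.
    apply: derivable_within_continuous => s; rewrite in_itv/= => /andP[sa _].
    by have [] := g' s (lt_le_trans a0 sa).
  by rewrite mul0r => /eqP; rewrite subr_eq0 => /eqP.
suff dr : d r = 0 by apply/eqP; rewrite -subr_eq0 opprK; exact/eqP.
have gr : g r = 0; last first.
  move: gr => /eqP; rewrite /g mulf_eq0 => /orP[/eqP//|].
  by rewrite gt_eqF// mulr_gt0 ?exprn_gt0 ?expR_gt0.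
apply: contrapT => /eqP g0.
pose c := `|g r|; have c0 : 0 < c by rewrite normr_gt0.
have gc s : 0 < s -> `|g s| = c.
  by move=> s0; rewrite /c; case: (leP s r) => [/(gE s r s0)->//|/ltW/(gE r s r0)->].
have dc s : 0 < s -> s <= 1 -> c <= `|d s|.
  move=> s0 s1; rewrite -(gc s s0) /g normrM ler_piMr// ger0_norm; last first.
    by rewrite mulr_ge0 ?expR_ge0// exprn_ge0// ltW.
  rewrite mulr_ile1 ?expR_ge0//.
  - by rewrite exprn_ge0// ltW.
  - by rewrite exprn_ile1// ltW.
  - by rewrite expR_le1 oppr_le0 divr_ge0 ?sqr_ge0.
pose k1 := k (1 / 2); have k10 : 0 < k1 by apply: kernel_gt0 => //; lra.
have vc s : 0 < s -> s <= 1 -> s <= c / (2 * k1) -> c / 2 <= `|v s|.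
  move=> s0 s1 sc.
  have ks : k (s ^+ 2 / 2) <= k1.
    apply: kernel_le => //; first by rewrite divr_ge0 ?sqr_ge0.
    by rewrite ler_pM2r ?invr_gt0// exprn_ile1// ltW.
  have ks0 : 0 < k (s ^+ 2 / 2) by apply: kernel_gt0 => //; rewrite divr_ge0 ?sqr_ge0.
  have h1 : s * k (s ^+ 2 / 2) <= c / 2.
    apply: (@le_trans _ _ (s * k1)); first by rewrite ler_pM2l.
    rewrite -ler_pdivlMr// (le_trans sc)// le_eqVlt; apply/orP; left; apply/eqP.
    by field; rewrite gt_eqF.
  have h2 := dc s s0 s1.
  have h3 : `|d s| <= `|v s| + s * k (s ^+ 2 / 2).
    apply: (le_trans (ler_normD _ _)).
    by rewrite (ger0_norm (mulr_ge0 (ltW s0) (ltW ks0))).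
  lra.
(* The hypothesis at 0 controls u(h)/h, not u', so the mean value theorem is applied on [h/2, h].
   There c/8 suffices: the increment is at most 3ch/16, while |u'| >= c/2 makes it at least ch/4. *)
have : \forall h \near 0^'+, `|h^-1 * (u h - u 0)| < c / 8.
  have c8 : 0 < c / 8 by lra.
  move/cvgrPdist_lt : ulim => /(_ _ c8); apply: filterS => h.
  by rewrite sub0r normrN.
rewrite uz => /nbhs_ballP[e /= e0 he].
have uh (h : R) : 0 < h -> h < e -> `|u h| <= c / 8 * h.
  move=> h0 h1; have := he h; rewrite /ball/= sub0r normrN gtr0_norm// => /(_ h1 h0).
  rewrite subr0 normrM gtr0_norm ?invr_gt0// => /ltW.
  by rewrite ler_pdivrMl// mulrC.
pose h := Num.min (Num.min 1 (e / 2)) (c / (2 * k1)).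
have h0 : 0 < h.
  have p1 : 0 < e / 2 by rewrite divr_gt0.
  have p2 : 0 < c / (2 * k1) by rewrite divr_gt0// mulr_gt0.
  by rewrite !lt_min p1 p2 ltr01.
have h1 : h <= 1 by rewrite !ge_min lexx.
have he2 : h <= e / 2 by rewrite !ge_min lexx !orbT.
have hc : h <= c / (2 * k1) by rewrite !ge_min lexx !orbT.
have u' (s : R) : 0 < s -> is_derive s 1 u (v s).
  by move=> s0; have [du _ _] := uode s s0; apply: DeriveDef => //; rewrite /v derive1E.
have hh : h / 2 <= h by lra.
have [||s sI E] := @MVT_segment _ u v (h / 2) h hh.
- by move=> s; rewrite in_itv/= => /andP[s0 _]; apply: u'; lra.
- apply: derivable_within_continuous => s; rewrite in_itv/= => /andP[s0 _].
  have : 0 < s by lra.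
  by move=> /u'[].
move: sI; rewrite in_itv/= => /andP[s1 s2].
have vs : c / 2 <= `|v s| by apply: vc; lra.
have : `|u h - u (h / 2)| <= c / 8 * h + c / 8 * (h / 2).
  by apply: (le_trans (ler_normB _ _)); apply: lerD; apply: uh; lra.
rewrite E normrM (ger0_norm (_ : 0 <= h - h / 2)); last by lra.
have : c / 2 * (h - h / 2) <= `|v s| * (h - h / 2) by rewrite ler_wpM2r//; lra.
have : 0 < c * h by rewrite mulr_gt0.
lra.
Qed.

End radial_profile.

(** * Regularised support functions *)

Section penalized_support.
Context (R : realType) (n : nat) (K : set 'rV[R]_n) (r1 eps : R).
Hypotheses (cK : compact K) (vK : convex_set K) (K0 : K 0).
Hypotheses (Kr : K `<=` cball n r1) (eps0 : 0 < eps).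
Implicit Types x y z : 'rV[R]_n.

Local Notation e i := (delta_mx 0 i : 'rV[R]_n).

Lemma convex_set_segment x y (s : R) : K x -> K y -> 0 < s -> s <= 1 ->
  K (x + s *: (y - x)).
Proof.
move=> Kx Ky s0 s1.
have h : 0 <= s <= 1 by rewrite (ltW s0).
have := @vK y x (Itv01 (ltW s0) s1); rewrite !inE => /(_ Ky Kx).
rewrite /conv/=.
have -> : x + s *: (y - x) = s *: y + (1 - s) *: x.
  by rewrite scalerBr scalerBl scale1r addrCA.
done.
Qed.

Let pen x z := edot x z - eps / 2 * edot z z.

Let ex_max x : exists z, K z /\ forall y, K y -> pen x y <= pen x z.
Proof.
have [||z zK hz] := @EVT_max_rV R n (pen x) K _ cK.
- by exists 0.
- apply: continuous_subspaceT.
  have c1 : continuous (fun z => edot x z).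
    apply: (@continuous_edot _ _ _ (fun=> x) idfun); first exact: cst_continuous.
    by move=> t; exact: cvg_id.
  have c2 : continuous (fun z => edot z z).
    by apply: (@continuous_edot _ _ _ idfun idfun) => t; exact: cvg_id.
  by move=> t; exact: (cvgB (c1 t) (cvgM (cvg_cst _) (c2 t))).
by exists z; split; [rewrite -in_setE|move=> y Ky; apply: hz; rewrite in_setE].
Qed.

(** Completing the square in x.z - eps |z|^2/2 shows that this is the nearest-point projection of
    x/eps onto K; strict concavity of the penalised functional is what makes it Lipschitz in x. *)
Definition penalized_argmax := projT1 (choice ex_max).

Local Notation pz := penalized_argmax.

Let pzP x := projT2 (choice ex_max) x.

Lemma penalized_argmaxK x : K (pz x).
Proof. exact: (pzP x).1. Qed.

Definition penalized_support x := edot x (pz x) - eps / 2 * edot (pz x) (pz x).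

Lemma penalized_support_ge x y : K y ->
  edot x y - eps / 2 * edot y y <= penalized_support x.
Proof. exact: (pzP x).2. Qed.

(** Variational inequality of a projection: the maximiser z is compared with the points z + s (y -
    z) of K for small s. *)
Let first_order x y : K y -> edot x (y - pz x) <= eps * edot (pz x) (y - pz x).
Proof.
move=> Ky; set z := pz x; have Kz : K z by exact: penalized_argmaxK.
have seg s := convex_set_segment (s := s) Kz Ky; move: (y - z) seg => w seg.
rewrite leNgt; apply/negP => h.
pose a := edot x w - eps * edot z w; pose b := edot w w.
have a0 : 0 < a by rewrite subr_gt0.
have b0 : 0 <= b by exact: edot_ge0.
have H s : 0 < s -> s <= 1 -> a <= eps / 2 * (s * b).
  move=> s0 s1.
  have := penalized_support_ge x (seg s s0 s1).
  rewrite /penalized_support -/z !(edotDl, edotDr) !(edotZl, edotZr) (edotC w z).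
  rewrite -/b => hs; rewrite -(ler_pM2l s0) /a.
  move: (edot x w) (edot z w) (edot x z) (edot z z) hs => p q p' q'; lra.
(* Small enough that eps s b / 2 < a; the summand 1 covers the case b = 0. *)
pose s := Num.min 1 (a / (eps * (b + 1))).
have eb : 0 < eps * (b + 1) by rewrite mulr_gt0//; lra.
have s0 : 0 < s by rewrite lt_min ltr01 divr_gt0.
have := H s s0; rewrite ge_min lexx => /(_ isT).
apply/negP; rewrite -ltNge.
have h1 : s * (eps * (b + 1)) <= a by rewrite -ler_pdivlMr// ge_min lexx orbT.
have h2 : 0 <= s * eps by rewrite mulr_ge0 ?ltW.
nra.
Qed.

(** Adding the first-order conditions at x and y gives strong monotonicity: eps |z_x - z_y|^2 <= (x
    - y).(z_x - z_y). *)
Lemma penalized_argmax_lipschitz x y : enorm (pz x - pz y) <= enorm (x - y) / eps.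
Proof.
have h1 := first_order x (penalized_argmaxK y).
have h2 := first_order y (penalized_argmaxK x).
have H : eps * edot (pz x - pz y) (pz x - pz y) <= edot (x - y) (pz x - pz y).
  move: h1 h2; rewrite !(edotDl, edotDr) !(edotNl, edotNr) (edotC (pz y) (pz x)).
  lra.
rewrite ler_pdivlMr// mulrC.
have [z0|z0] := eqVneq (enorm (pz x - pz y)) 0.
  by rewrite z0 mulr0 enorm_ge0.
have zp : 0 < enorm (pz x - pz y) by rewrite lt0r z0 enorm_ge0.
rewrite -(ler_pM2r zp) -mulrA -expr2 sqr_enorm; apply: (le_trans H).
exact: edot_le.
Qed.

Lemma penalized_argmax_le x : enorm (pz x) <= r1.
Proof. exact: (Kr (penalized_argmaxK x)). Qed.

Let pz_coord x i : `|pz x 0 i| <= r1.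
Proof. by apply: (le_trans (coord_le_enorm _ _)); exact: penalized_argmax_le. Qed.

Let subgradient x y : penalized_support x + edot (y - x) (pz x) <= penalized_support y.
Proof.
have := penalized_support_ge y (penalized_argmaxK x).
by rewrite /penalized_support edotDl edotNl; lra.
Qed.

(** Envelope argument: the subgradient inequalities at x and at x + h e_i squeeze the first-order
    remainder between 0 and h times the increment of the maximiser, hence below h^2/eps. *)
Lemma is_C1_penalized_support : is_C1 penalized_support (fun i x => pz x 0 i).
Proof.
have d x i : is_derive x (e i) penalized_support (pz x 0 i).
  apply: (@is_derive_quadratic _ _ _ _ _ _ eps^-1) => h.
  have := subgradient x (h *: e i + x); have := subgradient (h *: e i + x) x.
  rewrite addrK opprD addrCA subrr addr0 edotNl !edotZl !edot_delta => h1 h2.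
  have h3 : `|pz (h *: e i + x) 0 i - pz x 0 i| <= `|h| / eps.
    have := coord_le_enorm (pz (h *: e i + x) - pz x) i; rewrite !mxE => /le_trans; apply.
    apply: (le_trans (penalized_argmax_lipschitz _ _)).
    by rewrite addrK enormZ /enorm edot_delta mxE !eqxx sqrtr1 mulr1.
  rewrite -(real_normK (num_real h)) expr2 mulrCA [eps^-1 * _]mulrC.
  apply: (@le_trans _ _ (`|h| * `|pz (h *: e i + x) 0 i - pz x 0 i|)); last first.
    by rewrite ler_wpM2l.
  rewrite -normrM [leLHS]ger0_norm; last by lra.
  apply: (@le_trans _ _ (h * (pz (h *: e i + x) 0 i - pz x 0 i))); last exact: ler_norm.
  by lra.
have r10 : 0 <= r1 by apply: le_trans (Kr K0); exact: enorm_ge0.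
split=> //.
  exact: (bounded_partial_continuous r10 d (fun i x => pz_coord x i)).
move=> i; apply: (@enorm_lipschitz_continuous _ _ _ eps^-1) => x y.
have := coord_le_enorm (pz x - pz y) i; rewrite !mxE => /le_trans; apply.
by rewrite mulrC; exact: penalized_argmax_lipschitz.
Qed.

End penalized_support.

(** * Volumes and integrals in polar form *)

Section volume.
Context (R : realType) (n : nat).
Implicit Types (x : 'rV[R]_n).

Local Notation lam := (lebesgue_row R n).
Local Notation kap := (unit_ball_volume R n).

Lemma lebesgue_row_cball_lty (r : R) : (lam (cball n r) < +oo)%E.
Proof.
apply: le_lt_trans (lebesgue_row_box_lty n r).
by apply: le_measure; rewrite ?inE; [exact: measurable_cball|exact: measurable_box|exact: cball_box].
Qed.

Lemma lebesgue_row_cball1 : lam (cball n 1) = kap%:E.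
Proof. by rewrite fineK// ge0_fin_numE// lebesgue_row_cball_lty. Qed.

Lemma unit_ball_volume_gt0 : 0 < kap.
Proof.
rewrite -lte_fin -lebesgue_row_cball1.
apply: (@lt_le_trans _ _ (lam (box n (n.+1%:R^-1)))).
  by rewrite lebesgue_row_box// lte_fin exprn_gt0// mulr_gt0.
apply: le_measure; rewrite ?inE; [exact: measurable_box|exact: measurable_cball|].
apply: (subset_trans (@box_cball R n _)) => x /le_trans; apply.
by rewrite ler_pdivrMr// mul1r ler_nat.
Qed.

Lemma lebesgue_row_cone (A : set 'rV[R]_n) (r : R) : 0 < r -> measurable A ->
  (forall c x, 0 < c -> A (c *: x) <-> A x) ->
  lam (A `&` cball n r) = ((r ^+ n)%:E * lam (A `&` cball n 1))%E.
Proof.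
move=> r0 mA hA; have mAr : measurable (A `&` cball n r).
  by apply: measurableI => //; exact: measurable_cball.
rewrite -(lebesgue_row_scale r0 mAr); congr (_ * lam _)%E.
apply/seteqP; split=> x; rewrite /preimage /cball /= enormZ (gtr0_norm r0).
  by move=> [/(hA _ _ r0) Ax]; rewrite -[leRHS]mulr1 ler_pM2l.
by move=> [Ax x1]; split; [exact/(hA _ _ r0)|rewrite -[leRHS]mulr1 ler_pM2l].
Qed.

Lemma lebesgue_row_cball (r : R) : 0 < r -> lam (cball n r) = (r ^+ n * kap)%:E.
Proof.
move=> r0; have := @lebesgue_row_cone setT r r0 measurableT.
by rewrite !setTI EFinM lebesgue_row_cball1; apply.
Qed.

Lemma measurable_origin : measurable [set (0 : 'rV[R]_n)].
Proof.
apply: closed_measurable_row.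
rewrite (_ : [set 0] = cball n (0 : R)); first exact: closed_cball.
apply/seteqP; split=> x /=; first by move=> ->; rewrite /cball/= enorm0.
by rewrite /cball/= => x0; apply: enorm_eq0; apply/eqP; rewrite eq_le x0 enorm_ge0.
Qed.

(** Doubling fixes the origin but multiplies volumes by 2^n. *)
Lemma lebesgue_row_origin : (0 < n)%N -> lam [set 0] = 0%E.
Proof.
move=> n0; have m0 := measurable_origin.
have fin : lam [set 0] \is a fin_num.
  rewrite ge0_fin_numE//; apply: le_lt_trans (lebesgue_row_cball_lty 1).
  apply: le_measure; rewrite ?inE//; first exact: measurable_cball.
  by move=> _ /= ->; rewrite /cball/= enorm0.
have := lebesgue_row_scale (ltr0n R 2) m0.
rewrite (_ : _ @^-1` _ = [set 0]); last first.
  apply/seteqP; split=> x /=; last by move=> ->; rewrite scaler0.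
  by move=> /eqP; rewrite scaler_eq0 pnatr_eq0/= => /eqP.
rewrite -(fineK fin) -EFinM => -[] h; congr EFin; apply/eqP.
have : (2 ^+ n - 1) * fine (lam [set 0]) = 0 :> R by rewrite mulrBl mul1r h subrr.
move=> /eqP; rewrite mulf_eq0 subr_eq0 => /orP[|//].
by rewrite gt_eqF// exprn_egt1// ?ltr1n// -lt0n.
Qed.

(* Cutting into the cones where a lies in [j dl, (j + 1) dl[. *)
Lemma lebesgue_row_star_ge (a : 'rV[R]_n -> R) (dl : R) : 0 < dl ->
  measurable_fun setT a -> (forall c x, 0 < c -> a (c *: x) = a x) ->
  (forall x, dl <= a x) ->
  (\int[lam]_(x in cball n 1) ((a x - dl) ^+ n)%:E <=
   lam [set x : 'rV[R]_n | (enorm x <= a x)%R])%E.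
Proof.
move=> dl0 ma ha adl.
pose C (j : nat) := [set x | Num.truncn (a x / dl) = j].
have a0 x : 0 <= a x / dl by rewrite divr_ge0 ?(ltW dl0)// (le_trans (ltW dl0)).
have CE j x : C j x <-> j%:R * dl <= a x < j.+1%:R * dl.
  rewrite -ler_pdivlMr// -ltr_pdivrMr//; split; last exact: truncn_def.
  by rewrite /C/= => <-; exact: truncn_itv.
have mC j : measurable (C j).
  rewrite (_ : C j = a @^-1` `[j%:R * dl, j.+1%:R * dl[).
    by rewrite -[X in measurable X]setTI; exact: ma.
  by apply/seteqP; split => x /=; rewrite in_itv/=; exact: (CE j x).1 || exact: (CE j x).2.
have tC (D : set 'rV[R]_n) : trivIset setT (fun j => C j `&` D).
  apply/trivIsetP => i j _ _ /eqP ij; apply/seteqP; split=> // x [[Ci _] [Cj _]].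
  by apply: ij; rewrite -Ci -Cj.
have UC (D : set 'rV[R]_n) : D = \bigcup_j (C j `&` D).
  apply/seteqP; split=> [x Dx|x [j _ []//]].
  by exists (Num.truncn (a x / dl)).
have mA : measurable [set x | enorm x <= a x].
  rewrite (_ : mkset _ = (fun x => a x - enorm x) @^-1` `[0, +oo[); last first.
    by apply/seteqP; split=> x /=; rewrite in_itv/= andbT subr_ge0.
  rewrite -[X in measurable X]setTI; apply: measurable_funB => //.
  exact: measurable_enorm.
have m1 := @measurable_cball R n 1.
rewrite [in leLHS](UC (cball n 1)) [in leRHS](UC [set x | enorm x <= a x]).
rewrite ge0_integral_bigcup//; last 3 first.
- by move=> j; exact: measurableI.
- apply/measurable_EFinP; apply: measurable_funTS; apply: measurable_funX.
  exact: measurable_funB.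
- by move=> x _; rewrite lee_fin exprn_ge0// subr_ge0.
rewrite measure_bigcup//; last by move=> j _; exact: measurableI.
rewrite [leRHS](@eq_eseriesl _ _ xpredT); last by move=> j; rewrite in_setT.
apply: lee_nneseries => [j _ _|j _].
  by apply: integral_ge0 => x _; rewrite lee_fin exprn_ge0// subr_ge0.
have [->|j0] := posnP j.
  rewrite (_ : C 0 = set0) ?set0I ?integral_set0//.
  apply/seteqP; split=> // x /CE; rewrite mul1r mul0r => /andP[_].
  by rewrite ltNge adl.
have jd : 0 < j%:R * dl by rewrite mulr_gt0// ltr0n.
(* On [C j], a - dl < j dl <= a: the first inequality bounds the integrand, the second places the
   part of the cone within radius j dl inside the star set. *)
apply: (@le_trans _ _ (((j%:R * dl) ^+ n)%:E * lam (C j `&` cball n 1))%E).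
  rewrite -integral_cst; last exact: measurableI.
  apply: ge0_le_integral => //.
  - exact: measurableI.
  - by move=> x _; rewrite lee_fin exprn_ge0// subr_ge0.
  - apply/measurable_EFinP; apply: measurable_funTS; apply: measurable_funX.
    exact: measurable_funB.
  - move=> x [/CE/andP[_ h] _]; rewrite lee_fin lerXn2r// ?nnegrE ?subr_ge0 ?(ltW jd)//.
    by rewrite -natr1 mulrDl mul1r in h; lra.
rewrite -(lebesgue_row_cone jd (mC j)); last by move=> c x c0; rewrite /C/= ha.
apply: le_measure; rewrite ?inE.
- by apply: measurableI => //; exact: measurable_cball.
- exact: measurableI.
- by move=> x [Cx xj]; split=> //=; have /CE/andP[h _] := Cx; exact: le_trans h.
Qed.

End volume.

(** * Surface integrals as integrals over the unit ball *)

Section sphere_integral.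
Context (R : realType) (n : nat).
Hypothesis n0 : (0 < n)%N.

Local Notation lam := (lebesgue_row R n).
Local Notation dir := (@direction R n).

Let mcb : measurable (@cball R n 1) := measurable_cball (n := n) 1.

Let n_ge0 : 0 <= n%:R :> R := ler0n R n.

(** Its image under [direction] is the surface measure, so a surface integral becomes an integral
    over the ball by pushforward and density. *)
Let cone_measure := mscale (NngNum n_ge0) (mrestr lam mcb).

Let pf := measure_function_pushforward__canonical__measure_function_Measure
    cone_measure (@measurable_direction R n).

Lemma cball_direction x : cball n 1 (dir x).
Proof.
rewrite /cball/= /direction enormZ normfV (ger0_norm (enorm_ge0 x)).
have [->|x0] := eqVneq (enorm x) 0; first by rewrite invr0 mul0r.
by rewrite mulVf.
Qed.

Lemma sphere_direction x : x != 0 -> sphere R n (dir x).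
Proof.
move=> x0; rewrite /sphere/= /direction enormZ normfV (ger0_norm (enorm_ge0 x)).
by rewrite mulVf//; apply: contra_neq x0 => /enorm_eq0.
Qed.

Lemma measurable_sphere : measurable (sphere R n).
Proof.
rewrite (_ : sphere R n = @enorm R n @^-1` [set 1]) //.
by rewrite -[X in measurable X]setTI; exact: measurable_enorm.
Qed.

Let cone_measureE A : measurable A ->
  cone_measure A = (\int[lam]_(x in A) (n%:R * \1_(cball n 1) x)%:E)%E.
Proof.
move=> mA; under eq_integral do rewrite EFinM.
rewrite ge0_integralZl//; last first.
  by apply/measurable_EFinP; apply: measurable_funTS; exact: measurable_indic.
by rewrite integral_indic// setIC.
Qed.

Lemma Rintegral_sphere_measure (g : 'rV[R]_n -> R) (M : R) :
  measurable_fun setT g -> (forall x, `|g x| <= M) ->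
  (sphere_measure R n).-integrable setT (EFin \o g) /\
  \int[sphere_measure R n]_x g x = n%:R * \int[lam]_(x in cball n 1) g (dir x).
Proof.
move=> mg gM.
have E A : sphere_measure R n A = pf A.
  by rewrite /sphere_measure/= /pushforward /mscale/= /mrestr setIC.
have mgd : measurable_fun setT (g \o dir).
  by apply: measurableT_comp => //; exact: measurable_direction.
have bg : bsupp (fun x => \1_(cball n 1) x * g (dir x)).
  apply: bsuppM => //; first by apply: (@bsupp_indic _ _ 1) => //; exact: cball_box.
  by move=> r; exists M.
have bgn : bsupp (fun x => g (dir x) * (n%:R * \1_(cball n 1) x)).
  by have := bsuppZ n%:R bg; congr bsupp; apply/funext => x; ring.
have ind0 : forall x : 'rV[R]_n, 0 <= n%:R * (\1_(cball n (1 : R)) x : R).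
  by move=> x; rewrite mulr_ge0.
have mind : measurable_fun setT (fun x : 'rV[R]_n => n%:R * \1_(cball n 1) x : R).
  by apply: measurable_funM => //; exact: measurable_indic.
have intc : cone_measure.-integrable setT (EFin \o (g \o dir)).
  apply: (integrable_density (mu := lam) ind0 mind cone_measureE mgd).2.
  exact: bsupp_lebesgue_integrable.
have intp : pf.-integrable setT (EFin \o g).
  apply/integrableP; split; first exact/measurable_EFinP.
  rewrite (@ge0_integral_pushforward _ _ _ _ _ _ (@measurable_direction R n) cone_measure)//; last first.
    by apply/measurable_EFinP; exact: measurableT_comp.
  by rewrite preimage_setT; have /integrableP[] := intc.
have eqi (f : 'rV[R]_n -> \bar R) : (\int[sphere_measure R n]_x f x = \int[pf]_x f x)%E.
  by apply: eq_measure_integral => A mA _; exact: E.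
split.
  apply/integrableP; split; first exact/measurable_EFinP.
  by rewrite eqi; have /integrableP[] := intp.
rewrite {1}/Rintegral eqi (@integral_pushforward _ _ _ _ _ _ (@measurable_direction R n)
  cone_measure)//; last exact/measurable_EFinP.
rewrite preimage_setT -[LHS]/(\int[cone_measure]_x (g \o dir) x).
rewrite (Rintegral_density (mu := lam) ind0 mind cone_measureE intc).
rewrite [in RHS]Rintegral_mkcond -RintegralZl//.
  apply: eq_Rintegral => x _; rewrite patchE /= indicE.
  by case: ifP => xc; rewrite ?mulr1 ?mulr0// mulrC.
have := bsupp_lebesgue_integrable bg; apply: eq_integrable => // x _ /=.
by rewrite patchE indicE; case: ifP => xc; rewrite ?mul1r ?mul0r.
Qed.

Lemma Rintegral_sphere (g : 'rV[R]_n -> R) (M : R) :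
  measurable_fun setT g -> (forall x, cball n 1 x -> `|g x| <= M) ->
  (sphere_measure R n).-integrable (sphere R n) (EFin \o g) /\
  \int[sphere_measure R n]_(x in sphere R n) g x =
  n%:R * \int[lam]_(x in cball n 1) g (dir x).
Proof.
move=> mg gM.
pose f x := g x * \1_(sphere R n) x.
have ms := measurable_sphere.
have mf : measurable_fun setT f by apply: measurable_funM => //; exact: measurable_indic.
have fM x : `|f x| <= `|M|.
  rewrite /f indicE; have [xs|xs] := boolP (x \in sphere R n); last by rewrite mulr0 normr0.
  rewrite mulr1 (le_trans _ (ler_norm M))// gM//.
  by move: xs; rewrite inE /sphere /cball /= => ->.
have [fi fE] := Rintegral_sphere_measure mf fM.
have gf : g \_ (sphere R n) = f.
  by apply/funext => x; rewrite /f patchE indicE; case: ifP; rewrite ?mulr1 ?mulr0.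
split.
  rewrite (integrable_mkcond _ ms); move: fi; apply: eq_integrable => // x _ /=.
  by rewrite -gf !patchE; case: ifP.
rewrite Rintegral_mkcond gf fE; congr (_ * _); rewrite /Rintegral; congr fine.
have m0 := @measurable_origin R n.
have md : measurable_fun setT dir := @measurable_direction R n.
apply: ae_eq_integral => //.
- by apply/measurable_EFinP; apply: measurable_funTS; exact: measurableT_comp.
- by apply/measurable_EFinP; apply: measurable_funTS; exact: measurableT_comp.
(* [direction] maps nonzero points to the sphere; only the origin, where its value is 0, has to be
   discarded. *)
- exists [set 0]; split=> //; first exact: lebesgue_row_origin.
  move=> x /= /not_implyP[_ h]; apply: contrapT => /eqP x0; apply: h.
  by rewrite /f indicE mem_set ?mulr1//; exact: sphere_direction.
Qed.

End sphere_integral.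

(** * Support function and mean width *)

Section support.
Context (R : realType) (n : nat) (K : set 'rV[R]_n) (r1 : R).
Hypotheses (K0 : K 0) (Kr : K `<=` cball n r1).
Implicit Types x y z : 'rV[R]_n.

Local Notation h := (support_function K).

Let r10 : 0 <= r1.
Proof. by apply: le_trans (Kr K0); exact: enorm_ge0. Qed.

Lemma support_function_ge x z : K z -> edot z x <= h x.
Proof.
move=> Kz; apply: ub_le_sup; last by exists z.
exists (r1 * enorm x) => _ [y Ky <-]; apply: (le_trans (edot_le _ _)).
by apply: ler_wpM2r; [exact: enorm_ge0|exact: Kr].
Qed.

Lemma support_function_le x (c : R) : (forall z, K z -> edot z x <= c) -> h x <= c.
Proof.
move=> hc; apply: ge_sup; first by exists (edot 0 x); exists 0.
by move=> _ [z Kz <-]; exact: hc.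
Qed.

Lemma support_function_ge0 x : 0 <= h x.
Proof. by rewrite -(edot0l x); exact: support_function_ge. Qed.

Lemma support_function_le_enorm x : h x <= r1 * enorm x.
Proof.
apply: support_function_le => z Kz; apply: (le_trans (edot_le _ _)).
by apply: ler_wpM2r; [exact: enorm_ge0|exact: Kr].
Qed.

Lemma support_functionZ (c : R) x : 0 <= c -> h (c *: x) = c * h x.
Proof.
rewrite le0r => /orP[/eqP->|c0].
  rewrite scale0r mul0r; apply/eqP; rewrite eq_le support_function_ge0 andbT.
  by apply: support_function_le => z _; rewrite edotC edot0l.
apply/eqP; rewrite eq_le; apply/andP; split.
  apply: support_function_le => z Kz; rewrite edotZr ler_pM2l//.
  exact: support_function_ge.
rewrite -ler_pdivlMl//; apply: support_function_le => z Kz.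
by rewrite ler_pdivlMl// -edotZr; exact: support_function_ge.
Qed.

Lemma continuous_support_function : continuous h.
Proof.
have H x y : h x - h y <= r1 * enorm (x - y).
  rewrite lerBlDr; apply: support_function_le => z Kz.
  rewrite -[x in edot z x](subrK y) edotDr lerD//; last exact: support_function_ge.
  apply: (le_trans (edot_le _ _)).
  by apply: ler_wpM2r; [exact: enorm_ge0|exact: Kr].
apply: (@enorm_lipschitz_continuous _ _ _ r1) => x y.
rewrite ler_norml H andbT lerNl opprB (le_trans (H y x))//.
by rewrite -opprB enormN.
Qed.

Lemma support_function_direction x : h x = enorm x * h (direction x).
Proof.
rewrite -support_functionZ ?enorm_ge0// /direction scalerA.
have [x0|x0] := eqVneq (enorm x) 0; last by rewrite divff// scale1r.
by rewrite (enorm_eq0 x0) !scaler0.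
Qed.

Lemma support_function_direction_le x : h (direction x) <= r1.
Proof.
apply: (le_trans (support_function_le_enorm _)); rewrite ler_piMr//.
exact: cball_direction.
Qed.

End support.

Section mean_width.
Context (R : realType) (n : nat).
Hypothesis n0 : (0 < n)%N.
Implicit Types (K : set 'rV[R]_n) (r : R).

Lemma support_function_cball r x : 0 < r -> sphere R n x ->
  support_function (cball n r) x = r.
Proof.
move=> r0 x1.
have b0 : cball n r 0 by rewrite /cball/= enorm0 ltW.
have br : cball n r `<=` cball n r by [].
apply/eqP; rewrite eq_le; apply/andP; split.
  by apply: (le_trans (support_function_le_enorm b0 br x)); rewrite x1 mulr1.
have := support_function_ge br x (z := r *: x).
rewrite edotZl -sqr_enorm x1 expr1n mulr1; apply.
by rewrite /cball/= enormZ x1 mulr1 gtr0_norm.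
Qed.

Lemma mean_support_excessE K r r1 : 0 < r -> K 0 -> K `<=` cball n r1 ->
  mean_support_excess r K = (mean_width K - mean_width (cball n r)) / 2.
Proof.
move=> r0 K0 Kr.
have ms := @measurable_sphere R n.
have b0 : cball n r 0 by rewrite /cball/= enorm0 ltW.
have int K' r' : K' 0 -> K' `<=` cball n r' ->
    (sphere_measure R n).-integrable (sphere R n) (EFin \o support_function K').
  move=> K0' Kr'.
  have mh := continuous_measurable_row (continuous_support_function K0' Kr').
  apply: (Rintegral_sphere n0 mh (M := r') _).1 => x x1.
  rewrite ger0_norm; last exact: support_function_ge0 K0' Kr' x.
  apply: (le_trans (support_function_le_enorm K0' Kr' x)).
  rewrite ler_piMr//; apply: le_trans (Kr' _ K0'); exact: enorm_ge0.
have i1 := int _ _ K0 Kr; have i2 := int _ _ b0 (fun x h => h).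
rewrite /mean_support_excess /mean_width.
rewrite (_ : \int[_]_(_ in _) (_ - r) = \int[sphere_measure R n]_(xi in sphere R n)
    (support_function K xi - support_function (cball n r) xi)); last first.
  by apply: eq_Rintegral => x; rewrite inE => xs; rewrite support_function_cball.
rewrite RintegralB// -mulrBr; field.
by rewrite gt_eqF ?unit_ball_volume_gt0//= pnatr_eq0 -lt0n.
Qed.

(** In this form the excess can be compared with the volume of a star set, itself bounded below by
    an integral over the unit ball. *)
Lemma mean_support_excess_cone K r r1 : 0 < r -> K 0 -> K `<=` cball n r1 ->
  mean_support_excess r K = (unit_ball_volume R n)^-1 *
    \int[lebesgue_row R n]_(x in cball n 1) (support_function K (direction x) - r).
Proof.
move=> r0 K0 Kr.
have mh := continuous_measurable_row (continuous_support_function K0 Kr).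
have m1 : measurable_fun setT (fun x => support_function K x - r).
  exact: measurable_funB.
have [|_ E] := Rintegral_sphere n0 m1 (M := r1 + r).
  move=> x x1; apply: (le_trans (ler_normB _ _)); rewrite (gtr0_norm r0) lerD2r.
  rewrite ger0_norm; last exact: support_function_ge0 K0 Kr x.
  apply: (le_trans (support_function_le_enorm K0 Kr x)).
  rewrite ler_piMr//; apply: le_trans (Kr _ K0); exact: enorm_ge0.
rewrite /mean_support_excess E; field.
by rewrite gt_eqF ?unit_ball_volume_gt0//= pnatr_eq0 -lt0n.
Qed.

Lemma mean_width_cball_le r : 0 < r -> mean_width (cball n r) <= 2 * r.
Proof.
move=> r0; rewrite /mean_width.
have m1 : measurable_fun setT (fun _ : 'rV[R]_n => r) by exact: measurable_cst.
have [|_ E] := Rintegral_sphere n0 m1 (M := r).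
  by move=> x _; rewrite gtr0_norm.
rewrite (_ : \int[_]_(_ in _) _ = n%:R * \int[lebesgue_row R n]_(x in cball n 1) r).
  rewrite Rintegral_cst//; last exact: measurable_cball.
  rewrite -/(unit_ball_volume R n) le_eqVlt; apply/orP; left; apply/eqP; field.
  by rewrite gt_eqF ?unit_ball_volume_gt0//= pnatr_eq0 -lt0n.
by rewrite -E; apply: eq_Rintegral => x; rewrite inE => xs; rewrite support_function_cball.
Qed.

End mean_width.

(** * Estimates for the radial solution *)

Section cutoff.
Context (R : realType).
Implicit Types s h dl : R.

Lemma is_derive_sqr_pos (s : R) : is_derive s 1 (fun t : R => Num.max 0 t ^+ 2) (2 * Num.max 0 s).
Proof.
apply: (@is_derive_quadratic _ R^o _ _ _ _ 1) => h.
rewrite [h *: 1]mulr1 mul1r !maxEle ler_norml.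
by case: (leP 0 (h + s)) => h1; case: (leP 0 s) => h2; apply/andP; split; nra.
Qed.

(** A C^1 substitute for the positive part: 0 up to dl, s - 3 dl/2 from 2 dl on, and in between a
    slope [dcutoff] growing linearly from 0 to 1. *)
Definition cutoff dl s :=
  (Num.max 0 (s - dl) ^+ 2 - Num.max 0 (s - 2 * dl) ^+ 2) / (2 * dl).

Definition dcutoff dl s := (Num.max 0 (s - dl) - Num.max 0 (s - 2 * dl)) / dl.

Lemma is_derive_cutoff dl (s : R) : dl != 0 -> is_derive s 1 (cutoff dl) (dcutoff dl s).
Proof.
move=> dl0.
have d1 c : is_derive s 1 (fun t : R => Num.max 0 (t - c) ^+ 2) (2 * Num.max 0 (s - c)).
  rewrite -[X in is_derive _ _ _ X]mulr1.
  apply: (@is_derive1_comp _ (fun t : R => Num.max 0 t ^+ 2) (fun t => t - c) s).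
    exact: is_derive_sqr_pos.
  by apply: is_derive_eq; rewrite subr0.
have h1 := d1 dl; have h2 := d1 (2 * dl).
by apply: is_derive_eq; rewrite /dcutoff !(scaler0, add0r) /GRing.scale/=; field.
Qed.

Lemma continuous_dcutoff dl : continuous (dcutoff dl).
Proof.
have cm c : continuous (fun s => Num.max 0 (s - c)).
  move=> s; apply: (@continuous_max _ _ (fun=> 0) (fun s => s - c)).
    exact: cvg_cst.
  by apply: cvgB; [exact: cvg_id|exact: cvg_cst].
move=> s; apply: cvgM; last exact: cvg_cst.
by apply: cvgB; exact: cm.
Qed.

Lemma cutoff0 dl s : 0 < dl -> s <= dl -> cutoff dl s = 0.
Proof.
move=> dl0 sd; rewrite /cutoff !max_l; [|lra|lra].
by rewrite subrr mul0r.
Qed.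

Lemma dcutoff0 dl s : 0 < dl -> s <= dl -> dcutoff dl s = 0.
Proof.
move=> dl0 sd; rewrite /dcutoff !max_l; [|lra|lra].
by rewrite subrr mul0r.
Qed.

Lemma dcutoff1 dl s : 0 < dl -> 2 * dl <= s -> dcutoff dl s = 1.
Proof.
move=> dl0 sd; rewrite /dcutoff !max_r; [|lra|lra].
by field; rewrite gt_eqF.
Qed.

Lemma dcutoff_itv dl s : 0 < dl -> 0 <= dcutoff dl s <= 1.
Proof.
move=> dl0; rewrite /dcutoff ler_pdivlMr// mul0r ler_pdivrMr// mul1r !maxEle.
by case: (leP 0 (s - dl)) => h1; case: (leP 0 (s - 2 * dl)) => h2; apply/andP; split; lra.
Qed.

End cutoff.

Section kernel_estimates.
Context (R : realType) (n : nat).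
Hypothesis n0 : (0 < n)%N.
Implicit Types p q : R.

Local Notation P := (@radial_potential R n).
Local Notation k := (@radial_kernel R n).
Local Notation dk := (@radial_dkernel R n).

Lemma is_derive_increment (f df : R -> R) p q : (forall s : R, is_derive s 1 f (df s)) ->
  exists s, [/\ Num.min p q <= s, s <= Num.max p q & f p - f q = df s * (p - q)].
Proof.
move=> f'; wlog pq : p q / q <= p => [H|].
  have /orP[/H//|qp] := le_total q p; have [s [s1 s2 E]] := H q p qp.
  by exists s; split; [rewrite minC|rewrite maxC|rewrite -opprB E -mulrN opprB].
have [|s sI E] := MVT_segment pq (fun s _ => f' s).
  by apply: derivable_within_continuous => s _; have [] := f' s.
by move: sI; rewrite in_itv/= => /andP[s1 s2]; exists s; rewrite min_r// max_l.
Qed.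

(** Convexity of P on the half-line, where its derivative k is nondecreasing. *)
Lemma potential_tangent p q : 0 <= p -> 0 <= q -> k q * (p - q) <= P p - P q.
Proof.
move=> p0 q0; have [s [s1 s2 ->]] := is_derive_increment p q (is_derive_potential n0).
have [qp|pq] := leP q p.
  rewrite (min_r qp) in s1; rewrite ler_wpM2r ?subr_ge0//; exact: kernel_le.
rewrite (max_r (ltW pq)) in s2; rewrite (min_l (ltW pq)) in s1.
rewrite ler_wnM2r ?subr_le0 ?(ltW pq)//; apply: kernel_le => //.
exact: le_trans s1.
Qed.

Lemma kernel_lipschitz Q p q : 0 <= p -> p <= Q -> 0 <= q -> q <= Q ->
  `|k p - k q| <= dk Q * `|p - q|.
Proof.
move=> p0 pQ q0 qQ; have [s [s1 s2 ->]] := is_derive_increment p q (is_derive_kernel n0).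
have s0 : 0 <= s by apply: le_trans s1; rewrite le_min p0.
have sQ : s <= Q by apply: (le_trans s2); rewrite ge_max pQ.
rewrite normrM ler_wpM2r// ger0_norm ?dkernel_ge0//.
exact: dkernel_le.
Qed.

(** In terms of q = |x|^2/2, this is |grad U|^2 exp(-|x|^2/2): the density of the energy for
    Lebesgue measure, up to the Gaussian constant. *)
Definition gradient_density q := (2 * q * k q ^+ 2) * expR (- q).

(** The three terms of the derivative, without the exponential and all with positive sign, at Q,
    where they are largest on [0, Q]. *)
Definition gradient_density_lip Q := 2 * k Q ^+ 2 + 4 * Q * k Q * dk Q + 2 * Q * k Q ^+ 2.

Lemma gradient_density_lipschitz Q p q : 0 <= p -> p <= Q -> 0 <= q -> q <= Q ->
  `|gradient_density p - gradient_density q| <= gradient_density_lip Q * `|p - q|.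
Proof.
move=> p0 pQ q0 qQ.
pose df s := (2 * k s ^+ 2 + 4 * s * k s * dk s - 2 * s * k s ^+ 2) * expR (- s).
have d (s : R) : is_derive s 1 gradient_density (df s).
  have h1 := is_derive_kernel n0 s.
  have h2 : is_derive s 1 (fun t : R => k t ^+ 2) (2 * k s * dk s).
    rewrite (_ : (fun _ => _) = k * k); last by apply/funext => t; rewrite expr2 fctE.
    by apply: is_derive_eq; rewrite /GRing.scale/=; ring.
  have h3 : is_derive s 1 (fun t : R => expR (- t)) (- expR (- s)).
    by apply: is_derive_eq; rewrite mulrN1.
  by apply: is_derive_eq; rewrite /df /GRing.scale/=; ring.
have [s [s1 s2 ->]] := is_derive_increment p q d.
have s0 : 0 <= s by apply: le_trans s1; rewrite le_min p0.
have sQ : s <= Q by apply: (le_trans s2); rewrite ge_max pQ.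
rewrite normrM ler_wpM2r// /df normrM.
have Q0 : 0 <= Q by exact: le_trans sQ.
have k0 := ltW (kernel_gt0 n0 s0); have kQ := kernel_le n0 s0 sQ.
have dk0 := dkernel_ge0 n0 s0; have dkQ := dkernel_le n0 s0 sQ.
have e1 : `|expR (- s)| <= 1 by rewrite ger0_norm ?expR_ge0// expR_le1 oppr_le0.
rewrite -[leRHS]mulr1; apply: ler_pM => //.
have a1 : k s ^+ 2 <= k Q ^+ 2 by rewrite lerXn2r ?nnegrE// (le_trans k0).
have a2 : s * k s * dk s <= Q * k Q * dk Q by rewrite !ler_pM ?mulr_ge0.
have a3 : s * k s ^+ 2 <= Q * k Q ^+ 2 by rewrite ler_pM// exprn_ge0.
have b1 : 0 <= k s ^+ 2 by rewrite exprn_ge0.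
have b2 : 0 <= s * k s * dk s by rewrite !mulr_ge0.
have b3 : 0 <= s * k s ^+ 2 by rewrite mulr_ge0.
rewrite ler_norml /gradient_density_lip; apply/andP; split; lra.
Qed.

End kernel_estimates.

(** * Upper bound on the ball, lower bound on the combination *)

Section radial_energy.
Context (R : realType) (n : nat).
Implicit Types (x : 'rV[R]_n.+1) (psi : 'rV[R]_n.+1 -> R).

Local Notation gam := (gauss_row R n.+1).
Local Notation k := (@radial_kernel R n.+1).
Local Notation q x := (edot x x / 2).

Definition sqr_gradient x : R := k (q x) ^+ 2 * edot x x.

Lemma sqr_gradient_ge0 x : 0 <= sqr_gradient x.
Proof. by rewrite mulr_ge0 ?sqr_ge0// edot_ge0. Qed.

Lemma is_C1_radial_kernel :
  is_C1 (fun x => k (q x)) (fun i x => @radial_dkernel R n.+1 (q x) * x 0 i).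
Proof.
apply: (is_C1_comp (@is_C1_sqr_norm R n.+1)) => [s|]; first exact: is_derive_kernel.
exact: continuous_dkernel.
Qed.

Lemma continuous_sqr_gradient : continuous sqr_gradient.
Proof.
have kC := is_C1_radial_kernel.
have [c _ _] := is_C1_mul (is_C1_mul kC kC)
  (is_C1_mul (is_C1_cst n.+1 (2 : R)) (@is_C1_sqr_norm R n.+1)).
have -> : sqr_gradient = (fun x => k (q x) * k (q x) * (cst 2 x * (q x))); last exact: c.
by apply/funext => x; rewrite /sqr_gradient /cst; field.
Qed.

(* The weak form of Delta U - x . grad U = -1, with grad U = - k(q x) x. *)
Lemma torsion_energy_radial (Omega : set 'rV[R]_n.+1) (r : R) psi :
  0 < r -> Omega `<=` box n.+1 r -> test_function Omega psi ->
  bsupp (fun x => \sum_(i < n.+1)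
    (2 * - (k (q x) * x 0 i) * partial i psi x - partial i psi x ^+ 2)) /\
  torsion_energy psi = \int[gam]_x \sum_(i < n.+1)
    (2 * - (k (q x) * x 0 i) * partial i psi x - partial i psi x ^+ 2).
Proof.
move=> r0 Or tpsi; have s := test_function_supported Or tpsi.
have C := test_function_C1 tpsi s.
have [bp bpp] := is_C1_bsupp C (ltW r0) s.
have b1 i : bsupp (fun x => - (k (q x) * x 0 i) * partial i psi x).
  have [ckx _ _] := is_C1_mul is_C1_radial_kernel (is_C1_coord R i).
  have := bsuppZ (-1) (bsuppMc (bpp i) ckx).
  by congr bsupp; apply/funext => x; ring.
have b2 i : bsupp (fun x => partial i psi x * partial i psi x) by exact: bsuppMb.
have b3 i : bsupp (fun x => 2 * - (k (q x) * x 0 i) * partial i psi x - partial i psi x ^+ 2).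
  have := bsuppB (bsuppZ 2 (b1 i)) (b2 i).
  by congr bsupp; apply/funext => x; ring.
split; first exact: bsupp_sum.
rewrite /torsion_energy.
have <- := gauss_weak_radial (is_derive_kernel _) (continuous_dkernel _)
  (kernel_ode _) C r0 s => //.
have -> : dirichlet psi = \int[gam]_x \sum_(i < n.+1) partial i psi x * partial i psi x.
  by rewrite Rintegral_sum// => i; exact: bsupp_gauss_integrable.
have b4 : bsupp (fun x => \sum_(i < n.+1) - (k (q x) * x 0 i) * partial i psi x).
  exact: bsupp_sum.
rewrite -RintegralZl//; last exact: bsupp_gauss_integrable.
rewrite -RintegralB//; last 2 first.
- by apply: bsupp_gauss_integrable; exact: bsuppZ.
- by apply: bsupp_gauss_integrable; exact: bsupp_sum.
apply: eq_Rintegral => x _; rewrite mulr_sumr -sumrB; apply: eq_bigr => i _.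
by ring.
Qed.

Lemma bsupp_sqr_gradient (A : set 'rV[R]_n.+1) (r : R) : 0 <= r -> measurable A ->
  A `<=` box n.+1 r -> bsupp (fun x => \1_A x * sqr_gradient x).
Proof.
move=> r0 mA Ar; apply: bsuppMc; last exact: continuous_sqr_gradient.
exact: bsupp_indic Ar.
Qed.

Lemma gauss_torsion_ball_le (r : R) : 0 < r ->
  gauss_torsion_body (cball n.+1 r) <= \int[gam]_x (\1_(cball n.+1 r) x * sqr_gradient x).
Proof.
move=> r0; have Or : (cball n.+1 r)° `<=` box n.+1 r.
  by apply: subset_trans (@cball_box R n.+1 r); exact: interior_subset.
have mO : measurable (cball n.+1 r)°.
  by apply: open_measurable_row; exact: open_interior.
have [_ +] := gauss_torsion_variational r0 mO Or; apply => psi tpsi.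
have [b ->] := torsion_energy_radial r0 Or tpsi.
apply: le_Rintegral => //.
- exact: bsupp_gauss_integrable.
- apply: bsupp_gauss_integrable; apply: (bsupp_sqr_gradient (ltW r0)).
    exact: measurable_cball.
  exact: cball_box.
move=> x _; rewrite indicE.
have [xr|xr] := boolP (x \in cball n.+1 r).
  rewrite mul1r /sqr_gradient /edot mulr_sumr; apply: ler_sum => i _.
  by have := sqr_ge0 (k (q x) * x 0 i + partial i psi x); rewrite /edot; nra.
rewrite mul0r big1// => i _; rewrite (partial_outside i tpsi) ?mulr0 ?expr0n/= ?subr0//.
by move=> /interior_subset xr'; move/negP: xr; apply; exact: mem_set.
Qed.

End radial_energy.

(** * Test function on the convex combination *)

Section convex_combination.
Context (R : realType) (n : nat) (K : set 'rV[R]_n.+1) (r r1 t : R).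
Hypotheses (cK : compact K) (vK : convex_set K) (K0 : K 0).
Hypotheses (Kr : K `<=` cball n.+1 r1) (r0 : 0 < r) (r10 : 0 < r1).
Hypotheses (t0 : 0 < t) (t1 : t < 1).
Implicit Types (x : 'rV[R]_n.+1).

Local Notation gam := (gauss_row R n.+1).
Local Notation P := (@radial_potential R n.+1).
Local Notation k := (@radial_kernel R n.+1).
Local Notation q x := (edot x x / 2).
Local Notation kr := (k (r ^+ 2 / 2)).
Local Notation hh := (penalized_support t cK K0).
Local Notation pz := (penalized_argmax t cK K0).
Local Notation Kt := (minkowski_add (minkowski_scale (1 - t) (cball n.+1 r))
                        (minkowski_scale t K)).

(** The last term pays for t^2 |z|^2 in the expansion of |x - t z|^2, where z is the maximiser at
    x. *)
Definition perturbed_profile x : R :=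
  P (r ^+ 2 / 2) - P (q x) + t * kr * (hh x - r ^+ 2) - kr * t ^+ 2 * r1 ^+ 2 / 2.

Local Notation w := perturbed_profile.

Let kr0 : 0 < kr.
Proof. by apply: kernel_gt0 => //; rewrite divr_ge0 ?sqr_ge0. Qed.

Lemma is_C1_perturbed_profile :
  is_C1 w (fun i x => - (k (q x) * x 0 i) + t * kr * pz x 0 i).
Proof.
have h1 := is_C1_comp (@is_C1_sqr_norm R n.+1)
  (fun s => is_derive_potential (ltn0Sn n) s) _.
have cP : continuous k.
  move=> s; apply: differentiable_continuous; apply/derivable1_diffP.
  by have [] := is_derive_kernel (ltn0Sn n) s.
have h2 := is_C1_mul (is_C1_cst n.+1 (-1 : R)) (h1 cP).
have h3 := is_C1_mul (is_C1_cst n.+1 (t * kr)) (is_C1_penalized_support cK vK K0 Kr t0).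
have h4 := is_C1_add (is_C1_add h2 h3) (is_C1_cst n.+1
  (P (r ^+ 2 / 2) - t * kr * r ^+ 2 - kr * t ^+ 2 * r1 ^+ 2 / 2)).
have E1 : w = fun x => cst (-1) x * P (q x) + cst (t * kr) x * hh x +
    cst (P (r ^+ 2 / 2) - t * kr * r ^+ 2 - kr * t ^+ 2 * r1 ^+ 2 / 2) x.
  by apply/funext => x; rewrite /w /cst; ring.
rewrite E1; move: h4; congr (is_C1 _ _); apply/funext => i; apply/funext => x.
by rewrite /cst; ring.
Qed.

Lemma minkowski_combination_bounded : Kt `<=` cball n.+1 (r + r1).
Proof.
move=> _ [_ [y yr <-] [_ [z zK <-] <-]]; apply: (le_trans (enormD _ _)).
rewrite !enormZ (gtr0_norm t0) gtr0_norm ?subr_gt0//.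
have zr : enorm z <= r1 := Kr zK.
apply: lerD; rewrite -[leRHS]mul1r ler_pM ?enorm_ge0 ?(ltW t0) ?(ltW t1)//.
  by rewrite subr_ge0 ltW.
by rewrite lerBlDr lerDl ltW.
Qed.

(** By convexity P(r^2/2) - P(q) <= kr (r^2/2 - q), so the factor kr > 0 splits off and w > 0 reads
    |x - t z|^2 < (1 - 2t) r^2 <= ((1 - t) r)^2. Hence x = (x - t z) + t z is the required
    decomposition. *)
Lemma perturbed_profile_gt0 x : 0 < w x -> Kt x.
Proof.
move=> wx; set z := pz x; have zK : K z by exact: penalized_argmaxK.
have zr : edot z z <= r1 ^+ 2.
  by rewrite -sqr_enorm lerXn2r ?nnegrE ?enorm_ge0 ?(ltW r10)//; exact: Kr.
have tang := potential_tangent (ltn0Sn n) (divr_ge0 (edot_ge0 x) (ler0n R 2))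
  (divr_ge0 (sqr_ge0 r) (ler0n R 2)).
have hz : hh x <= edot x z.
  by rewrite /penalized_support -/z lerBlDr lerDl mulr_ge0 ?edot_ge0// divr_ge0// ltW.
have H : 0 < kr * ((r ^+ 2 - edot x x) / 2 + t * (edot x z - r ^+ 2) - t ^+ 2 * r1 ^+ 2 / 2).
  apply: (lt_le_trans wx); rewrite /w.
  have kt0 : 0 <= t * kr by exact/ltW/mulr_gt0.
  have := ler_wpM2l kt0 hz.
  lra.
rewrite pmulr_rgt0// in H.
have s0 : 0 < 1 - t by rewrite subr_gt0.
have xz : enorm (x - t *: z) <= (1 - t) * r.
  rewrite -(@ler_sqr _ (enorm _)) ?nnegrE ?enorm_ge0 ?mulr_ge0 ?(ltW s0) ?(ltW r0)//.
  rewrite sqr_enorm !(edotDl, edotDr) !(edotNl, edotNr) !edotZl !edotZr (edotC z x).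
  have h3 : t ^+ 2 * edot z z <= t ^+ 2 * r1 ^+ 2 by rewrite ler_wpM2l ?sqr_ge0.
  have h4 := sqr_ge0 (t * r); nra.
exists (x - t *: z); last first.
  by exists (t *: z); [exists z|rewrite subrK].
exists ((1 - t)^-1 *: (x - t *: z)).
  by rewrite /cball/= enormZ gtr0_norm ?invr_gt0// ler_pdivrMl.
by rewrite scalerA mulfV ?scale1r// gt_eqF.
Qed.

(** On D the cutoff has slope 1, so the test function has gradient grad U + t kr z there and energy
    density |grad U|^2 - (t kr |z|)^2. The loss is charged on the whole ball containing K_t, which
    also covers the transition region. *)
Lemma torsion_combination_ge (D : set 'rV[R]_n.+1) : measurable D ->
  D `<=` [set x | 2 * t ^+ 2 <= w x] ->
  \int[gam]_x (\1_D x * sqr_gradient x) -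
    (kr * t * r1) ^+ 2 * \int[gam]_x \1_(cball n.+1 (r + r1)) x <= gauss_torsion_body Kt.
Proof.
move=> mD Dw.
have rr0 : 0 < r + r1 by rewrite addr_gt0.
have Or : Kt° `<=` box n.+1 (r + r1).
  apply: subset_trans (@cball_box R n.+1 _).
  apply: subset_trans minkowski_combination_bounded; exact: interior_subset.
have mO : measurable Kt° by apply: open_measurable_row; exact: open_interior.
have wC := is_C1_perturbed_profile; have [cw _ _] := wC.
have tt : 0 < t ^+ 2 by rewrite exprn_gt0.
have phiC := is_C1_comp wC (fun s => is_derive_cutoff s (lt0r_neq0 tt))
  (@continuous_dcutoff R (t ^+ 2)).
set phi := (fun x => _) in phiC.
(* L carries the support of the test function. It lies in the open set where w > 0, itself contained
   in K_t and so in its interior. *)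
pose L := [set x | t ^+ 2 <= w x].
have LK : L `<=` Kt°.
  have oU : open [set x | 0 < w x].
    by apply: (open_comp (D := [set s : R | 0 < s])) (@open_gt R 0) => x _; exact: cw.
  apply: (@subset_trans _ [set x | 0 < w x]); first by move=> x; exact: lt_le_trans.
  rewrite -open_subsetE//; exact: perturbed_profile_gt0.
have cL : compact L.
  apply: (@closed_cball_compact _ _ (r + r1)).
    by apply: (closed_comp (D := [set s : R | t ^+ 2 <= s])) (@closed_ge R _) => x _; exact: cw.
  by move=> x /LK /interior_subset; exact: minkowski_combination_bounded.
have tphi : test_function Kt° phi.
  apply: (C1_test_function phiC cL LK) => x /negP; rewrite -ltNge => wx.
  by rewrite /phi cutoff0// ltW.
have [/(_ _ tphi) le_T _] := gauss_torsion_variational rr0 mO Or.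
apply: le_trans le_T.
have [b ->] := torsion_energy_radial rr0 Or tphi.
have mc := @measurable_cball R n.+1 (r + r1).
have b1 : bsupp (\1_(cball n.+1 (r + r1)) : 'rV[R]_n.+1 -> R).
  by apply: (bsupp_indic (ltW rr0)) => //; exact: cball_box.
have DKt : D `<=` cball n.+1 (r + r1).
  move=> x /Dw /= wx; apply: minkowski_combination_bounded.
  by apply: perturbed_profile_gt0; apply: lt_le_trans wx; rewrite mulr_gt0.
have b2 := bsupp_sqr_gradient (ltW rr0) mD (subset_trans DKt (@cball_box R n.+1 _)).
rewrite -RintegralZl//; last exact: bsupp_gauss_integrable.
rewrite -RintegralB//; last 2 first.
- exact: bsupp_gauss_integrable.
- by apply: bsupp_gauss_integrable; exact: bsuppZ.
apply: le_Rintegral => //.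
- by apply: bsupp_gauss_integrable; apply: bsuppB => //; exact: bsuppZ.
- exact: bsupp_gauss_integrable.
move=> x _.
have pE i : partial i phi x = dcutoff (t ^+ 2) (w x) * (- (k (q x) * x 0 i) + t * kr * pz x 0 i).
  by have /(congr1 (fun g => g i x)) := partialE phiC.
under eq_bigr do rewrite pE.
have /andP[d0 d1] := dcutoff_itv (w x) tt.
set d := dcutoff _ _ in d0 d1 *.
(* With U = k x_i and V = t kr z_i, the two sides differ termwise by d (1 - d) (V - U)^2,
   nonnegative for every slope d in [0, 1]. *)
have main : d * (sqr_gradient x - (kr * t) ^+ 2 * edot (pz x) (pz x)) <=
    \sum_(i < n.+1) (2 * - (k (q x) * x 0 i) * (d * (- (k (q x) * x 0 i) + t * kr * pz x 0 i)) -
      (d * (- (k (q x) * x 0 i) + t * kr * pz x 0 i)) ^+ 2).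
  rewrite /sqr_gradient /edot !mulr_sumr -sumrB mulr_sumr; apply: ler_sum => i _.
  rewrite -/(edot x x); set U := k (q x) * x 0 i; set V := t * kr * pz x 0 i.
  rewrite -subr_ge0 (_ : _ - _ = d * (1 - d) * (V - U) ^+ 2).
    by rewrite mulr_ge0 ?sqr_ge0// mulr_ge0// subr_ge0.
  by rewrite /U /V; ring.
apply: le_trans main.
have zr : edot (pz x) (pz x) <= r1 ^+ 2.
  rewrite -sqr_enorm lerXn2r ?nnegrE ?enorm_ge0 ?(ltW r10)//.
  by apply: Kr; exact: penalized_argmaxK.
have z0 := edot_ge0 (pz x).
have F0 := sqr_gradient_ge0 x.
have kz : (kr * t) ^+ 2 * edot (pz x) (pz x) <= (kr * t * r1) ^+ 2.
  by rewrite [leRHS]exprMn ler_wpM2l ?sqr_ge0.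
have kz0 : 0 <= (kr * t) ^+ 2 * edot (pz x) (pz x) by rewrite mulr_ge0 ?sqr_ge0.
rewrite !indicE; have [xD|xD] := boolP (x \in D).
  have /DKt xc : D x by rewrite -in_setE.
  have dE : d = 1 by apply: dcutoff1 => //; apply: Dw; rewrite -in_setE.
  by rewrite dE !mul1r mem_set// mulr1 lerD2l lerN2.
rewrite mul0r sub0r; have [xc|xc] := boolP (x \in cball n.+1 (r + r1)).
  by rewrite mulr1; nra.
(* Outside the ball containing K_t, w cannot be positive. *)
have -> : d = 0.
  apply: dcutoff0 => //; rewrite leNgt; apply/negP => wx; move: xc => /negP; apply.
  rewrite in_setE; apply: minkowski_combination_bounded.
  by apply: perturbed_profile_gt0; exact: lt_trans wx.
by rewrite mulr0 mul0r oppr0.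
Qed.

End convex_combination.

(** * First-order expansion *)

(** Convexity of the power on the half-line. It bounds the volume of the star set from below
    (tangent at r) and that of the shell from above (tangent at r + e). *)
Lemma exprS_tangent (R : realDomainType) (n : nat) (x y : R) : 0 <= x -> 0 <= y ->
  y ^+ n.+1 + n.+1%:R * y ^+ n * (x - y) <= x ^+ n.+1.
Proof.
move=> x0 y0; elim: n => [|n IH]; first by rewrite expr0 !expr1 mulr1 mul1r addrC subrK.
rewrite [leRHS]exprS; apply: (le_trans _ (ler_wpM2l x0 IH)); rewrite -subr_ge0.
have -> : x * (y ^+ n.+1 + n.+1%:R * y ^+ n * (x - y)) -
    (y ^+ n.+2 + n.+2%:R * y ^+ n.+1 * (x - y)) = n.+1%:R * y ^+ n * (x - y) ^+ 2.
  have -> : n.+2%:R = n.+1%:R + 1 :> R by rewrite natr1.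
  by rewrite !exprS; ring.
by rewrite mulr_ge0 ?sqr_ge0// mulr_ge0// exprn_ge0.
Qed.

Lemma sqr_le_itv (R : realDomainType) (a x : R) : - a <= x -> x <= a -> x ^+ 2 <= a ^+ 2.
Proof.
move=> h1 h2; rewrite -subr_ge0 subr_sqr mulr_ge0// ?subr_ge0//.
by rewrite -lerBlDr sub0r lerNl.
Qed.

(** The inclusion of the star set in {w >= 2t^2}, read along a ray: s is |x| and h the support
    function in that direction. The last term is twice the correction in [perturbed_profile],
    because regularising the support function costs as much again. *)
Lemma perturbed_radius (R : realType) (n : nat) (r r1 : R) : 0 < r -> 0 < r1 ->
  let P := @radial_potential R n.+1 in let kr := @radial_kernel R n.+1 (r ^+ 2 / 2) in
  exists2 C1 : R, 0 <= C1 & forall t s h : R, 0 < t -> t <= 1 -> t * r1 <= r ->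
    0 <= s -> 0 <= h -> h <= r1 -> s <= r + t * (h - r) - C1 * t ^+ 2 ->
    2 * t ^+ 2 <= P (r ^+ 2 / 2) - P (s ^+ 2 / 2) + t * kr * (s * h - r ^+ 2) -
                  kr * t ^+ 2 * r1 ^+ 2.
Proof.
move=> r0 r10 P kr; set k := @radial_kernel R n.+1 in kr *.
have [r0' r10'] := (ltW r0, ltW r10).
have qr0 : 0 <= r ^+ 2 / 2 by rewrite divr_ge0 ?sqr_ge0.
have kr0 : 0 < kr by exact: kernel_gt0.
(* Q bounds s^2/2, because t r1 <= r forces s <= 2r. *)
pose Q := 2 * r ^+ 2; pose L := @radial_dkernel R n.+1 Q.
have Q0 : 0 <= Q by rewrite mulr_ge0 ?sqr_ge0.
have L0 : 0 <= L by exact: dkernel_ge0.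
(* When D >= C0 t, the lower bound 1/(n + 1) on the kernel yields (2 + kr (r^2 + r1^2)) t, enough
   for all the negative terms. *)
pose C0 := n.+1%:R * (2 + kr * (r ^+ 2 + r1 ^+ 2)).
have krr : 0 <= kr * (r ^+ 2 + r1 ^+ 2) by rewrite mulr_ge0 ?(ltW kr0) ?addr_ge0 ?sqr_ge0.
have C00 : 0 <= C0 by rewrite mulr_ge0 ?addr_ge0.
(* Bounds for |D|/t and |s - r|/t in the remaining range D < C0 t. *)
pose CD := C0 + 2 * r * r1; pose Cs := r1 + 2 * C0 / r.
have rr1 : 0 < r * r1 by rewrite mulr_gt0.
have Cs0 : 0 <= Cs by apply: addr_ge0 => //; apply: divr_ge0 => //; exact: mulr_ge0.
(* Collects the second-order errors: Cs^2/2 from D = - r (s - r) - (s - r)^2/2, Cs r1 from t (s - r)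
   h, r1^2 from the last term, L CD^2 from replacing the kernel at s by kr, and 2 from the target
   height. *)
pose C1 := (Cs ^+ 2 / 2 + Cs * r1 + r1 ^+ 2 + (L * CD ^+ 2 + 2) / kr) / r.
have C1E : kr * (r * C1) = kr * (Cs ^+ 2 / 2 + Cs * r1 + r1 ^+ 2) + (L * CD ^+ 2 + 2).
  by rewrite /C1; field; rewrite !gt_eqF.
have C10 : 0 <= C1.
  apply: divr_ge0; last exact: ltW.
  have e1 : 0 <= L * CD ^+ 2 + 2 by rewrite addr_ge0// mulr_ge0 ?sqr_ge0.
  by rewrite addr_ge0 ?divr_ge0 ?(ltW kr0)// !addr_ge0 ?divr_ge0 ?mulr_ge0 ?sqr_ge0// ltW.
exists C1 => // t s h t0 t1 tr s0 h0 hr sC.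
have tt0 : 0 <= t ^+ 2 := sqr_ge0 t.
have C1t : 0 <= C1 * t ^+ 2 by rewrite mulr_ge0.
have tr0 : 0 < t * r by rewrite mulr_gt0.
have thr : t * h <= t * r1 by rewrite ler_wpM2l// ltW.
have sr : s - r <= t * r1 by lra.
have s2r : s <= 2 * r by lra.
pose D := (r ^+ 2 - s ^+ 2) / 2.
have DE : 2 * D = (r - s) * (r + s) by rewrite /D; field.
have q0 : 0 <= s ^+ 2 / 2 by rewrite divr_ge0 ?sqr_ge0.
have tg : k (s ^+ 2 / 2) * D <= P (r ^+ 2 / 2) - P (s ^+ 2 / 2).
  have := potential_tangent (ltn0Sn n) qr0 q0; rewrite -/P -/k.
  by have -> : r ^+ 2 / 2 - s ^+ 2 / 2 = D by rewrite /D; ring.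
have t2 : t ^+ 2 <= t by rewrite expr2 ler_piMl// ltW.
(* Well inside the sphere k >= 1 / (n + 1) suffices; near it, expand to second order. *)
have [Df|Dn] := lerP (C0 * t) D.
  have D0 : 0 <= D by apply: le_trans Df; rewrite mulr_ge0// ltW.
  have k1 : (2 + kr * (r ^+ 2 + r1 ^+ 2)) * t <= k (s ^+ 2 / 2) * D.
    apply: (le_trans _ (ler_wpM2r D0 (kernel_ge (ltn0Sn n) q0))).
    by rewrite ler_pdivlMl// mulrA.
  have k2 : kr * r1 ^+ 2 * t ^+ 2 <= kr * r1 ^+ 2 * t.
    by rewrite ler_wpM2l// mulr_ge0 ?sqr_ge0// ltW.
  have k3 : 0 <= t * kr * (s * h) by rewrite !mulr_ge0// ltW.
  move: (P _) (P _) tg => p1 p2 tg.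
  by clear - t2 k1 k2 k3 tg; lra.
have rs0 : 0 <= r + s by rewrite addr_ge0// ltW.
have Dlo : - (CD * t) <= D.
  have d1 : (s - r) * (r + s) <= t * r1 * (r + s) by rewrite ler_wpM2r.
  have d2 : t * r1 * (r + s) <= t * r1 * (3 * r) by rewrite ler_wpM2l ?mulr_ge0 ?ltW//; lra.
  have d3 : 0 <= C0 * t by rewrite mulr_ge0// ltW.
  have d4 : 0 <= t * r1 * r by rewrite !mulr_ge0// ltW.
  by rewrite /CD; lra.
have Dhi : D <= CD * t.
  have d3 : 0 <= 2 * r * r1 * t by rewrite !mulr_ge0// ltW.
  by rewrite /CD; lra.
have D2 : D ^+ 2 <= CD ^+ 2 * t ^+ 2.
  by rewrite -exprMn sqr_le_itv.
have tr10 : 0 <= t * r1 by rewrite mulr_ge0// ltW.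
have Ct0 : 0 <= 2 * C0 * t / r by apply: divr_ge0 => //; apply: mulr_ge0; [exact: mulr_ge0|exact: ltW].
have CsE : Cs * t = t * r1 + 2 * C0 * t / r by rewrite /Cs; field; rewrite gt_eqF.
have slo : - (Cs * t) <= s - r.
  suff : r - s <= 2 * C0 * t / r by lra.
  have [rs|rs] := lerP (r - s) 0; first exact: le_trans rs _.
  rewrite ler_pdivlMr//; apply: (@le_trans _ _ ((r - s) * (r + s))).
    by rewrite ler_wpM2l ?lerDl// ltW.
  by rewrite -DE; lra.
have shi : s - r <= Cs * t by rewrite CsE; lra.
have s2 : (s - r) ^+ 2 <= Cs ^+ 2 * t ^+ 2 by rewrite -exprMn sqr_le_itv.
have q2 : s ^+ 2 / 2 <= Q.
  have : s ^+ 2 <= (2 * r) ^+ 2 by rewrite sqr_le_itv//; lra.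
  by rewrite /Q; lra.
have lip : kr * D - L * D ^+ 2 <= k (s ^+ 2 / 2) * D.
  have qQ : r ^+ 2 / 2 <= Q by have := sqr_ge0 r; rewrite /Q; lra.
  have := kernel_lipschitz (ltn0Sn n) qr0 qQ q0 q2; rewrite -/k -/kr -/L.
  have -> : r ^+ 2 / 2 - s ^+ 2 / 2 = D by rewrite /D; ring.
  move=> /(ler_wpM2r (normr_ge0 D)) /=; rewrite -normrM -[L * _ * _]mulrA
    -[`|D| * _]normrM -expr2 (ger0_norm (sqr_ge0 D)).
  by move=> /(le_trans (ler_norm _)); lra.
have th : - (Cs * r1 * t ^+ 2) <= t * ((s - r) * h).
  have h1 : - (Cs * t) * h <= (s - r) * h by rewrite ler_wpM2r.
  have h2 : Cs * t * h <= Cs * t * r1 by rewrite ler_wpM2l// mulr_ge0// ltW.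
  have h3 : t * - (Cs * t * r1) <= t * ((s - r) * h).
    by apply: ler_wpM2l; [exact: ltW|clear - h1 h2; lra].
  by lra.
have rr : r * (s - r) <= r * (t * (h - r) - C1 * t ^+ 2) by rewrite ler_wpM2l//; lra.
(* The first-order terms r t (h - r) coming from D and from t (s h - r^2) cancel here. *)
have in_brackets : r * C1 * t ^+ 2 - Cs ^+ 2 * t ^+ 2 / 2 - Cs * r1 * t ^+ 2 - t ^+ 2 * r1 ^+ 2 <=
    D + t * (s * h - r ^+ 2) - t ^+ 2 * r1 ^+ 2.
  have -> : D = - (r * (s - r)) - (s - r) ^+ 2 / 2 by rewrite /D; field.
  by clear - th rr s2; lra.
have {in_brackets} := ler_wpM2l (ltW kr0) in_brackets.
have L2 : L * D ^+ 2 <= L * (CD ^+ 2 * t ^+ 2) by rewrite ler_wpM2l.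
have := congr1 (fun z => z * t ^+ 2) C1E.
move: (P _) (P _) (k (_ / 2)) tg lip => p1 p2 k1 tg lip; clear - tg lip L2.
move: D Cs CD L C1 L2 tg lip => D Cs CD L C1; lra.
Qed.

Lemma continuous_mul (R : realType) (T : topologicalType) (f g : T -> R) :
  continuous f -> continuous g -> continuous (fun x => f x * g x).
Proof. by move=> cf cg x; exact: (cvgM (cf x) (cg x)). Qed.

(** * Comparison of energies in a thin shell *)

Section shell.
Context (R : realType) (n : nat) (r : R).
Hypothesis r0 : 0 < r.

Local Notation lam := (lebesgue_row R n.+1).
Local Notation gam := (gauss_row R n.+1).
Local Notation kap := (unit_ball_volume R n.+1).
Local Notation c0 := ((2 * pi : R) `^ (- (n.+1%:R / 2))).
Local Notation gd := (@gradient_density R n.+1).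
Local Notation q x := (edot x x / 2).

Lemma Rintegral_lebesgue_indic (A : set 'rV[R]_n.+1) (s : R) : 0 <= s -> measurable A ->
  A `<=` cball n.+1 s -> bsupp (\1_A : 'rV[R]_n.+1 -> R) /\ \int[lam]_x \1_A x = fine (lam A).
Proof.
move=> s0 mA As; split; first exact: (bsupp_indic s0 mA (subset_trans As (@cball_box R n.+1 s))).
by rewrite /Rintegral integral_indic// setIT.
Qed.

Lemma gauss_sqr_gradientE (A : set 'rV[R]_n.+1) (s : R) : 0 <= s -> measurable A ->
  A `<=` cball n.+1 s ->
  \int[gam]_x (\1_A x * sqr_gradient x) = \int[lam]_x (\1_A x * (c0 * gd (q x))).
Proof.
move=> s0 mA As; rewrite gauss_RintegralE; last first.
  exact: (bsupp_sqr_gradient s0 mA (subset_trans As (@cball_box R n.+1 s))).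
apply: eq_Rintegral => x _; rewrite gauss_densityE /sqr_gradient /gradient_density.
by field.
Qed.

(* The sets differ only in the shell r - e < |x| <= r + e, where the density
   is within O(e) of its value at |x| = r. *)
Lemma gauss_sqr_gradient_shell (A : set 'rV[R]_n.+1) (e : R) : 0 < e -> e <= r / 2 ->
  measurable A -> cball n.+1 (r - e) `<=` A -> A `<=` cball n.+1 (r + e) ->
  \int[gam]_x (\1_(cball n.+1 r) x * sqr_gradient x) +
    c0 * gd (r ^+ 2 / 2) * (fine (lam A) - r ^+ n.+1 * kap) -
    c0 * @gradient_density_lip R n.+1 (2 * r ^+ 2) * (3 * r / 2) * kap *
      (n.+1%:R * (2 * r) ^+ n) * 2 * e ^+ 2 <=
  \int[gam]_x (\1_A x * sqr_gradient x).
Proof.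
move=> e0 er mA Ai Ao.
have re0 : 0 < r - e by lra.
have rp0 : 0 < r + e by lra.
have mB s : measurable (cball n.+1 s : set 'rV[R]_n.+1) by exact: measurable_cball.
have sub s s' : s <= s' -> cball n.+1 s `<=` (cball n.+1 s' : set 'rV[R]_n.+1).
  by move=> ss x; rewrite /cball/= => /le_trans; apply.
have [bA lA] := Rintegral_lebesgue_indic (ltW rp0) mA Ao.
have vB s : 0 < s -> bsupp (\1_(cball n.+1 s) : 'rV[R]_n.+1 -> R) /\
    \int[lam]_x \1_(cball n.+1 s) x = s ^+ n.+1 * kap.
  move=> s0; have [b ->] := Rintegral_lebesgue_indic (ltW s0) (mB s) (@subset_refl _ _).
  by rewrite lebesgue_row_cball.
have [bB lB] := vB _ r0; have [bi li] := vB _ re0; have [bo lo] := vB _ rp0.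
rewrite (gauss_sqr_gradientE (ltW rp0) mA Ao).
rewrite (gauss_sqr_gradientE (ltW r0) (mB r) (@subset_refl _ _)).
pose F (x : 'rV[R]_n.+1) := c0 * gd (q x).
have cF : continuous F.
  have FE : F = (fun x => sqr_gradient x * gauss_density x).
    apply/funext => x; rewrite /F gauss_densityE /sqr_gradient /gradient_density.
    by field.
  rewrite FE; apply: continuous_mul; first exact: continuous_sqr_gradient.
  by have [] := is_C1_gauss_density R n.+1.
set f := c0 * gd (r ^+ 2 / 2).
(* Bounds |F - f| in the shell: |x| is within e of r and e <= r/2, so q varies by at most (3r/2)
   e. *)
pose E := c0 * @gradient_density_lip R n.+1 (2 * r ^+ 2) * (3 * r / 2) * e.
have ib (g : 'rV[R]_n.+1 -> R) : bsupp g -> lam.-integrable setT (EFin \o g).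
  exact: bsupp_lebesgue_integrable.
have shell_vol : (r + e) ^+ n.+1 * kap - (r - e) ^+ n.+1 * kap <= n.+1%:R * (2 * r) ^+ n * (2 * e) * kap.
  rewrite -mulrBl ler_wpM2r ?(ltW (unit_ball_volume_gt0 _ _))//.
  have := exprS_tangent n (ltW re0) (ltW rp0).
  have : (r + e) ^+ n <= (2 * r) ^+ n by rewrite lerXn2r ?nnegrE//; lra.
  move=> h1; have h2 : n.+1%:R * (r + e) ^+ n * (2 * e) <= n.+1%:R * (2 * r) ^+ n * (2 * e).
    by rewrite ler_wpM2r ?ler_wpM2l//; lra.
  by rewrite (_ : r - e - (r + e) = - (2 * e)); lra.
have c00 : 0 <= c0 by exact: powR_ge0.
have Q0 : 0 <= 2 * r ^+ 2 by rewrite mulr_ge0 ?sqr_ge0.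
have L0 : 0 <= @gradient_density_lip R n.+1 (2 * r ^+ 2).
  have kQ := ltW (kernel_gt0 (ltn0Sn n) Q0); have dQ := dkernel_ge0 (ltn0Sn n) Q0.
  rewrite /gradient_density_lip; apply: addr_ge0; first apply: addr_ge0.
  - by rewrite mulr_ge0 ?sqr_ge0.
  - by do 3 apply: mulr_ge0 => //.
  - by apply: mulr_ge0; [apply: mulr_ge0|exact: sqr_ge0].
have E0 : 0 <= E.
  apply: mulr_ge0; last exact: ltW.
  by apply: mulr_ge0; [exact: mulr_ge0|lra].
have main : \int[lam]_x (\1_(cball n.+1 r) x * F x) + f * (fine (lam A) - r ^+ n.+1 * kap) -
    E * ((r + e) ^+ n.+1 * kap - (r - e) ^+ n.+1 * kap) <= \int[lam]_x (\1_A x * F x).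
  rewrite -lA -lB -li -lo.
  have b1 := bsuppMc bA cF; have b2 := bsuppMc bB cF.
  have b3 := bsuppB bA bB; have b4 := bsuppB bo bi.
  rewrite -!RintegralB//; try exact: ib.
  rewrite -!RintegralZl//; try exact: ib.
  rewrite -RintegralD//; try (by apply: ib => //; exact: bsuppZ).
  rewrite -RintegralB//; last 2 first.
  - by apply: ib; apply: bsuppD => //; exact: bsuppZ.
  - by apply: ib; exact: bsuppZ.
  apply: le_Rintegral => //; try exact: ib.
    by apply: ib; apply: bsuppB; [apply: bsuppD => //|]; exact: bsuppZ.
  move=> x _; rewrite -subr_ge0.
  set a := \1_A x; set b := \1_(cball n.+1 r) x.
  set o := \1_(cball n.+1 (r + e)) x; set i := \1_(cball n.+1 (r - e)) x.
  (* Off the shell a = b; on it o - i = 1 and |a - b| <= 1, so the second term absorbs the first. *)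
  rewrite (_ : _ - _ = (a - b) * (F x - f) + E * (o - i)); last by ring.
  have [xo|xo] := boolP (x \in cball n.+1 (r + e)); last first.
    have nB : x \notin cball n.+1 r.
      by apply: contra xo; rewrite !in_setE; apply: sub; lra.
    have nA : x \notin A by apply: contra xo; rewrite !in_setE; exact: Ao.
    have ni : x \notin cball n.+1 (r - e).
      by apply: contra xo; rewrite !in_setE; apply: sub; lra.
    rewrite /a /b /o /i !indicE (negbTE nA) (negbTE nB) (negbTE ni) (negbTE xo).
    by rewrite !subrr mul0r mulr0 addr0.
  have oE : o = 1 by rewrite /o indicE xo.
  have [xi|xi] := boolP (x \in cball n.+1 (r - e)).
    have yB : x \in cball n.+1 r.
      by move: xi; rewrite !in_setE; apply: sub; lra.
    have yA : x \in A by move: xi; rewrite !in_setE; exact: Ai.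
    by rewrite oE /a /b /i !indicE yA yB xi !subrr mul0r mulr0 addr0.
  have iE : i = 0 by rewrite /i indicE (negbTE xi).
  rewrite oE iE subr0 mulr1.
  have FE : `|F x - f| <= E.
    have s1 : enorm x <= r + e by move: xo; rewrite in_setE.
    have s2 : r - e < enorm x.
      by rewrite ltNge; apply: contra xi; rewrite in_setE.
    have xE := sqr_enorm x; have s0 := enorm_ge0 x.
    move: (enorm x) => s in s1 s2 xE s0.
    have d1 : `|q x - r ^+ 2 / 2| <= 3 * r / 2 * e.
      have -> : q x - r ^+ 2 / 2 = (s - r) * ((s + r) / 2) by rewrite -xE; field.
      rewrite normrM mulrC ler_pM// ler_norml; apply/andP; split; lra.
    have qQ : r ^+ 2 / 2 <= 2 * r ^+ 2 by have := sqr_ge0 r; lra.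
    have xQ : q x <= 2 * r ^+ 2.
      have : s ^+ 2 <= (2 * r) ^+ 2 by rewrite lerXn2r ?nnegrE//; lra.
      by rewrite xE; lra.
    have := gradient_density_lipschitz (ltn0Sn n) (divr_ge0 (edot_ge0 x) (ler0n R 2)) xQ
      (divr_ge0 (sqr_ge0 r) (ler0n R 2)) qQ.
    move=> /le_trans /(_ (ler_wpM2l L0 d1)) d2.
    rewrite /F /f -mulrBr normrM ger0_norm//.
    by apply: (le_trans (ler_wpM2l c00 d2)); rewrite /E !mulrA.
  have ab : `|a - b| <= 1.
    by rewrite /a /b !indicE; do 2 case: (_ \in _); rewrite ?subrr ?subr0 ?sub0r ?normrN ?normr0 ?normr1.
  have : `|(a - b) * (F x - f)| <= E by rewrite normrM -[leRHS]mul1r ler_pM.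
  by rewrite ler_norml => /andP[+ _]; rewrite -lerBlDr sub0r.
apply: le_trans main.
have := ler_wpM2l E0 shell_vol; rewrite /E.
move: (\int[lam]_x _) => I; lra.
Qed.
End shell.

(** * Volume of the star set *)

Section star.
Context (R : realType) (n : nat) (K : set 'rV[R]_n.+1) (r r1 C1 t : R).
Hypotheses (K0 : K 0) (Kr : K `<=` cball n.+1 r1) (r0 : 0 < r) (r10 : 0 < r1).
Hypotheses (C10 : 0 <= C1) (t0 : 0 < t).

Local Notation c := (r + r1 + C1 + 1).
Hypothesis tc : t * (2 * c) <= r.

Local Notation lam := (lebesgue_row R n.+1).
Local Notation kap := (unit_ball_volume R n.+1).
Local Notation H x := (support_function K (direction x)).

Definition star_radius (x : 'rV[R]_n.+1) : R := r + t * (H x - r) - C1 * t ^+ 2.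

Definition star_set : set 'rV[R]_n.+1 := [set x | enorm x <= star_radius x].

Lemma star_time_le1 : t <= 1 / 2.
Proof.
have h : 2 * r <= 2 * c by have := r10; have := C10; lra.
rewrite -(@ler_pM2r _ (2 * r)) ?mulr_gt0//; apply: (le_trans (ler_wpM2l (ltW t0) h)).
by apply: (le_trans tc); lra.
Qed.

Let tt : t ^+ 2 <= t.
Proof. by have := star_time_le1; have := t0; nra. Qed.

Let H0 x : 0 <= H x. Proof. exact: (support_function_ge0 K0 Kr). Qed.

Let Hr x : H x <= r1. Proof. exact: (support_function_direction_le K0 Kr). Qed.

Lemma measurable_star_radius : measurable_fun setT star_radius.
Proof.
have mH : measurable_fun setT (fun x => H x).
  apply: measurableT_comp; last exact: measurable_direction.
  by apply: continuous_measurable_row; exact: (continuous_support_function K0 Kr).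
apply: measurable_funB => //; apply: measurable_funD => //.
by apply: measurable_funM => //; exact: measurable_funB.
Qed.

Lemma measurable_star_set : measurable star_set.
Proof.
rewrite (_ : star_set = [set: _] `&` [set x | (enorm x <= star_radius x)%R]); last by rewrite setTI.
apply: measurable_fun_le => //; [exact: measurable_enorm|exact: measurable_star_radius].
Qed.

(** The summand 1 in [c] pays for the extra t^2 on the left. This keeps the radius above t^2, the
    mesh at which the volume is discretised. *)
Lemma star_radius_itv x : r - c * t + t ^+ 2 <= star_radius x /\ star_radius x <= r + c * t.
Proof.
have := H0 x; have := Hr x; rewrite /star_radius => h1 h2.
have h3 : t * H x <= t * r1 by rewrite ler_wpM2l// ltW.
have h4 : 0 <= t * H x by rewrite mulr_ge0// ltW.
have h5 : C1 * t ^+ 2 <= C1 * t by rewrite ler_wpM2l.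
have h6 : 0 <= C1 * t ^+ 2 by rewrite mulr_ge0 ?sqr_ge0.
have h7 : 0 <= r * t by rewrite mulr_ge0// ltW.
have h8 : 0 <= r1 * t by rewrite mulr_ge0// ltW.
by have := t0; have := tt; split; lra.
Qed.

Lemma cball_star_set : cball n.+1 (r - c * t) `<=` star_set.
Proof.
move=> x; rewrite /cball /star_set/= => xr; have [+ _] := star_radius_itv x.
by move: xr; have := sqr_ge0 t; lra.
Qed.

Lemma star_set_cball : star_set `<=` cball n.+1 (r + c * t).
Proof.
by move=> x; rewrite /star_set/= => /le_trans; apply; have [] := star_radius_itv x.
Qed.

(** The mesh t^2 in [lebesgue_row_star_ge] costs only second order and turns C1 into C1 + 1; the
    power of the radius is then minorised by its tangent at r, which is affine in the support
    function. *)
Lemma lebesgue_row_star_set_ge :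
  r ^+ n.+1 * kap + n.+1%:R * r ^+ n * kap *
    (t * mean_support_excess r K - (C1 + 1) * t ^+ 2) <= fine (lam star_set).
Proof.
have rc0 : 0 < r - c * t by have := tc; have := r0; lra.
have tt0 : 0 < t ^+ 2 by rewrite exprn_gt0.
have dl x : t ^+ 2 <= star_radius x by have [+ _] := star_radius_itv x; lra.
have dirZ (s : R) (x : 'rV[R]_n.+1) : 0 < s -> direction (s *: x) = direction x.
  move=> s0; rewrite /direction enormZ gtr0_norm// scalerA invfM -mulrA mulrCA mulVf ?mulr1//.
  by rewrite gt_eqF.
have aZ (s : R) x : 0 < s -> star_radius (s *: x) = star_radius x.
  by move=> s0; rewrite /star_radius dirZ.
have := lebesgue_row_star_ge tt0 measurable_star_radius aZ dl.
rewrite -/star_set => vol.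
have rct : 0 <= r + c * t by have [_] := star_radius_itv 0; have := dl 0; move: tt0; lra.
have lA : (lam star_set < +oo)%E.
  apply: le_lt_trans (lebesgue_row_cball_lty _ (r + c * t)).
  apply: le_measure; rewrite ?inE; [exact: measurable_star_set|exact: measurable_cball|].
  exact: star_set_cball.
rewrite -lee_fin fineK ?ge0_fin_numE//; apply: le_trans vol.
have mb : measurable (cball n.+1 1 : set 'rV[R]_n.+1) by exact: measurable_cball.
have ib (g : 'rV[R]_n.+1 -> R) (M : R) : measurable_fun setT g -> (forall x, `|g x| <= M) ->
    lam.-integrable (cball n.+1 1) (EFin \o g).
  move=> mg gM; apply: (@measurable_bounded_integrable _ _ _ lam) => //.
  - exact: lebesgue_row_cball_lty.
  - exact: measurable_funTS.
  - exists M; split; first exact: num_real.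
    by move=> y My x _; apply: le_trans (gM x) (ltW My).
have mG : measurable_fun setT (fun x : 'rV[R]_n.+1 => star_radius x - t ^+ 2).
  by apply: measurable_funB => //; exact: measurable_star_radius.
have iP : lam.-integrable (cball n.+1 1) (EFin \o (fun x => (star_radius x - t ^+ 2) ^+ n.+1)).
  apply: (ib _ ((r + c * t) ^+ n.+1)).
    exact: (@measurable_funX _ _ _ _ _ n.+1 mG).
  move=> x; have [_ ax] := star_radius_itv x; have dx := dl x.
  by rewrite ger0_norm ?exprn_ge0 ?subr_ge0// lerXn2r ?nnegrE ?subr_ge0//; lra.
have mH : measurable_fun setT (fun x : 'rV[R]_n.+1 => H x - r).
  apply: measurable_funB => //.
  apply: measurableT_comp; last exact: measurable_direction.
  by apply: continuous_measurable_row; exact: (continuous_support_function K0 Kr).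
have iH : lam.-integrable (cball n.+1 1) (EFin \o (fun x => H x - r)).
  apply: (ib _ (r + r1)) => // x; rewrite ler_norml.
  by apply/andP; split; have := H0 x; have := Hr x; lra.
have i1 (k : R) : lam.-integrable (cball n.+1 1) (EFin \o (cst k : 'rV[R]_n.+1 -> R)).
  by apply: (ib _ `|k|).
pose G x := (r ^+ n.+1 - n.+1%:R * r ^+ n * ((C1 + 1) * t ^+ 2)) + n.+1%:R * r ^+ n * t * (H x - r).
have iZ : lam.-integrable (cball n.+1 1) (EFin \o (fun x => n.+1%:R * r ^+ n * t * (H x - r))).
  exact: (integrableZl mb _ iH).
have iG : lam.-integrable (cball n.+1 1) (EFin \o G).
  exact: (integrableD mb (i1 _) iZ).
have GE : \int[lam]_(x in cball n.+1 1) G x = r ^+ n.+1 * kap + n.+1%:R * r ^+ n * kap *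
    (t * mean_support_excess r K - (C1 + 1) * t ^+ 2).
  rewrite /G RintegralD//; last exact: i1.
  rewrite RintegralZl// (mean_support_excess_cone (ltn0Sn n) r0 K0 Kr).
  rewrite Rintegral_cst//.
  have k0 : kap != 0 by rewrite gt_eqF// unit_ball_volume_gt0.
  by rewrite -/kap; field.
rewrite -GE /Rintegral fineK; last exact: integrable_fin_num.
apply: le_integral => // x _; rewrite lee_fin.
have ax : 0 <= star_radius x - t ^+ 2 by rewrite subr_ge0.
apply: le_trans (exprS_tangent n ax (ltW r0)).
by rewrite /G /star_radius; lra.
Qed.
End star.

(** * Assembly of the first-order expansion *)

Section first_order.
Context (R : realType) (n : nat) (r r1 : R).
Hypotheses (r0 : 0 < r) (r10 : 0 < r1).

Local Notation k := (@radial_kernel R n.+1).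
Local Notation kr := (k (r ^+ 2 / 2)).
Local Notation kap := (unit_ball_volume R n.+1).
Local Notation c0 := ((2 * pi : R) `^ (- (n.+1%:R / 2))).
Local Notation gd := (@gradient_density R n.+1).
Local Notation Kt K t := (minkowski_add (minkowski_scale (1 - t) (cball n.+1 r))
                           (minkowski_scale t K)).

(** The slope is the area of the sphere of radius r times the energy density on it, as in Hadamard's
    variation formula. *)
Lemma torsion_slopeE :
  torsion_slope n.+1 r = n.+1%:R * r ^+ n * kap * (c0 * gd (r ^+ 2 / 2)).
Proof.
rewrite /torsion_slope (derive1_radial_profile (ltn0Sn n) r0) /gradient_density.
rewrite -powRN /=; move: (powR _ _) (expR _) kr => p e s.
by field.
Qed.

Lemma sphere_density_gt0 : 0 < c0 * gd (r ^+ 2 / 2).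
Proof.
have q0 : 0 < r ^+ 2 / 2 by rewrite divr_gt0 ?exprn_gt0.
apply: mulr_gt0; first by rewrite powR_gt0// mulr_gt0// pi_gt0.
apply: mulr_gt0; last exact: expR_gt0.
apply: mulr_gt0; first by rewrite mulr_gt0.
by rewrite exprn_gt0// kernel_gt0// ltW.
Qed.

Lemma torsion_slope_gt0 : 0 < torsion_slope n.+1 r.
Proof.
rewrite torsion_slopeE mulr_gt0 ?sphere_density_gt0//.
by apply: mulr_gt0; [rewrite mulr_gt0// exprn_gt0|exact: unit_ball_volume_gt0].
Qed.

Lemma gauss_torsion_combination_ge : exists t1 C : R, [/\ 0 < t1, 0 < C &
  forall K : set 'rV[R]_n.+1, compact K -> convex_set K -> K `<=` cball n.+1 r1 -> K 0 ->
  forall t, 0 < t -> t <= t1 ->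
    gauss_torsion_body (cball n.+1 r) + torsion_slope n.+1 r * mean_support_excess r K * t -
      C * t ^+ 2 <= gauss_torsion_body (Kt K t)].
Proof.
have [C1 C10 radius] := perturbed_radius n r0 r10.
pose c := r + r1 + C1 + 1.
have c_gt0 : 0 < c by rewrite /c; have := r0; have := r10; move: C10; lra.
pose L := @gradient_density_lip R n.+1 (2 * r ^+ 2).
(* The second-order errors: A1 from the volume of the star set, A2 from the variation of the density
   across the shell, A3 from the energy of the perturbation t kr z. *)
pose A1 := torsion_slope n.+1 r * (C1 + 1).
pose A2 := c0 * L * (3 * r / 2) * kap * (n.+1%:R * (2 * r) ^+ n) * 2 * c ^+ 2.
pose A3 := (kr * r1) ^+ 2 * \int[gauss_row R n.+1]_x \1_(cball n.+1 (r + r1)) x.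
(* This time bound gives c t <= r/2, the width allowed by the shell estimate, and t <= 1/2. Absolute
   values and the summand 1 make the constant positive. *)
exists (r / (2 * c)), (`|A1| + `|A2| + `|A3| + 1).
split; first by rewrite divr_gt0 ?mulr_gt0.
  by rewrite ltr_wpDl ?addr_ge0.
move=> K cK vK Kr K0 t t0 tt1.
have tc : t * (2 * c) <= r by rewrite -ler_pdivlMr ?mulr_gt0.
have t12 := star_time_le1 r0 r10 C10 t0 tc.
have t1 : t < 1 by move: t12; lra.
pose A := star_set K r C1 t.
have mA : measurable A := measurable_star_set r C1 t K0 Kr.
have Aw : A `<=` [set x | 2 * t ^+ 2 <= perturbed_profile r r1 t cK K0 x].
  move=> x; rewrite /A /star_set/= /star_radius => xa.
  have h0 := support_function_ge0 K0 Kr (direction x).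
  have h1 := support_function_direction_le K0 Kr x.
  have tr : t * r1 <= r.
    apply: le_trans tc; apply: ler_wpM2l; first exact: ltW.
    by rewrite /c; have := r0; have := r10; move: C10; lra.
  have := radius _ _ _ t0 (ltW t1) tr (enorm_ge0 x) h0 h1 xa.
  rewrite -(support_function_direction K0 Kr) sqr_enorm => /le_trans; apply.
  (* The penalty is at most t r1^2/2 at every point of K, so regularising lowers the support
     function by no more than that. *)
  have hh : support_function K x - t * r1 ^+ 2 / 2 <= penalized_support t cK K0 x.
    rewrite lerBlDr; apply: (support_function_le K0) => z Kz; rewrite -lerBlDr.
    rewrite edotC; apply: le_trans (penalized_support_ge t cK K0 x Kz).
    rewrite lerD2l lerN2 mulrAC ler_pM2r ?invr_gt0// ler_pM2l//.
    by rewrite -sqr_enorm lerXn2r ?nnegrE ?enorm_ge0 ?(ltW r10)//; exact: Kr.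
  have kr0 : 0 <= t * kr.
    by rewrite mulr_ge0 ?(ltW t0)// ltW// kernel_gt0// divr_ge0 ?sqr_ge0.
  have := ler_wpM2l kr0 hh; rewrite /perturbed_profile.
  move: (radial_potential _ _) (radial_potential _ _) => p1 p2; lra.
have lower := torsion_combination_ge vK Kr r0 r10 t0 t1 mA Aw.
have upper := gauss_torsion_ball_le n r0.
have ct0 : 0 < c * t by rewrite mulr_gt0.
have cr : c * t <= r / 2 by rewrite mulrC; lra.
have shell := gauss_sqr_gradient_shell r0 ct0 cr mA
  (cball_star_set K0 Kr r0 r10 C10 t0 tc) (star_set_cball K0 Kr r0 r10 C10 t0 tc).
have vol := lebesgue_row_star_set_ge K0 Kr r0 r10 C10 t0 tc.
apply: le_trans lower; rewrite lerBrDr; apply: le_trans shell.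
rewrite torsion_slopeE.
have := ler_wpM2l (ltW sphere_density_gt0) vol; clear vol.
have a1 : A1 * t ^+ 2 <= `|A1| * t ^+ 2 by rewrite ler_wpM2r ?sqr_ge0// ler_norm.
have a2 : A2 * t ^+ 2 <= `|A2| * t ^+ 2 by rewrite ler_wpM2r ?sqr_ge0// ler_norm.
have a3 : A3 * t ^+ 2 <= `|A3| * t ^+ 2 by rewrite ler_wpM2r ?sqr_ge0// ler_norm.
have tt := sqr_ge0 t.
move: a1 a2 a3; rewrite {1}/A1 {1}/A2 {1}/A3 torsion_slopeE -/c -/L -/A.
move: `|A1| `|A2| `|A3| => b1 b2 b3.
move: upper; move: (gauss_torsion_body _) => T0.
move: (\int[_]_x (_ * _)) (\int[_]_x \1__ x) => I0 I1.
move: (mean_support_excess r K) (fine _) => M V.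
move: (powR _ _) (gradient_density _ _) (L) kap (c) => p g l v c'.
move: (n.+1%:R) (r ^+ n) (r ^+ n.+1) ((2 * r) ^+ n) kr => m rn rm r2n k1.
clear - tt; lra.
Qed.

End first_order.
Theorem proposition4p3 (R : realType) (n : nat) (rad rad1 : R)
    (hn : (2 <= n)%N) (hrad : 0 < rad) (hrad1 : 0 < rad1) :
  exists t1 C : R, [/\ 0 < t1, 0 < C &
    forall Omega1 : set 'rV[R]_n,
      convex_body Omega1 -> Omega1 `<=` cball n rad1 -> Omega1 0 ->
      let M := mean_support_excess rad Omega1 in
      let K t := minkowski_add (minkowski_scale (1 - t) (cball n rad))
                               (minkowski_scale t Omega1) in
      [/\ M = (mean_width Omega1 - mean_width (cball n rad)) / 2,
          forall t : R, 0 < t -> t <= t1 ->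
            gauss_torsion_body (K t) >=
              gauss_torsion_body (cball n rad)
              + torsion_slope n rad * M * t - C * t ^+ 2 &
          2 * rad < mean_width Omega1 ->
            \forall t \near 0^'+,
              gauss_torsion_body (K t) > gauss_torsion_body (cball n rad)]].
Proof.
case: n hn => [//|m] hn.
have [t1 [C [t10 C0 lower]]] := gauss_torsion_combination_ge m hrad hrad1.
exists t1, C; split=> // K [cK vK _] Kr K0 M Kt.
have ME := mean_support_excessE (ltn0Sn m) hrad K0 Kr.
have low := lower K cK vK Kr K0.
split=> // wK.
have M0 : 0 < M.
  rewrite /M ME divr_gt0// subr_gt0; apply: le_lt_trans wK.
  exact: mean_width_cball_le.
pose s := torsion_slope m.+1 rad * M.
have s0 : 0 < s by rewrite mulr_gt0// torsion_slope_gt0.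
near=> t.
have t0 : 0 < t by near: t; exact: nbhs_right_gt.
have tt1 : t <= t1 by near: t; exact: nbhs_right_le.
(* Below s/C the linear gain s t exceeds the error C t^2. *)
have ts : t < s / C by near: t; apply: nbhs_right_lt; exact: divr_gt0.
apply: lt_le_trans (low t t0 tt1); rewrite -/M -/s -addrA ltrDl.
have -> : s * t - C * t ^+ 2 = t * (s - C * t) by ring.
by rewrite mulr_gt0// subr_gt0 mulrC -ltr_pdivlMr.
Unshelve. all: end_near.
Qed.
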